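(* There exist finite groups $G$ and $H$ of order $288$ such that $M(G)\cong M(H)$ and the $\mathbb{C}$-bijectivity condition holds for $G$ and $H$, but $G\not\sim_{\mathbb{C}} H$. However, if $G$ and $H$ are finite groups such that $M(G)\cong M(H)$, the $\mathbb{C}$-bijectivity condition holds for $G$ and $H$, and additionally $M(G)$ is cyclic or isomorphic to an elementary abelian group of order $4$ or $9$, then $G\sim_{\mathbb{C}}H$.
   Context: For a field $F$, a finite group $G$ and a $2$-cocycle $\alpha \in Z^2(G,F^* )$ (trivial action), the twisted group algebra $F^\alpha G$ is the $F$-vector space with basis $\{u_g\}_{g\in G}$ and multiplication $u_g u_h = \alpha(g,h) u_{gh}$, with $F$ central. Its isomorphism type depends only on $[\alpha] \in H^2(G,F^* )$. One writes $G \sim_F H$ if there is a group isomorphism $\psi: H^2(G,F^* ) \to H^2(H,F^* )$ such that $F^{\alpha}G \cong F^{\psi(\alpha)}H$ for every $[\alpha]\in H^2(G,F^* )$. The $F$-bijectivity condition for $G$ and $H$: there exists a set bijection $\varphi: H^2(G,F^* )\to H^2(H,F^* )$ such that $F^\alpha G\cong F^{\varphi(\alpha)}H$ for every $[\alpha]\in H^2(G,F^* )$. Isomorphisms of twisted group algebras are isomorphisms of $F$-algebras. $M(G)=H^2(G,\mathbb{C}^* )$ is the Schur multiplier of $G$. *)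

(* Defs.v *)
From HB Require Import structures.
From mathcomp Require Import all_boot all_order all_fingroup all_algebra.
From mathcomp Require Import ring_quotient boolp reals complex.

Set Implicit Arguments.
Unset Strict Implicit.
Unset Printing Implicit Defensive.

Import GRing.Theory.
Local Open Scope ring_scope.
Local Open Scope quotient_scope.

(* F^*, written ADDITIVELY so that it is a zmodType: x + y is the product of  *)
(* x and y in F, 0 is 1, and - x is x^-1.                                     *)
Section Units.
Variable F : fieldType.

Record units := Units { uval : F; uvalP : uval != 0 }.

HB.instance Definition _ := [isSub for uval].
HB.instance Definition _ := [Choice of units by <:].

Definition units1 : units := Units (oner_neq0 F).
Definition unitsM (x y : units) : units :=
  Units (mulf_neq0 (uvalP x) (uvalP y)).
Fact unitsV_subproof (x : units) : (uval x)^-1 != 0.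
Proof. by rewrite invr_eq0 uvalP. Qed.
Definition unitsV (x : units) : units := Units (unitsV_subproof x).

Fact unitsMA : associative unitsM.
Proof. by move=> x y z; apply/val_inj; exact: mulrA. Qed.
Fact unitsMC : commutative unitsM.
Proof. by move=> x y; apply/val_inj; exact: mulrC. Qed.
Fact units1M : left_id units1 unitsM.
Proof. by move=> x; apply/val_inj; exact: mul1r. Qed.
Fact unitsVM : left_inverse units1 unitsV unitsM.
Proof. by move=> x; apply/val_inj; exact: mulVf (uvalP x). Qed.

HB.instance Definition _ :=
  GRing.isZmodule.Build units unitsMA unitsMC units1M unitsVM.

Lemma uvalD (x y : units) : uval (x + y) = uval x * uval y.
Proof. by []. Qed.
Lemma uvalN (x : units) : uval (- x) = (uval x)^-1.
Proof. by []. Qed.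
Lemma uval0 : uval 0 = 1.
Proof. by []. Qed.
End Units.

(* Second cohomology of a finite group with coefficients in a trivial module, *)
(* the latter written additively; cocycles are not assumed normalized.        *)
Section Cohomology.
Variables (A : zmodType) (G : finGroupType).

Definition Z2 : {pred {ffun G * G -> A}} := fun a =>
  [forall g, forall h, forall k,
     a (g, h) + a ((g * h)%g, k) == a (h, k) + a (g, (h * k)%g)].

Lemma Z2P (a : {ffun G * G -> A}) :
  reflect (forall g h k,
             a (g, h) + a ((g * h)%g, k) = a (h, k) + a (g, (h * k)%g))
          (a \in Z2).
Proof.
apply: (iffP forallP) => [aP g h k | aP g].
  by have /forallP/(_ h)/forallP/(_ k)/eqP := aP g.
by apply/forallP => h; apply/forallP => k; apply/eqP.
Qed.

Fact Z2_zmod_closed : zmod_closed Z2.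
Proof.
split=> [|a b /Z2P aP /Z2P bP]; apply/Z2P => g h k; rewrite !ffunE ?addr0 //.
by rewrite addrACA aP -opprD bP opprD addrACA.
Qed.
HB.instance Definition _ := GRing.isZmodClosed.Build _ Z2 Z2_zmod_closed.

Record cocycle :=
  Cocycle { cocycle_val :> {ffun G * G -> A}; cocycleP : cocycle_val \in Z2 }.

HB.instance Definition _ := [isSub for cocycle_val].
HB.instance Definition _ := [Choice of cocycle by <:].
HB.instance Definition _ := [SubChoice_isSubZmodule of cocycle by <:].

Definition B2 : {pred cocycle} := fun a =>
  `[< exists b : G -> A, forall g h, a (g, h) = b g + b h - b (g * h)%g >].

Lemma B2P (a : cocycle) :
  reflect (exists b : G -> A, forall g h, a (g, h) = b g + b h - b (g * h)%g)
          (a \in B2).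
Proof. by rewrite unfold_in; exact: asboolP. Qed.

Fact B2_zmod_closed : zmod_closed B2.
Proof.
split=> [|a b].
  by apply/B2P; exists (fun=> 0) => g h; rewrite subr0 addr0 [LHS]ffunE.
move=> /B2P[s sP] /B2P[t tP]; apply/B2P.
exists (fun g => s g - t g) => g h.
by rewrite !ffunE sP tP opprD addrACA (addrACA (s g) (- t g)) -!opprD.
Qed.
HB.instance Definition _ := GRing.isZmodClosed.Build _ B2 B2_zmod_closed.

Definition H2 : zmodType := Quotient.quot B2.

Definition class2 (a : cocycle) : H2 := \pi_(Quotient.quot B2) a.
End Cohomology.

(* The twisted group algebra F^a G: elements are the coordinate functions     *)
(* with respect to the basis u_g.                                             *)
Definition twisted_alg (F : fieldType) (G : finGroupType)
  (a : cocycle (units F) G) : Type := {ffun G -> F^o}.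

Section TwistedGroupAlgebra.
Variables (F : fieldType) (G : finGroupType) (a : cocycle (units F) G).
Local Notation T := (twisted_alg a).

HB.instance Definition _ := GRing.Lmodule.copy T {ffun G -> F^o}.

Definition tw_basis (g : G) : T := [ffun k => (k == g)%:R].

Local Notation u := tw_basis.
Local Notation c := (fun g h => uval (a (g, h))).

Definition tw_mul (x y : T) : T :=
  \sum_g \sum_h (x g * y h * c g h) *: u (g * h)%g.

(* u 1 itself is the unit only when the cocycle is normalized. *)
Definition tw_one : T := (c 1%g 1%g)^-1 *: u 1%g.

Lemma tw_basisE (x : T) : x = \sum_g x g *: u g.
Proof.
apply/ffunP => k; rewrite sum_ffunE (bigD1 k) //= !ffunE eqxx.
rewrite /GRing.scale /= mulr1 big1 ?addr0 // => g gk.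
by rewrite !ffunE eq_sym (negPf gk) /GRing.scale /= mulr0.
Qed.

Fact tw_mulDl : left_distributive tw_mul +%R.
Proof.
move=> x y z; rewrite /tw_mul -big_split /=; apply: eq_bigr => g _.
rewrite -big_split /=; apply: eq_bigr => h _.
by rewrite -scalerDl -!mulrDl ffunE.
Qed.

Fact tw_mulDr : right_distributive tw_mul +%R.
Proof.
move=> x y z; rewrite /tw_mul -big_split /=; apply: eq_bigr => g _.
rewrite -big_split /=; apply: eq_bigr => h _.
by rewrite -scalerDl -!mulrDl -mulrDr ffunE.
Qed.

Fact tw_scaleAl k (x y : T) : k *: tw_mul x y = tw_mul (k *: x) y.
Proof.
rewrite /tw_mul scaler_sumr; apply: eq_bigr => g _.
rewrite scaler_sumr; apply: eq_bigr => h _.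
by rewrite scalerA ffunE /GRing.scale /= !mulrA.
Qed.

Fact tw_scaleAr k (x y : T) : k *: tw_mul x y = tw_mul x (k *: y).
Proof.
rewrite /tw_mul scaler_sumr; apply: eq_bigr => g _.
rewrite scaler_sumr; apply: eq_bigr => h _.
by rewrite scalerA ffunE /GRing.scale /= !mulrA (mulrC k).
Qed.

Fact tw_mul_suml (I : Type) (r : seq I) (E : I -> T) y :
  tw_mul (\sum_(i <- r) E i) y = \sum_(i <- r) tw_mul (E i) y.
Proof.
elim: r => [|i r IHr]; last by rewrite !big_cons tw_mulDl IHr.
by rewrite !big_nil; have := tw_scaleAl 0 0 y; rewrite !scale0r => <-.
Qed.

Fact tw_mul_sumr (I : Type) (r : seq I) (E : I -> T) x :
  tw_mul x (\sum_(i <- r) E i) = \sum_(i <- r) tw_mul x (E i).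
Proof.
elim: r => [|i r IHr]; last by rewrite !big_cons tw_mulDr IHr.
by rewrite !big_nil; have := tw_scaleAr 0 x 0; rewrite !scale0r => <-.
Qed.

Fact tw_mul_basis g h : tw_mul (u g) (u h) = c g h *: u (g * h)%g.
Proof.
rewrite /tw_mul (bigD1 g) //= (bigD1 h) //= !ffunE !eqxx !mul1r.
rewrite big1 => [|h' h'h]; last first.
  by rewrite ffunE (negPf h'h) mulr0 mul0r scale0r.
rewrite addr0 big1 ?addr0 // => g' g'g; rewrite big1 // => h' _.
by rewrite ffunE (negPf g'g) !mul0r scale0r.
Qed.

Fact tw_cocycle g h k : c g h * c (g * h)%g k = c h k * c g (h * k)%g.
Proof. by have /Z2P/(_ g h k)/(congr1 (@uval F)) := cocycleP a. Qed.

Fact tw_c1l g : c 1%g g = c 1%g 1%g.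
Proof.
have := tw_cocycle 1%g 1%g g; rewrite !mul1g.
by move/(mulIf (uvalP _)) => ->.
Qed.

Fact tw_c1r g : c g 1%g = c 1%g 1%g.
Proof.
have := tw_cocycle g 1%g 1%g; rewrite !mulg1.
by move/(mulIf (uvalP _)) => ->.
Qed.

Fact tw_mulA : associative tw_mul.
Proof.
move: tw_mul_suml tw_mul_sumr tw_scaleAl tw_scaleAr tw_mul_basis.
move: tw_mul => m suml sumr scAl scAr mE x y z.
rewrite (tw_basisE x) !suml; apply: eq_bigr => g _.
rewrite (tw_basisE y) suml 2!sumr suml; apply: eq_bigr => h _.
rewrite (tw_basisE z) 3!sumr; apply: eq_bigr => k _.
rewrite -!(scAl, scAr) !mE -!(scAl, scAr) !mE !scalerA mulgA.
rewrite -!mulrA tw_cocycle; congr (_ *: _).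
by rewrite [RHS]mulrCA (mulrCA (z k) (y h)).
Qed.

Fact tw_mul1 : left_id tw_one tw_mul.
Proof.
move=> x; rewrite /tw_one -tw_scaleAl {1}(tw_basisE x) tw_mul_sumr.
rewrite scaler_sumr [RHS]tw_basisE; apply: eq_bigr => g _.
rewrite -tw_scaleAr tw_mul_basis mul1g (tw_c1l g) !scalerA mulrAC.
by rewrite mulVf ?mul1r ?uvalP.
Qed.

Fact tw_mulr1 : right_id tw_one tw_mul.
Proof.
move=> x; rewrite /tw_one -tw_scaleAr {1}(tw_basisE x) tw_mul_suml.
rewrite scaler_sumr [RHS]tw_basisE; apply: eq_bigr => g _.
rewrite -tw_scaleAl tw_mul_basis mulg1 (tw_c1r g) !scalerA mulrAC.
by rewrite mulVf ?mul1r ?uvalP.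
Qed.

Fact tw_one_neq0 : tw_one != 0.
Proof.
apply/eqP => /ffunP/(_ 1%g); rewrite !ffunE eqxx /GRing.scale /= mulr1.
move/eqP; rewrite invr_eq0; apply/negP; exact: uvalP.
Qed.

HB.instance Definition _ := GRing.Zmodule_isNzRing.Build T
  tw_mulA tw_mul1 tw_mulr1 tw_mulDl tw_mulDr tw_one_neq0.
HB.instance Definition _ :=
  GRing.Lmodule_isLalgebra.Build F T tw_scaleAl.
HB.instance Definition _ :=
  GRing.Lalgebra_isAlgebra.Build F T tw_scaleAr.

Lemma tw_basisM g h :
  tw_basis g * tw_basis h = uval (a (g, h)) *: tw_basis (g * h)%g.
Proof. exact: tw_mul_basis. Qed.
End TwistedGroupAlgebra.

Definition zmod_iso (U V : zmodType) : Prop :=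
  exists f : {additive U -> V}, bijective f.

Definition alg_iso (F : fieldType) (A B : algType F) : Prop :=
  exists f : {lrmorphism A -> B}, bijective f.

(* All representatives of the two classes are quantified over: their choice   *)
(* does not matter up to isomorphism.                                         *)
Definition preserves_twisted_algs (F : fieldType) (G H : finGroupType)
    (f : H2 (units F) G -> H2 (units F) H) : Prop :=
  forall (a : cocycle (units F) G) (b : cocycle (units F) H),
    f (class2 a) = class2 b -> alg_iso (twisted_alg a) (twisted_alg b).

Definition twisted_equiv (F : fieldType) (G H : finGroupType) : Prop :=
  exists psi : {additive H2 (units F) G -> H2 (units F) H},
    bijective psi /\ preserves_twisted_algs psi.

Definition bijectivity_condition (F : fieldType) (G H : finGroupType) : Prop :=
  exists phi : H2 (units F) G -> H2 (units F) H,
    bijective phi /\ preserves_twisted_algs phi.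

(* R[i] is the field of complex numbers.                                     *)
Definition schur_multiplier (R : realType) (G : finGroupType) : zmodType :=
  H2 (units R[i]) G.

Definition zmod_cyclic (V : zmodType) : Prop :=
  exists x : V, forall y : V, exists n : int, y = x *~ n.

(* Main.v *)
(* Over an algebraically closed field of characteristic 0, F^a G is a product *)
(* of matrix algebras of degrees d_i, and the sum of the commutators          *)
(* u_g u_h u_g^-1 u_h^-1 acts on the i-th factor as (|G|/d_i)^2.  The traces  *)
(* of its powers in the regular representation, read off the coefficient of   *)
(* u_1, therefore determine the d_i, hence the algebra up to isomorphism.     *)
(*                                                                            *)
(* Cyclic case.  Let v_p(x) be the least p-adic valuation of the dimension of *)
(* a projective representation of class x.  Tensor products give              *)
(* v_p(x + y) <= v_p(x) + v_p(y), determinants show that v_p(x) = 0 only if   *)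
(* the order of x is prime to p, and symmetric powers of degree p give        *)
(* v_p(p x) < v_p(x) when v_p(x) > 0.  So in a cyclic group the v_p determine *)
(* the order of x, and the bijection preserves orders.  Two classes of the    *)
(* same order are Galois conjugate and define isomorphic algebras, so any     *)
(* group isomorphism will do.                                                 *)
(*                                                                            *)
(* Elementary abelian case.  The bijection fixes 0.  Any bijection of Z_2^2   *)
(* fixing 0 is additive; on Z_3^2 the algebras only depend on x up to sign,   *)
(* and every permutation of the four lines of Z_3^2 is linear.                *)
(*                                                                            *)
(* Counterexample.  Let P = <x, c, y> have order 32 with x^4 = c^4 = y^2 = 1, *)
(* c central and [x, y] = c^2.  A class on P is determined by its commutator  *)
(* pairings of c with x and with y, so M(P) = Z_4 * Z_2.  Let P act by signs  *)
(* on Z_3^2, via (xc, x) in G and via (yc, y) in H, where each letter stands  *)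
(* for the character which is -1 on that generator only and concatenation     *)
(* for the product; both multipliers are inflated from P.  The spectra of G   *)
(* and H agree under the involution of Z_4 * Z_2 which exchanges (2,0) and    *)
(* (0,1), but (2,0) is the only nonzero double, so it would be fixed by any   *)
(* group isomorphism, and its spectra in G and H differ.                      *)

From HB Require Import structures.
Require Import Defs.
From mathcomp Require Import all_boot all_order all_fingroup all_algebra.
From mathcomp Require Import cyclic center pgroup separable algC cyclotomic mxrepresentation.
From mathcomp Require Import ring generic_quotient boolp reals complex.

Set Implicit Arguments.
Unset Strict Implicit.
Unset Printing Implicit Defensive.

Import GRing.Theory Num.Theory.
Local Open Scope ring_scope.
Local Open Scope quotient_scope.

(** Over a closed field of characteristic 0 the algebra F^a G is a product of matrix algebras, so
    its isomorphism type is the multiset of their degrees ([splitting_exists], [splitting_alg_iso]),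
    and [alg_isoP] replaces this multiset by the power sums [spectrum], which can be computed from
    the cocycle. These are rational values of integer polynomials at roots of unity, hence do not
    change when a class is multiplied by an integer prime to its order ([Galois_alg_iso]).

    A bijection that preserves the algebras preserves the dimensions of the projective
    representations of each class. On a cyclic multiplier such a bijection preserves orders
    ([cyclic_perm_gcdn]), because symmetric powers ([proj_dim_sym]) make p-adic valuations drop
    strictly under multiplication by p; so it agrees with any isomorphism up to Galois conjugation.
    On Z_2^2 the bijection is itself additive ([klein_preserves]); on Z_3^2 the permutation of the
    four lines that it suggests is made linear ([nine_linearize]).

    For the counterexample the multipliers are found exactly: [pgrp_trivial] treats the group P of
    order 32 and [sdp_inr_inj] the restriction to it. Then [sdp_spectrum] reduces each spectrum to
    eight sums over pairs of elements of P, which are evaluated. The results match under a swap of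
    two classes, one a double and the other not ([swap_spectra_agree]), and no isomorphism can
    achieve a match ([not_equiv_GH]). *)

(** * Wedderburn decomposition of an ordinary group algebra *)

Section GroupWedderburn.
Variables (F : numClosedFieldType) (E : finGroupType).
Local Notation aG := (regular_repr F [set: E]).
Variable sG : irrType F [set: E].
Implicit Types (i j : sG) (w : E -> F).

Let splitG : group_splitting_field F [set: E]%G.
Proof. exact: group_closure_closed_field. Qed.
Let pcharG : ([pchar F]^'.-group [set: E])%g.
Proof. by apply/pgroupP => p _ _; rewrite inE /= pchar_num. Qed.

Definition gelt w : 'M[F]_#|[set: E]| := \sum_x w x *: aG x.

Lemma gelt_op i w :
  gring_op (irr_repr i) (gelt w) = \sum_x w x *: irr_repr i x.
Proof.
rewrite linear_sum; apply: eq_bigr => x _.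
by rewrite linearZ /= gring_opG ?inE.
Qed.

Lemma gelt_mem w : (gelt w \in group_ring F [set: E])%MS.
Proof.
rewrite linear_sum summx_sub // => x _.
by rewrite linearZ scalemx_sub // envelop_mx_id ?inE.
Qed.

Lemma gelt_coef w x : gring_proj x (gelt w) = (w x)%:M.
Proof.
rewrite linear_sum (bigD1 x) //= linearZ /= gring_projE ?inE // eqxx.
rewrite big1 ?addr0 ?scale_scalar_mx ?mulr1 // => y yx.
by rewrite linearZ /= gring_projE ?inE // eq_sym (negPf yx) scaler0.
Qed.

Lemma gelt_surj (A : 'M[F]_#|[set: E]|) :
  (A \in group_ring F [set: E])%MS -> exists w, A = gelt w.
Proof.
move/envelop_mxP => [b ->]; exists b.
by apply: eq_bigl => x; rewrite inE.
Qed.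

(** By semisimplicity [gelt w] is the sum of its products with the Wedderburn idempotents, and each
    irreducible representation is faithful on its own Wedderburn component. *)
Lemma gelt_eq0 w :
  (forall i, \sum_x w x *: irr_repr i x = 0) -> w =1 fun=> 0.
Proof.
move=> w0 x; suff A0 : gelt w = 0.
  have := gelt_coef w x; rewrite A0 linear0 => /esym/matrixP/(_ 0 0).
  by rewrite !mxE.
rewrite -[gelt w]mulmx1 -(Wedderburn_sum_id sG pcharG) mulmx_sumr big1 // => i _.
have /mulsmx_subP/(_ (gelt w) (Wedderburn_id i)) :
    (group_ring F [set: E] * Wedderburn_subring i <= Wedderburn_subring i)%MS.
  by have /andP[] := Wedderburn_ideal i.
move/(_ (gelt_mem w) (Wedderburn_id_mem i)) => Ri.
have inj := @regular_op_inj_pchar _ _ _ sG pcharG _ (irr_repr i) (socle_irr i).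
apply: inj; rewrite ?inE ?irr_reprK_pchar ?linear0 ?sub0mx //.
rewrite gring_opM ?gelt_op ?w0 ?mul0mx //.
by rewrite -(Wedderburn_sum_pchar sG pcharG) (sumsmx_sup i) ?Wedderburn_id_mem.
Qed.

(** Absolute irreducibility gives some preimage of [M]; multiplying it by the Wedderburn idempotent
    of [i] kills it in every other representation. *)
Lemma irr_repr_surj i (M : 'M[F]_(irr_degree i)) :
  exists w, \sum_x w x *: irr_repr i x = M /\
    forall j, j != i -> \sum_x w x *: irr_repr j x = 0.
Proof.
have /andP[_ full] := splitG (socle_irr i).
have /envelop_mxP[b defM] := submx_full (mxvec M) full.
pose B := \sum_(x in [set: E]) b x *: aG x.
have BR : (B \in group_ring F [set: E])%MS by apply/envelop_mxP; exists b.
have eR : (Wedderburn_id i \in group_ring F [set: E])%MS.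
  rewrite -(Wedderburn_sum_pchar sG pcharG).
  by rewrite (sumsmx_sup i) ?Wedderburn_id_mem.
have RB : (B *m Wedderburn_id i \in Wedderburn_subring i)%MS.
  have /andP[/mulsmx_subP sub _] := Wedderburn_ideal i.
  by apply: sub => //; apply: Wedderburn_id_mem.
have [w defw] : exists w, B *m Wedderburn_id i = gelt w.
  apply: gelt_surj; apply: submx_trans RB _.
  by rewrite -(Wedderburn_sum_pchar sG pcharG) (sumsmx_sup i).
exists w; split=> [|j ji]; rewrite -gelt_op -defw.
  rewrite gring_opM // op_Wedderburn_id_pchar // mulmx1 defM linear_sum.
  by apply: eq_bigr => x _; rewrite linearZ /= gring_opG ?inE.
by rewrite (irr_repr'_op0_pchar pcharG _ RB) // eq_sym.
Qed.

End GroupWedderburn.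

(** * Cocycles, central extensions and projective representations *)

Section CocycleBasics.
Variables (A : zmodType) (G : finGroupType).
Implicit Types (a b : cocycle A G) (g h k : G).

Lemma cocycleE a g h k :
  a (g, h) + a ((g * h)%g, k) = a (h, k) + a (g, (h * k)%g).
Proof. by have /Z2P := cocycleP a. Qed.

Lemma cocycle1l a g : a (1%g, g) = a (1%g, 1%g).
Proof. by have := cocycleE a 1 1 g; rewrite !mul1g => /addIr. Qed.

Lemma cocycle1r a g : a (g, 1%g) = a (1%g, 1%g).
Proof.
by have := cocycleE a g 1 1; rewrite !mulg1 => /addIr.
Qed.

Lemma cocycleVg a g : a ((g^-1)%g, g) = a (g, (g^-1)%g).
Proof.
have := cocycleE a g g^-1 g.
by rewrite mulgV mulVg cocycle1l cocycle1r => /addIr.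
Qed.

Lemma class2_eq a b :
  class2 a = class2 b <->
  exists s : G -> A, forall g h, a (g, h) = b (g, h) + (s g + s h - s (g * h)%g).
Proof.
have -> : (class2 a = class2 b) <-> a - b \in B2 (A:=A) (G:=G).
  by rewrite Quotient.idealrBE; split => /eqP.
split=> [/B2P[s sP]|[s sP]].
  by exists s => g h; rewrite -sP !ffunE addrC subrK.
by apply/B2P; exists s => g h; rewrite !ffunE sP addrAC subrr add0r.
Qed.

Lemma class2_surj (x : H2 A G) : exists a, x = class2 a.
Proof. by exists (repr x); rewrite /class2 reprK. Qed.

Fact class2_zmod_morphism : zmod_morphism (@class2 A G).
Proof. by move=> a b; rewrite /class2 !piE. Qed.
HB.instance Definition _ :=
  GRing.isZmodMorphism.Build (cocycle A G) (H2 A G) (@class2 A G)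
    class2_zmod_morphism.

End CocycleBasics.

Section CocycleMap.
Variables (A B : zmodType) (G : finGroupType) (f : {additive A -> B}).

Fact cocycle_map_subproof (a : cocycle A G) :
  [ffun p => f (a p)] \in Z2 (A:=B) (G:=G).
Proof. by apply/Z2P => g h k; rewrite !ffunE -!raddfD cocycleE. Qed.

Definition cocycle_map (a : cocycle A G) : cocycle B G :=
  Cocycle (cocycle_map_subproof a).

Lemma cocycle_mapE a p : cocycle_map a p = f (a p).
Proof. by rewrite ffunE. Qed.
End CocycleMap.

(** A synonym of the product that remembers [a], so that the group law twisted by [a] can be
    attached to it. *)
Definition central_ext (A : finZmodType) (G : finGroupType) (a : cocycle A G) :
  Type := (A * G)%type.

Section CentralExtension.
Variables (A : finZmodType) (G : finGroupType) (a : cocycle A G).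
Local Notation E := (central_ext a).
HB.instance Definition _ := Finite.copy E (A * G)%type.

Definition ext_mul (x y : E) : E := (x.1 + y.1 + a (x.2, y.2), (x.2 * y.2)%g).
Definition ext_one : E := (- a (1%g, 1%g), 1%g).
Definition ext_inv (x : E) : E :=
  (- x.1 - a ((x.2^-1)%g, x.2) - a (1%g, 1%g), (x.2^-1)%g).

Fact ext_mulA : associative ext_mul.
Proof.
move=> [x g] [y h] [z k]; rewrite /ext_mul /= mulgA; congr (_, _).
rewrite -!addrA; congr (_ + (_ + _)).
by rewrite [RHS]addrCA cocycleE.
Qed.
Fact ext_mul1 : left_id ext_one ext_mul.
Proof.
move=> [x g]; rewrite /ext_mul /ext_one /= mul1g (cocycle1l a g); congr (_, _).
by rewrite addrAC addNr add0r.
Qed.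
Fact ext_mulV : left_inverse ext_one ext_inv ext_mul.
Proof.
move=> [x g]; rewrite /ext_mul /ext_one /ext_inv /= mulVg; congr (_, _).
by rewrite 2!(addrAC _ _ x) addNr add0r addrAC addNr add0r.
Qed.

HB.instance Definition _ := Finite_isGroup.Build E ext_mulA ext_mul1 ext_mulV.

Definition ext_lift (g : G) : E := (0, g).
(** As [a] need not be normalized, the unit of the extension is [(- a (1, 1), 1)]; the same shift
    makes [ext_cent] a group morphism into the centre. *)
Definition ext_cent (z : A) : E := (z - a (1%g, 1%g), 1%g).

Lemma ext_liftM g h :
  (ext_lift g * ext_lift h)%g = (ext_cent (a (g, h)) * ext_lift (g * h))%g.
Proof.
rewrite /mulg /= /ext_mul /= !add0r addr0 mul1g (cocycle1l a (g * h)).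
by rewrite subrK.
Qed.

Lemma ext_cent_lift z g : (ext_cent z * ext_lift g)%g = (z, g) :> E.
Proof. by rewrite /mulg /= /ext_mul /= addr0 mul1g (cocycle1l a g) subrK. Qed.

Lemma ext_centD z w : ext_cent (z + w) = (ext_cent z * ext_cent w)%g.
Proof.
rewrite /mulg /= /ext_mul /= /ext_cent mul1g; congr (_, _).
by rewrite -(addrA (z - _)) subrK addrAC.
Qed.

Lemma ext_cent_central z : ext_cent z \in 'Z([set: E])%g.
Proof.
apply/centerP; split; rewrite ?inE // => -[w g] _.
rewrite /commute /mulg /= /ext_mul /= mul1g mulg1 (cocycle1l a g) (cocycle1r a g).
by rewrite (addrC w).
Qed.

Lemma ext_lift1 : ext_lift 1 = ext_cent (a (1%g, 1%g)).
Proof. by rewrite /ext_cent subrr. Qed.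
End CentralExtension.

Section ProjectiveRepresentations.
Variables (F : fieldType) (G : finGroupType) (a : cocycle (units F) G).
Local Notation c g h := (uval (a (g, h))).
Implicit Types (g h : G) (z w : twisted_alg a).

(** The condition at 1 makes the unit of the twisted algebra act as the identity matrix. *)
Definition proj_rep n (X : G -> 'M[F]_n) : Prop :=
  X 1%g = (c 1%g 1%g)%:M /\ forall g h, X g *m X h = c g h *: X (g * h)%g.

Definition proj_op n (X : G -> 'M[F]_n) z : 'M[F]_n := \sum_g z g *: X g.

Fact proj_op_is_linear n (X : G -> 'M[F]_n) : linear (proj_op X).
Proof.
move=> k z w; rewrite /proj_op scaler_sumr -big_split /=; apply: eq_bigr => g _.
by rewrite !ffunE scalerDl scalerA.
Qed.
HB.instance Definition _ n (X : G -> 'M[F]_n) :=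
  GRing.isLinear.Build F (twisted_alg a) 'M[F]_n _ (proj_op X)
    (proj_op_is_linear X).

Lemma proj_op_basis n (X : G -> 'M[F]_n) g : proj_op X (tw_basis a g) = X g.
Proof.
rewrite /proj_op (bigD1 g) //= ffunE eqxx scale1r big1 ?addr0 // => h hg.
by rewrite ffunE (negPf hg) scale0r.
Qed.

Lemma proj_opM n (X : G -> 'M[F]_n) z w :
  proj_rep X -> proj_op X (z * w) = proj_op X z *m proj_op X w.
Proof.
case=> _ XM; rewrite [in RHS]/proj_op mulmx_suml [z * w]/(tw_mul z w).
rewrite linear_sum; apply: eq_bigr => g _ /=.
rewrite mulmx_sumr linear_sum; apply: eq_bigr => h _ /=.
by rewrite linearZ /= proj_op_basis -scalemxAl -scalemxAr XM !scalerA.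
Qed.

Lemma proj_op1 n (X : G -> 'M[F]_n) : proj_rep X -> proj_op X 1 = 1%:M.
Proof.
case=> X1 _; rewrite [1]/(tw_one a) linearZ /= proj_op_basis X1.
by rewrite scale_scalar_mx mulVf ?uvalP.
Qed.

Lemma proj_opX n (X : G -> 'M[F]_n) z (k : nat) : proj_rep X ->
  proj_op X (z ^+ k) = iter k (mulmx (proj_op X z)) 1%:M.
Proof.
move=> repX; elim: k => [|k IHk] /=; first by rewrite expr0 proj_op1.
by rewrite exprS proj_opM // IHk.
Qed.

(** A Wedderburn decomposition: the last two conditions say that the [rho i] together identify F^a G
    with the product of the full matrix algebras of degrees [d i]. *)
Definition splitting (I : finType) (d : I -> nat)
    (rho : forall i, G -> 'M[F]_(d i)) : Prop :=
  [/\ forall i, (0 < d i)%N, forall i, proj_rep (rho i),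
      forall z, (forall i, proj_op (rho i) z = 0) -> z = 0
    & forall i (M : 'M[F]_(d i)), exists z,
        proj_op (rho i) z = M /\ forall j, j != i -> proj_op (rho j) z = 0].

End ProjectiveRepresentations.

Arguments proj_op {F G a n} X z.

(** * Wedderburn decomposition of a twisted group algebra *)

Section TwistedWedderburn.
Variables (F : numClosedFieldType) (A : finZmodType) (G : finGroupType).
Variables (a : cocycle A G) (l : {additive A -> units F}).
Local Notation E := (central_ext a).
Local Notation la := (cocycle_map l a).

Lemma units_character_sum (m : A -> F) (m0 : m 0 = 1)
    (mD : forall x y, m (x + y) = m x * m y) x :
  m x != 1 -> \sum_y m y = 0.
Proof.
move=> mx; have: m x * \sum_y m y = \sum_y m y.
  rewrite mulr_sumr [RHS](reindex_inj (addrI x)) /=.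
  by apply: eq_bigr => y _; rewrite mD.
move/eqP; rewrite -subr_eq0 -{2}[\sum_y m y]mul1r -mulrBl mulf_eq0.
by rewrite subr_eq0 (negPf mx) => /eqP.
Qed.

(** Representations of the central extension on which [A] acts through the character [l] are the
    projective representations of [G] with cocycle [la]; the irreducible ones of this kind give the
    decomposition. *)
Theorem twisted_splitting :
  exists (I : finType) (d : I -> nat) (rho : forall i, G -> 'M[F]_(d i)),
    splitting la rho.
Proof.
pose sG := DecSocleType (regular_repr F [set: E]).
pose lies (i : sG) := [forall z, irr_mode i (ext_cent a z) == uval (l z)].
pose I : finType := {i : sG | lies i}.
pose d (i : I) := irr_degree (val i).
pose rho (i : I) (g : G) := irr_repr (val i) (ext_lift a g).
have cent (i : sG) z : irr_repr i (ext_cent a z) = (irr_mode i (ext_cent a z))%:M.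
  apply: irr_center_scalar; last exact: ext_cent_central.
  exact: group_closure_closed_field.
have reprM (i : sG) (x y : E) : irr_repr i (x * y)%g = irr_repr i x *m irr_repr i y.
  by rewrite repr_mxM ?inE.
have liesP (i : I) z : irr_repr (val i) (ext_cent a z) = (uval (l z))%:M.
  by rewrite cent; have /forallP/(_ z)/eqP-> := valP i.
have repE (i : sG) (z : A) g : irr_repr i ((z, g) : E) =
    irr_mode i (ext_cent a z) *: irr_repr i (ext_lift a g).
  by rewrite -ext_cent_lift reprM cent mul_scalar_mx.
exists I, d, rho; split=> [i|i|z z0|i M].
- exact: irr_degree_gt0.
- split=> [|g h]; first by rewrite /rho ext_lift1 liesP cocycle_mapE.
  by rewrite /rho -reprM ext_liftM reprM liesP mul_scalar_mx cocycle_mapE.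
(* Faithfulness: [z] is spread over the fibres of the extension with weights inverse to [l].
   Representations over other characters of [A] kill the result by orthogonality, the others by
   hypothesis. *)
- pose w (x : E) := z x.2 * (uval (l x.1))^-1.
  have w0 : w =1 fun=> 0.
    apply: (@gelt_eq0 F E sG) => i.
    transitivity ((\sum_(y : A) (uval (l y))^-1 * irr_mode i (ext_cent a y)) *:
                  \sum_g z g *: irr_repr i (ext_lift a g)).
      rewrite scaler_suml -(pair_big xpredT xpredT
        (fun y g => w (y, g) *: irr_repr i ((y, g) : E))) /=.
      apply: eq_bigr => y _; rewrite scaler_sumr; apply: eq_bigr => g _.
      by rewrite repE !scalerA /w /= -mulrA mulrC.
    have [li|] := boolP (lies i).
      have := z0 (exist _ i li : I); rewrite /proj_op => ->.
      by rewrite scaler0.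
    rewrite negb_forall => /existsP[x xP].
    rewrite (@units_character_sum
      (fun y => (uval (l y))^-1 * irr_mode i (ext_cent a y)) _ _ x) ?scale0r //.
    + rewrite raddf0 uval0 invr1 mul1r.
      suff -> : ext_cent a 0 = 1%g by rewrite irr_mode1.
      by rewrite /ext_cent sub0r.
    + move=> y y'; rewrite raddfD uvalD invfM mulrACA ext_centD.
      by rewrite irr_modeM ?ext_cent_central //; apply: group_closure_closed_field.
    + by rewrite mulrC -(inj_eq (mulIf (uvalP (l x)))) mulfVK ?uvalP // mul1r.
  apply/ffunP => g; have := w0 ((0, g) : E).
  by rewrite /w /= raddf0 uval0 invr1 mulr1 ffunE.
- have [w [wi wj]] := @irr_repr_surj F E sG (val i) M.
  (* Conversely, an element of the group ring of the extension is summed along the fibres with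
     weights [l y]. *)
  pose z : twisted_alg la := [ffun g => \sum_y w (y, g) * uval (l y)].
  have zE (j : I) : proj_op (rho j) z = \sum_x w x *: irr_repr (val j) x.
    rewrite (eq_bigr (fun x : E => w (x.1, x.2) *: irr_repr (val j) ((x.1, x.2) : E))); last by case.
    rewrite -(pair_big xpredT xpredT (fun y g => w (y, g) *: irr_repr (val j) ((y, g) : E))) /=.
    rewrite exchange_big /=; apply: eq_bigr => g _; rewrite ffunE scaler_suml.
    by apply: eq_bigr => y _; have /forallP/(_ y)/eqP e := valP j; rewrite repE e scalerA.
  exists z; split=> [|j ji]; rewrite zE //.
  by rewrite wj // (inj_eq val_inj).
Qed.

End TwistedWedderburn.

Section AlgIso.
Variables (F : fieldType) (A B : algType F).

Lemma alg_iso_from (f : A -> B) :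
  linear f -> monoid_morphism f -> bijective f -> alg_iso A B.
Proof.
move=> fL fM fB.
pose f1 := GRing.isLinear.Build F A B _ f fL.
pose f2 := GRing.isMonoidMorphism.Build A B f fM.
pose ff : {lrmorphism A -> B} := HB.pack f f1 f2.
by exists ff.
Qed.

End AlgIso.

Lemma alg_iso_sym (F : fieldType) (A B : algType F) : alg_iso A B -> alg_iso B A.
Proof.
case=> f [g fK gK].
have gL : linear g.
  by move=> k x y; apply: (can_inj fK); rewrite gK linearD linearZ /= !gK.
have gM : monoid_morphism g.
  split; first by apply: (can_inj fK); rewrite gK rmorph1.
  by move=> x y; apply: (can_inj fK); rewrite gK rmorphM /= !gK.
exact: (alg_iso_from gL gM (Bijective gK fK)).
Qed.

Lemma alg_iso_trans (F : fieldType) (A B C : algType F) :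
  alg_iso A B -> alg_iso B C -> alg_iso A C.
Proof.
move=> [f fB] [g gB]; exists (g \o f : {lrmorphism A -> C}).
exact: bij_comp.
Qed.

(** * Power sums of the degrees *)

Section CommutatorSum.
Variables (F : fieldType) (G : finGroupType) (a : cocycle (units F) G).
Local Notation c g h := (uval (a (g, h))).
Local Notation u := (tw_basis a).
Implicit Types (g h : G) (z w : twisted_alg a).

Lemma tw_basis1 : u 1%g = c 1%g 1%g *: 1.
Proof. by rewrite [1]/(tw_one a) scalerA mulfV ?uvalP ?scale1r. Qed.

Definition tw_inv g : twisted_alg a :=
  (c g (g^-1)%g * c 1%g 1%g)^-1 *: u (g^-1)%g.

Lemma tw_mul_inv g : u g * tw_inv g = 1.
Proof.
rewrite /tw_inv -scalerAr tw_basisM mulgV scalerA tw_basis1 scalerA.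
by rewrite -mulrA mulVf ?scale1r // mulf_neq0 ?uvalP.
Qed.

Lemma tw_inv_mul g : tw_inv g * u g = 1.
Proof.
rewrite /tw_inv -scalerAl tw_basisM mulVg scalerA tw_basis1 scalerA.
by rewrite cocycleVg -mulrA mulVf ?scale1r // mulf_neq0 ?uvalP.
Qed.

Lemma tw_inv1 : tw_inv 1%g = (c 1%g 1%g)^-1 *: 1.
Proof.
rewrite /tw_inv invg1 tw_basis1 scalerA invfM -mulrA mulVf ?uvalP //.
by rewrite mulr1.
Qed.

Lemma tw_invM g h : tw_inv (h * g)%g * u h = c h g *: tw_inv g.
Proof.
have: u (h * g)%g * (tw_inv (h * g)%g * u h) = u (h * g)%g * (c h g *: tw_inv g).
  by rewrite mulrA tw_mul_inv mul1r -scalerAr scalerAl -tw_basisM -mulrA tw_mul_inv mulr1.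
by move/(congr1 ( *%R (tw_inv (h * g)%g))); rewrite !mulrA tw_inv_mul !mul1r.
Qed.

Definition commutator_sum : twisted_alg a :=
  \sum_g \sum_h u g * u h * tw_inv g * tw_inv h.

(** The factor in front turns the coefficient of u_1 into the trace in the regular
    representation. *)
Definition spectrum (k : nat) : F :=
  #|G|%:R * c 1%g 1%g * (commutator_sum ^+ k : twisted_alg a) 1%g.

End CommutatorSum.

Section Average.
Variables (F : fieldType) (G : finGroupType) (a : cocycle (units F) G).
Local Notation c g h := (uval (a (g, h))).
Variables (m n : nat) (X : G -> 'M[F]_m) (Y : G -> 'M[F]_n).
Hypotheses (repX : proj_rep a X) (repY : proj_rep a Y).

Definition average (N : 'M[F]_(m, n)) : 'M[F]_(m, n) :=
  \sum_g X g *m N *m proj_op Y (tw_inv a g).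

Lemma average_hom N (z : twisted_alg a) :
  proj_op X z *m average N = average N *m proj_op Y z.
Proof.
have avg_u h : X h *m average N = average N *m Y h.
  rewrite mulmx_sumr mulmx_suml [RHS](reindex_inj (mulgI h)) /=.
  apply: eq_bigr => g _; rewrite -[RHS]mulmxA -(proj_op_basis a Y h).
  rewrite -proj_opM // tw_invM [X in _ = _ *m X]linearZ /= -scalemxAr !mulmxA.
  by case: repX => _ ->; rewrite -!scalemxAl.
rewrite /proj_op mulmx_suml mulmx_sumr; apply: eq_bigr => g _.
by rewrite -scalemxAl -scalemxAr avg_u.
Qed.
End Average.

Section Orthogonality.
Variables (F : numFieldType) (G : finGroupType) (a : cocycle (units F) G).
Local Notation c g h := (uval (a (g, h))).
Variables (I : finType) (d : I -> nat) (rho : forall i, G -> 'M[F]_(d i)).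
Arguments rho : clear implicits.
Hypothesis rhoS : splitting a rho.
Local Notation rinv i g := (proj_op (rho i) (tw_inv a g)).

Let d_gt0 i : (0 < d i)%N. Proof. by case: rhoS. Qed.
Let rep i : proj_rep a (rho i). Proof. by case: rhoS. Qed.
Let dF i : (d i)%:R != 0 :> F. Proof. by rewrite pnatr_eq0 -lt0n. Qed.

(** An element acting as the identity through [rho i] and as 0 through [rho j] is moved across the
    intertwiner. *)
Lemma average_neq i j (N : 'M[F]_(d i, d j)) :
  i != j -> average a (rho i) (rho j) N = 0.
Proof.
move=> ij; have [_ _ _ /(_ i 1%:M) [z [zi zj]]] := rhoS.
have := average_hom (rep i) (rep j) N z.
by rewrite zi mul1mx zj ?mulmx0 // eq_sym.
Qed.

(** The average commutes with the full matrix algebra, so it is scalar; conjugation preserves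
    traces, which determines the scalar. *)
Lemma average_eq i (N : 'M[F]_(d i)) :
  average a (rho i) (rho i) N = (#|G|%:R * \tr N / (d i)%:R)%:M.
Proof.
set B := average _ _ _ _.
have comm (M : 'M[F]_(d i)) : M *m B = B *m M.
  have [_ _ _ /(_ i M) [z [<- _]]] := rhoS.
  exact: average_hom (rep i) (rep i) N z.
have [x Bx] : exists x, B = x%:M.
  have i0 := Ordinal (d_gt0 i).
  exists (B i0 i0); apply/matrixP => p q; rewrite !mxE.
  have := comm (delta_mx i0 p) => /matrixP/(_ i0 q); rewrite !mxE.
  rewrite (bigD1 p) //= mxE !eqxx mul1r big1 ?addr0 => [->|r rp]; last first.
    by rewrite mxE (negPf rp) andbF mul0r.
  rewrite (bigD1 i0) //= mxE eqxx big1 ?addr0 => [|r rp]; last first.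
    by rewrite mxE (negPf rp) mulr0.
  by rewrite eq_sym mulr_natr.
have trB : \tr B = #|G|%:R * \tr N.
  rewrite linear_sum /= mulr_natl -sumr_const; apply: eq_bigr => g _.
  rewrite mxtrace_mulC mulmxA -(proj_op_basis a (rho i) g) -proj_opM //.
  by rewrite tw_inv_mul proj_op1 // mul1mx.
by rewrite -trB Bx mxtrace_scalar -[x *+ _]mulr_natr mulfK.
Qed.

Lemma schur_orthogonality i p q k r :
  \sum_g rho i g p q * rinv i g k r =
  #|G|%:R / (d i)%:R * ((p == r) && (q == k))%:R.
Proof.
have := average_eq (delta_mx q k) => /matrixP/(_ p r); rewrite !mxE summxE.
have -> : \tr (delta_mx q k : 'M[F]_(d i)) = (q == k)%:R.
  rewrite /mxtrace (bigD1 q) //= mxE eqxx big1 ?addr0 // => s sq.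
  by rewrite mxE (negPf sq).
rewrite -[X in _ = X]mulr_natr => e.
transitivity (#|G|%:R * (q == k)%:R / (d i)%:R * (p == r)%:R : F); last first.
  rewrite -mulnb natrM (mulrC (p == r)%:R) [RHS]mulrA.
  by rewrite [in RHS](mulrAC _ (d i)%:R^-1).
rewrite -{}e; apply: eq_bigr => g _; rewrite mxE (bigD1 k) //= big1 ?addr0.
  rewrite !mxE (bigD1 q) //= big1 ?addr0 => [|s sq].
    by rewrite mxE !eqxx mulr1.
  by rewrite mxE (negPf sq) mulr0.
move=> s sk; rewrite mxE big1 ?mul0r // => t _.
by rewrite mxE (negPf sk) andbF mulr0.
Qed.

Lemma schur_orthogonality_neq i j p q k r : i != j ->
  \sum_g rho i g p q * rinv j g k r = 0.
Proof.
move/(average_neq (delta_mx q k)) => /matrixP/(_ p r); rewrite !mxE summxE => e.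
rewrite -[RHS]e; apply: eq_bigr => g _; rewrite mxE (bigD1 k) //= big1 ?addr0.
  rewrite !mxE (bigD1 q) //= big1 ?addr0 => [|s sq].
    by rewrite mxE !eqxx mulr1.
  by rewrite mxE (negPf sq) mulr0.
move=> s sk; rewrite mxE big1 ?mul0r // => t _.
by rewrite mxE (negPf sk) andbF mulr0.
Qed.

(** For fixed h the sum over g of the conjugates of [rho i h] is the scalar (|G|/d) tr(rho_i(h)).
    Schur orthogonality then evaluates the sum over h and yields a second factor |G|/d. *)
Lemma op_commutator_sum i :
  proj_op (rho i) (commutator_sum a) = ((#|G|%:R / (d i)%:R) ^+ 2)%:M.
Proof.
have -> : proj_op (rho i) (commutator_sum a) =
    \sum_h average a (rho i) (rho i) (rho i h) *m rinv i h.
  rewrite linear_sum /= (eq_bigr (fun g => \sum_h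
      rho i g *m rho i h *m rinv i g *m rinv i h)) => [|g _].
    rewrite exchange_big; apply: eq_bigr => h _ /=.
    by rewrite mulmx_suml.
  rewrite linear_sum; apply: eq_bigr => h _ /=.
  by rewrite !proj_opM // !proj_op_basis.
apply/matrixP => k b; rewrite summxE.
transitivity (\sum_h \sum_p #|G|%:R / (d i)%:R * (rho i h p p * rinv i h k b)).
  apply: eq_bigr => h _; rewrite average_eq mul_scalar_mx mxE.
  rewrite -mulr_sumr -mulr_suml [RHS]mulrA; congr (_ * _).
  exact: mulrAC.
rewrite exchange_big /=.
under eq_bigr do rewrite -mulr_sumr schur_orthogonality.
rewrite (bigD1 k) //= big1 ?addr0 => [|p pk].
  by rewrite eqxx andbT mulrA -expr2 mxE mulr_natr.
by rewrite (negPf pk) andbF !mulr0.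
Qed.

(** Fourier inversion: with t(y) = sum_i d_i tr(rho_i(y)), orthogonality shows that sum_x t(z
    u_x^-1) u_x and |G| z have the same image in every [rho i], so they are equal; then coefficients
    at 1 are compared. *)
Lemma trace_formula (z : twisted_alg a) :
  \sum_i (d i)%:R * \tr (proj_op (rho i) z) = #|G|%:R * c 1%g 1%g * z 1%g.
Proof.
pose t (y : twisted_alg a) : F := \sum_i (d i)%:R * \tr (proj_op (rho i) y).
pose z' : twisted_alg a := \sum_x t (z * tw_inv a x) *: tw_basis a x.
have z'E : z' = #|G|%:R *: z.
  apply/eqP; rewrite -subr_eq0; apply/eqP.
  have [_ _ inj _] := rhoS; apply: inj => i.
  rewrite linearB linearZ /= linear_sum /=.
  apply/eqP; rewrite subr_eq0; apply/eqP/matrixP => p q.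
  rewrite mxE summxE.
  pose Z j := proj_op (rho j) z.
  transitivity (\sum_j (d j)%:R * \sum_k \sum_r Z j k r *
      \sum_x rho i x p q * rinv j x r k).
    under eq_bigr => x _.
      rewrite linearZ /= proj_op_basis mxE mulr_suml.
      over.
    rewrite exchange_big; apply: eq_bigr => j _ /=.
    under eq_bigr => x _.
      rewrite proj_opM // -mulrA /mxtrace mulr_suml.
      under eq_bigr => k _ do rewrite mxE mulr_suml.
      over.
    rewrite -mulr_sumr; congr (_ * _); rewrite exchange_big; apply: eq_bigr => k _ /=.
    rewrite exchange_big; apply: eq_bigr => r _ /=; rewrite mulr_sumr.
    by apply: eq_bigr => x _; rewrite -mulrA (mulrC (rinv j x r k)).
  rewrite (bigD1 i) //= [X in _ + X]big1 ?addr0 => [|j ji]; last first.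
    rewrite big1 ?mulr0 // => k _; rewrite big1 // => r _.
    by rewrite schur_orthogonality_neq ?mulr0 // eq_sym.
  rewrite (bigD1 p) //= [X in _ + X]big1 ?addr0 => [|k kp]; last first.
    by rewrite big1 // => r _; rewrite schur_orthogonality eq_sym (negPf kp) !mulr0.
  rewrite (bigD1 q) //= [X in _ + X]big1 ?addr0 => [|r rq]; last first.
    by rewrite schur_orthogonality [q == r]eq_sym (negPf rq) andbF !mulr0.
  rewrite schur_orthogonality !eqxx mulr1 mulrCA.
  by rewrite (mulrC (d i)%:R) divfK // mulrC.
have: z' 1%g = #|G|%:R * z 1%g by rewrite z'E ffunE.
rewrite sum_ffunE (bigD1 1%g) //= big1 ?addr0 => [|x x1]; last first.
  by rewrite !ffunE eq_sym (negPf x1) scaler0.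
have tZ k y : t (k *: y) = k * t y.
  rewrite /t mulr_sumr; apply: eq_bigr => i _.
  by rewrite linearZ /= mxtraceZ mulrCA.
rewrite !ffunE eqxx tw_inv1 -scalerAr mulr1 tZ.
rewrite [_ *: _]mulr1 => /(congr1 ( *%R (c 1%g 1%g))).
by rewrite mulrA mulfV ?uvalP // mul1r mulrCA mulrA.
Qed.

Lemma spectrumE k :
  spectrum a k = \sum_i (d i)%:R ^+ 2 * ((#|G|%:R / (d i)%:R) ^+ 2) ^+ k.
Proof.
rewrite /spectrum -trace_formula; apply: eq_bigr => i _.
rewrite proj_opX // op_commutator_sum.
have iterE x : iter k (mulmx x%:M) 1%:M = (x ^+ k)%:M :> 'M[F]_(d i).
  elim: k => [|k IHk]; first by rewrite expr0.
  by rewrite iterS IHk mul_scalar_mx scale_scalar_mx exprS.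
by rewrite iterE mxtrace_scalar -[X in _ * X]mulr_natl mulrA -expr2.
Qed.

End Orthogonality.

(** * Spectra classify twisted group algebras *)

Section Transport.
Variables (F : fieldType) (G H : finGroupType).
Variables (a : cocycle (units F) G) (b : cocycle (units F) H).

Lemma proj_rep_transport (f : {lrmorphism twisted_alg a -> twisted_alg b}) n
    (X : H -> 'M[F]_n) :
  proj_rep b X -> proj_rep a (fun g => proj_op X (f (tw_basis a g))).
Proof.
move=> repX; split=> [|g h].
  by rewrite tw_basis1 linearZ /= rmorph1 linearZ /= proj_op1 // scale_scalar_mx mulr1.
by rewrite -proj_opM // -rmorphM /= tw_basisM !linearZ.
Qed.

Lemma proj_op_transport (f : {lrmorphism twisted_alg a -> twisted_alg b}) n
    (X : H -> 'M[F]_n) z :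
  proj_op (a := a) (fun g => proj_op X (f (tw_basis a g))) z = proj_op X (f z).
Proof.
rewrite {2}(tw_basisE z) !linear_sum; apply: eq_bigr => g _.
by rewrite !linearZ.
Qed.

Lemma splitting_transport (I : finType) (d : I -> nat)
    (rho : forall i, H -> 'M[F]_(d i)) :
  alg_iso (twisted_alg a) (twisted_alg b) -> splitting b rho ->
  exists rho' : forall i, G -> 'M[F]_(d i), splitting a rho'.
Proof.
move=> [f [f' fK f'K]] [d0 rep inj surj].
exists (fun i g => proj_op (rho i) (f (tw_basis a g))); split=> [||z z0|i M].
- exact: d0.
- by move=> i; apply: proj_rep_transport.
- apply: (can_inj fK); rewrite linear0; apply: inj => i.
  by rewrite -proj_op_transport z0.
have [w [wi wj]] := surj i M.
exists (f' w); split=> [|j ji]; rewrite proj_op_transport f'K //.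
exact: wj.
Qed.
End Transport.

Lemma splitting_reindex (F : fieldType) (G : finGroupType)
    (a : cocycle (units F) G) (I J : finType) (d : I -> nat)
    (rho : forall i, G -> 'M[F]_(d i)) (f : J -> I) :
  bijective f -> splitting a rho ->
  splitting a (fun j => rho (f j) : G -> 'M[F]_((d \o f) j)).
Proof.
move=> bij_f [d0 rep inj surj]; have [f' fK f'K] := bij_f; split=> [j|j|z z0|j M].
- exact: d0.
- exact: rep.
- by apply: inj => i; rewrite -(f'K i); apply: z0.
have [z [zi zj]] := surj (f j) M; exists z; split=> // k kj.
by apply: zj; rewrite (inj_eq (bij_inj bij_f)).
Qed.

(** Both algebras are identified with the same product of matrix algebras; the isomorphism matches
    elements with equal images there. *)
Lemma splitting_alg_iso (F : fieldType) (G H : finGroupType)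
    (a : cocycle (units F) G) (b : cocycle (units F) H) (I : finType)
    (d : I -> nat) (rho : forall i, G -> 'M[F]_(d i))
    (rho' : forall i, H -> 'M[F]_(d i)) :
  splitting a rho -> splitting b rho' ->
  alg_iso (twisted_alg a) (twisted_alg b).
Proof.
have lift (K K' : finGroupType) (c : cocycle (units F) K)
    (c' : cocycle (units F) K') (r : forall i, K -> 'M[F]_(d i))
    (r' : forall i, K' -> 'M[F]_(d i)) : splitting c' r' ->
    forall z : twisted_alg c, exists w : twisted_alg c',
      forall i, proj_op (r' i) w = proj_op (r i) z.
  move=> [_ _ _ surj] z.
  have [w wP] := choice (fun i => surj i (proj_op (r i) z)).
  exists (\sum_i w i) => i; rewrite linear_sum (bigD1 i) //= big1 ?addr0.
    by have [] := wP i.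
  by move=> j ji; have [_ ->] := wP j; rewrite // eq_sym.
move=> Sa Sb.
have [f fP] := choice (lift _ _ a _ rho _ Sb).
have [f' f'P] := choice (lift _ _ b _ rho' _ Sa).
have [_ repa inja _] := Sa; have [_ repb injb _] := Sb.
have inj_b (z w : twisted_alg b) : (forall i, proj_op (rho' i) z = proj_op (rho' i) w) -> z = w.
  move=> zw; apply/eqP; rewrite -subr_eq0; apply/eqP/injb => i.
  by rewrite linearB /= zw subrr.
have inj_a (z w : twisted_alg a) : (forall i, proj_op (rho i) z = proj_op (rho i) w) -> z = w.
  move=> zw; apply/eqP; rewrite -subr_eq0; apply/eqP/inja => i.
  by rewrite linearB /= zw subrr.
apply: (@alg_iso_from F _ _ f).
- move=> k z w; apply: inj_b => i.
  by rewrite linearD linearZ /= !fP linearD linearZ.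
- split=> [|z w]; apply: inj_b => i; first by rewrite fP !proj_op1.
  by rewrite fP !proj_opM // !fP.
- by exists f' => z; [apply: inj_a | apply: inj_b] => i; rewrite ?(f'P, fP) ?(f'P, fP).
Qed.

Lemma perm_eq_reindex (I J : finType) (d : I -> nat) (e : J -> nat) :
  perm_eq [seq d i | i : I] [seq e j | j : J] ->
  exists2 f : J -> I, bijective f & d \o f = e.
Proof.
move=> eqde; have cardIJ : #|I| = #|J|.
  by have := perm_size eqde; rewrite !size_image.
(* If [J] is empty there is no default element for [nth], so the bijection of empty types is built
   separately. *)
have [J0|/card_gt0P[j0 _]] := posnP #|J|.
  have I0 (i : I) : False by have := fintype0 i; rewrite cardIJ J0 => /(_ erefl).
  have J0' (j : J) : False by have := fintype0 j; rewrite J0 => /(_ erefl).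
  exists (fun j => False_rect I (J0' j)); last by apply/funext => j; case: (J0' j).
  by exists (fun i => False_rect J (I0 i)) => [j|i]; [case: (J0' j)|case: (I0 i)].
have /card_gt0P[i0 _] : (0 < #|I|)%N by rewrite cardIJ; apply/card_gt0P; exists j0.
have [Is permIs defe] := perm_iotaP 0%N (etrans (perm_sym _ _) eqde).
rewrite size_image in permIs.
have sizeIs : size Is = #|J| by rewrite (perm_size permIs) size_iota.
have ltIs (j : J) : (nth 0%N Is (enum_rank j) < #|I|)%N.
  have : nth 0%N Is (enum_rank j) \in Is by apply: mem_nth; rewrite sizeIs; exact: ltn_ord.
  by rewrite (perm_mem permIs) mem_iota.
pose f j := enum_val (Ordinal (ltIs j)).
exists f.
  apply: inj_card_bij; last by rewrite cardIJ.
  move=> j k /enum_val_inj/(congr1 val)/= /eqP.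
  rewrite nth_uniq ?sizeIs // ?(perm_uniq permIs) ?iota_uniq //.
  by move=> /eqP/val_inj/enum_rank_inj.
apply/funext => j /=; 
have -> : e j = nth 0%N [seq e j | j : J] (enum_rank j).
  by rewrite (nth_map j0) -?cardE // nth_enum_rank.
rewrite defe (nth_map 0%N) ?sizeIs // (nth_map i0) -?cardE //.
by rewrite /f (enum_val_nth i0).
Qed.

(** Rescaling each u_g by the cochain [s] turns one multiplication into the other. *)
Lemma class2_alg_iso (F : fieldType) (G : finGroupType)
    (a b : cocycle (units F) G) :
  class2 a = class2 b -> alg_iso (twisted_alg a) (twisted_alg b).
Proof.
move=> /class2_eq[s sP].
pose f (z : twisted_alg a) : twisted_alg b := [ffun g => z g * uval (s g)].
have cE g h : uval (a (g, h)) * uval (s (g * h)%g) =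
    uval (s g) * uval (s h) * uval (b (g, h)).
  by rewrite sP !uvalD uvalN -mulrA divfK ?uvalP // mulrC.
have fu g : f (tw_basis a g) = uval (s g) *: tw_basis b g.
  apply/ffunP => h; rewrite !ffunE /GRing.scale /=.
  by have [->|] := eqVneq h g; rewrite ?mul1r ?mulr1 // mul0r mulr0.
have fL : linear f.
  move=> k z w; apply/ffunP => g; rewrite !ffunE /GRing.scale /=.
  by rewrite mulrDl mulrA.
have fZ k z : f (k *: z) = k *: f z.
  by apply/ffunP => g; rewrite !ffunE /GRing.scale /= mulrA.
apply: (@alg_iso_from F _ _ f) => //.
- pose f1 := GRing.isLinear.Build F _ _ _ f fL.
  pose ff : {linear twisted_alg a -> twisted_alg b} := HB.pack f f1.
  have fE : f =1 ff by [].
  split=> [|z w].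
    rewrite [1]/(tw_one a) fE linearZ -fE /= fu [RHS]/(tw_one b) scalerA.
    have /(mulfI (uvalP _)) -> : uval (s 1%g) * uval (a (1%g, 1%g)) =
        uval (s 1%g) * (uval (s 1%g) * uval (b (1%g, 1%g))).
      by have := cE 1%g 1%g; rewrite mulg1 -mulrA mulrC.
    by rewrite invfM mulrAC mulVf ?uvalP // mul1r.
  rewrite (tw_basisE z) mulr_suml !fE !linear_sum mulr_suml.
  apply: eq_bigr => g _; rewrite (tw_basisE w) mulr_sumr !linear_sum mulr_sumr.
  apply: eq_bigr => h _; rewrite -!fE -scalerAl -scalerAr tw_basisM !fZ !fu.
  rewrite -scalerAl -scalerAr -[in RHS]scalerAl -[in RHS]scalerAr tw_basisM.
  by rewrite !scalerA -!mulrA cE !mulrA.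
pose f' (z : twisted_alg b) : twisted_alg a := [ffun g => z g / uval (s g)].
by exists f' => z; apply/ffunP => g; rewrite !ffunE ?mulfK ?mulfVK ?uvalP.
Qed.

Section UnitsExp.
Variable F : fieldType.

Lemma uvalMn (x : units F) n : uval (x *+ n) = uval x ^+ n.
Proof.
elim: n => [|n IHn]; first by rewrite mulr0n uval0 expr0.
by rewrite mulrS uvalD IHn exprS.
Qed.

Lemma uval_inj : injective (@uval F).
Proof. exact: val_inj. Qed.
End UnitsExp.

Section CyclicCharacter.
Variables (V : zmodType) (n : nat) (v : V).

Lemma mulrn_modn k : v *+ n.+1 = 0 -> v *+ (k %% n.+1) = v *+ k.
Proof.
by move=> vn; rewrite [in RHS](divn_eq k n.+1) mulrnDr mulnC mulrnA vn mul0rn add0r.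
Qed.

(** The morphism from the cyclic group ['I_n.+1] that sends 1 to [v]. The proof that [v] is killed
    by [n.+1] is an argument, so that the additive structure can be declared on it. *)
Definition Zp_mulrn (_ : v *+ n.+1 = 0) (i : 'I_n.+1) : V := v *+ i.

Fact Zp_mulrn_is_zmod_morphism vn : zmod_morphism (Zp_mulrn vn).
Proof.
move=> i j; rewrite /Zp_mulrn /= mulrn_modn // mulrnDr; congr (_ + _).
rewrite mulrn_modn //; apply: (addIr (v *+ j)).
by rewrite -mulrnDr subnK ?vn ?addNr // ltnW.
Qed.
HB.instance Definition _ vn :=
  GRing.isZmodMorphism.Build 'I_n.+1 V (Zp_mulrn vn)
    (Zp_mulrn_is_zmod_morphism vn).
End CyclicCharacter.

(** Summing the cocycle identity over its third variable exhibits |G| a as the coboundary of g |->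
    sum_k a(g, k). *)
Lemma class2_card (A : zmodType) (G : finGroupType) (a : cocycle A G) :
  class2 a *+ #|G| = 0.
Proof.
rewrite -raddfMn -(raddf0 (@class2 A G)); apply/class2_eq.
exists (fun g => \sum_k a (g, k)) => g h.
have MnE n : (a *+ n) (g, h) = a (g, h) *+ n.
  by elim: n => [|n IHn]; rewrite ?mulr0n ?ffunE // !mulrS ffunE IHn.
rewrite MnE ffunE add0r -sumr_const.
rewrite [X in X - _]addrC [X in _ + X - _](reindex_inj (mulgI h)) /=.
rewrite -big_split -sumrB; apply: eq_bigr => k _ /=.
by rewrite -cocycleE addrK.
Qed.

Lemma cocycleMnE (A : zmodType) (G : finGroupType) (a : cocycle A G) n p :
  (a *+ n) p = a p *+ n.
Proof. by elim: n => [|n IHn]; rewrite ?mulr0n ?ffunE // !mulrS ffunE IHn. Qed.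

Section ClosedField.
Variable F : numClosedFieldType.

Lemma prim_root_exists n : (0 < n)%N -> exists z : F, n.-primitive_root z.
Proof.
move=> n_gt0; pose p : {poly F} := 'X^n - 1.
have [r Dp] := closed_field_poly_normal p.
move: Dp; rewrite lead_coefXnsubC // scale1r => Dp.
have rn1 : all n.-unity_root r by apply/allP => z; rewrite -root_prod_XsubC -Dp.
have sz_r : (n < (size r).+1)%N by rewrite -(size_prod_XsubC r id) -Dp size_XnsubC.
have Ur : uniq r.
  by rewrite -separable_prod_XsubC -Dp separable_Xn_sub_1 // pnatr_eq0 -lt0n.
by have [z] := hasP (has_prim_root n_gt0 rn1 Ur sz_r); exists z.
Qed.

Variable G : finGroupType.
Implicit Types a : cocycle (units F) G.

(** If [a *+ n.+1] is the coboundary of [s], subtracting from [a] the coboundary of an [n.+1]-st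
    root of [s] leaves values that are [n.+1]-st roots of unity. *)
Lemma root_of_unity_cocycle a n (z : units F) (zn : z *+ n.+1 = 0) :
  n.+1.-primitive_root (uval z) -> class2 a *+ n.+1 = 0 ->
  exists a' : cocycle 'I_n.+1 G,
    class2 a = class2 (cocycle_map (Zp_mulrn zn) a').
Proof.
move=> prim_z; rewrite -raddfMn -(raddf0 (@class2 _ G)) => /class2_eq[s sP].
have root_nz g : n.+1.-root (uval (s g)) != 0 by rewrite rootC_eq0 // uvalP.
pose t g := Units (root_nz g).
have tE g : t g *+ n.+1 = s g by apply: uval_inj; rewrite uvalMn rootCK.
pose b g h := a (g, h) - (t g + t h - t (g * h)%g).
have bE g h : exists i : 'I_n.+1, b g h = z *+ i.
  have : b g h *+ n.+1 = 0.
    rewrite mulrnBl -cocycleMnE sP ffunE add0r mulrnBl mulrnDl !tE.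
    exact: subrr.
  move/(congr1 (@uval F)); rewrite uvalMn => /(prim_rootP prim_z)[i bi].
  by exists i; apply: uval_inj; rewrite uvalMn.
have [f fP] := choice (fun p : G * G => bE p.1 p.2).
have inj_z : injective (Zp_mulrn zn).
  move=> i j /(congr1 (@uval F)); rewrite !uvalMn => /eqP.
  by rewrite (eq_prim_root_expr prim_z) !modn_small // => /eqP/val_inj.
have cZ : [ffun p => f p] \in Z2 (A := 'I_n.+1) (G := G).
  apply/Z2P => g h k; apply: inj_z; rewrite !raddfD !ffunE /=.
  have fE p : Zp_mulrn zn (f p) = b p.1 p.2 by rewrite fP.
  rewrite !fE /b /= mulgA [LHS]addrACA [RHS]addrACA cocycleE; congr (_ + _).
  rewrite -!opprD (addrC (t g) (t (h * k)%g)); congr (- _).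
  by rewrite !addrA !subrK; congr (_ - _); rewrite [RHS]addrC addrA.
exists (Cocycle cZ); apply/class2_eq; exists t => g h.
by rewrite cocycle_mapE /= ffunE /Zp_mulrn -fP /b /= subrK.
Qed.

(** The class is killed by |G|, hence represented by a cocycle with values in the |G|-th roots of
    unity, and the central extension by these is finite. *)
Lemma splitting_exists a :
  exists (I : finType) (d : I -> nat) (rho : forall i, G -> 'M[F]_(d i)),
    splitting a rho.
Proof.
have [n cardG] : exists n, #|G| = n.+1 by exists #|G|.-1; rewrite prednK // -cardsT cardG_gt0.
have [z prim_z] := prim_root_exists (ltn0Sn n).
have z0 : z != 0.
  apply/eqP => z0; have := prim_expr_order prim_z.
  by rewrite z0 expr0n /= => /eqP; rewrite eq_sym oner_eq0.
pose u := Units z0.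
have un : u *+ n.+1 = 0 by apply: uval_inj; rewrite uvalMn (prim_expr_order prim_z).
have [|a' aa'] := root_of_unity_cocycle un prim_z (a := a).
  by rewrite -cardG class2_card.
have [I [d [rho rhoS]]] := twisted_splitting a' (Zp_mulrn un).
exists I, d; apply: splitting_transport rhoS; exact: class2_alg_iso.
Qed.

End ClosedField.

Lemma spectrum0 (F : numFieldType) (G : finGroupType)
    (a : cocycle (units F) G) : spectrum a 0 = #|G|%:R.
Proof.
rewrite /spectrum expr0 [X in _ * X = _]ffunE ffunE eqxx /GRing.scale /= mulr1.
by rewrite mulfK ?uvalP.
Qed.

Lemma count_mem_image (I : finType) (d : I -> nat) n :
  count_mem n [seq d i | i : I] = #|[pred i | d i == n]|.
Proof. by rewrite count_map enumT cardE /enum_mem size_filter. Qed.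

(** By linearity the weighted sums of the values of any polynomial at the points (N/m)^2 agree. A
    polynomial vanishing at all these points except the one for [n] isolates the multiplicity of
    [n]. *)
Lemma power_sums_perm (F : numFieldType) (I J : finType) (d : I -> nat)
    (e : J -> nat) (N : nat) :
  (0 < N)%N -> (forall i, (0 < d i)%N) -> (forall j, (0 < e j)%N) ->
  (forall k, \sum_i (d i)%:R ^+ 2 * ((N%:R / (d i)%:R) ^+ 2) ^+ k =
             \sum_j (e j)%:R ^+ 2 * ((N%:R / (e j)%:R) ^+ 2) ^+ k :> F) ->
  perm_eq [seq d i | i : I] [seq e j | j : J].
Proof.
move=> N0 d0 e0 eq_sums.
pose x (m : nat) : F := (N%:R / m%:R) ^+ 2.
have x_inj m n : (0 < m)%N -> (0 < n)%N -> x m = x n -> m = n.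
  move=> m0 n0 /eqP; rewrite eqrXn2 ?divr_ge0 ?ler0n // => /eqP.
  have Nz : N%:R != 0 :> F by rewrite pnatr_eq0 -lt0n.
  by move/(mulfI Nz)/invr_inj/eqP; rewrite eqr_nat => /eqP.
have eq_polys (p : {poly F}) : \sum_i (d i)%:R ^+ 2 * p.[x (d i)] =
    \sum_j (e j)%:R ^+ 2 * p.[x (e j)].
  have expand (K : finType) (c : K -> nat) : \sum_i (c i)%:R ^+ 2 * p.[x (c i)] =
      \sum_(k < size p) p`_k * \sum_i (c i)%:R ^+ 2 * x (c i) ^+ k.
    transitivity (\sum_i \sum_(k < size p) p`_k * ((c i)%:R ^+ 2 * x (c i) ^+ k)).
      apply: eq_bigr => i _; rewrite horner_coef mulr_sumr.
      by apply: eq_bigr => k _; rewrite mulrCA.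
    by rewrite exchange_big; apply: eq_bigr => k _; rewrite mulr_sumr.
  by rewrite !expand; apply: eq_bigr => k _; rewrite eq_sums.
pose S := [seq d i | i : I] ++ [seq e j | j : J].
apply/allP => n nS /=; rewrite !count_mem_image.
have S0 m : m \in S -> (0 < m)%N.
  by rewrite mem_cat => /orP[] /imageP[i _ ->].
pose p : {poly F} := \prod_(m <- undup S | m != n) ('X - (x m)%:P).
have p0 m : m \in S -> m != n -> p.[x m] = 0.
  move=> mS mn; rewrite /p horner_prod (big_rem m) ?mem_undup //= mn.
  by rewrite hornerXsubC subrr mul0r.
have pn : p.[x n] != 0.
  rewrite /p horner_prod prodf_seq_neq0; apply/allP => m; rewrite mem_undup => mS.
  apply/implyP => mn; rewrite hornerXsubC subr_eq0; apply: contraNneq mn.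
  by move/x_inj=> /(_ (S0 _ nS) (S0 _ mS)) ->.
have expand (K : finType) (c : K -> nat) : (forall i, c i \in S) ->
    \sum_i (c i)%:R ^+ 2 * p.[x (c i)] =
    #|[pred i | c i == n]|%:R * (n%:R ^+ 2 * p.[x n]).
  move=> cS; rewrite (bigID [pred i | c i == n]) /= [X in _ + X]big1 ?addr0.
    rewrite mulr_natl -sumr_const; apply: eq_big => i; first by rewrite inE.
    by move/eqP->.
  by move=> i cin; rewrite p0 ?mulr0.
have := eq_polys p; rewrite !expand => [/mulIf|j|i].
- rewrite mulf_neq0 ?expf_neq0 ?pnatr_eq0 -?lt0n ?S0 // => /(_ isT)/eqP.
  by rewrite eqr_nat.
- by rewrite mem_cat image_f ?orbT.
- by rewrite mem_cat image_f.
Qed.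

(** Equal spectra agree at 0, where they give the group orders; [power_sums_perm] then shows that
    the degrees agree. *)
Theorem alg_isoP (F : numClosedFieldType) (G H : finGroupType)
    (a : cocycle (units F) G) (b : cocycle (units F) H) :
  alg_iso (twisted_alg a) (twisted_alg b) <-> spectrum a =1 spectrum b.
Proof.
have [J [e [rho' rhoS']]] := splitting_exists b.
split=> [iso_ab k|eq_ab].
  have [rho rhoS] := splitting_transport iso_ab rhoS'.
  have cardE : #|G|%:R = #|H|%:R :> F.
    by rewrite -(spectrum0 a) -(spectrum0 b) !(spectrumE rhoS, spectrumE rhoS').
  by rewrite (spectrumE rhoS) (spectrumE rhoS') cardE.
have [I [d [rho rhoS]]] := splitting_exists a.
have cardE : #|G| = #|H|.
  by apply/eqP; rewrite -(eqr_nat F) -(spectrum0 a) -(spectrum0 b) eq_ab.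
have /perm_eq_reindex[f bij_f de] : perm_eq [seq d i | i : I] [seq e j | j : J].
  apply: (@power_sums_perm F _ _ _ _ #|H|) => [|i|j|k].
  - by rewrite -cardsT cardG_gt0.
  - by case: rhoS.
  - by case: rhoS'.
  by have := eq_ab k; rewrite (spectrumE rhoS) (spectrumE rhoS') cardE.
move: (splitting_reindex bij_f rhoS); rewrite -{}de in rho' rhoS' *.
move=> rhoS2; exact: splitting_alg_iso rhoS2 rhoS'.
Qed.

(** * Galois conjugate classes *)

Section CyclotomicConjugates.
Variables (F : numFieldType) (n : nat).
Local Notation ratF := (map_poly (ratr : rat -> F)).
Local Notation PhiQ := (map_poly (intr : int -> rat) 'Phi_n).

Lemma root_Cyclotomic (z : F) :
  n.-primitive_root z -> root (ratF PhiQ) z.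
Proof.
move=> prim_z; have n0 := prim_order_gt0 prim_z.
have intF (p : {poly int}) : ratF (map_poly intr p) = map_poly intr p.
  by rewrite -map_poly_comp; apply: eq_map_poly => x; rewrite /= ratr_int.
have unityE m : (0 < m)%N -> z ^+ m == 1 =
    has (fun d => root (map_poly (intr : int -> F) 'Phi_d) z) (divisors m).
  move=> m0; rewrite -unity_rootE /root_of_unity.
  have <- : map_poly (intr : int -> F) ('X^m - 1) = 'X^m - 1.
    by rewrite rmorphB /= map_polyXn rmorph1.
  by rewrite -(prod_Cyclotomic m0) rmorph_prod /root horner_prod prodf_seq_eq0.
have := unityE n n0; rewrite (prim_expr_order prim_z) eqxx.
case/esym/hasP => d d_dv root_d; rewrite intF.
suff -> : n = d by exact: root_d.
have dvd_dn : (d %| n)%N by rewrite dvdn_divisors.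
have d0 : (0 < d)%N := dvdn_gt0 n0 dvd_dn.
apply/eqP; rewrite eqn_dvd dvd_dn andbT (prim_order_dvd prim_z) unityE //.
by apply/hasP; exists d; rewrite // -dvdn_divisors.
Qed.

(** Irreducibility of the cyclotomic polynomial is known through minimal polynomials in [algC]. The
    gcd of [p] and this polynomial over the rationals is not constant, as [z] is a root in [F]; so
    it has a root in [algC], again a primitive n-th root, which forces the divisibility. *)
Lemma Cyclotomic_dvd (z : F) (p : {poly rat}) :
  n.-primitive_root z -> root (ratF p) z -> PhiQ %| p.
Proof.
move=> prim_z pz; have n0 := prim_order_gt0 prim_z.
have algPhi (w : algC) : n.-primitive_root w ->
    forall q : {poly rat}, root (map_poly ratr q) w = (PhiQ %| q).
  move=> prim_w; have [q [eq_q _] qP] := minCpolyP w.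
  suff <- : q = PhiQ by [].
  apply: (map_inj_poly (@fmorph_inj _ _ (ratr : {rmorphism rat -> algC}))).
    by rewrite rmorph0.
  rewrite -eq_q (minCpoly_cyclotomic prim_w) -(Cintr_Cyclotomic prim_w).
  by rewrite -map_poly_comp; apply: eq_map_poly => x; rewrite /= ratr_int.
pose g := gcdp p PhiQ.
have gz : root (ratF g) z by rewrite gcdp_map root_gcd pz root_Cyclotomic.
have g0 : g != 0.
  by rewrite gcdp_eq0 negb_and orbC monic_neq0 // monic_map // Cyclotomic_monic.
have [w gw] : exists w : algC, root (map_poly ratr g) w.
  apply/closed_rootP; rewrite size_map_poly.
  apply: contraTneq gz => /eqP/size_poly1P[c c0 ->].
  by rewrite map_polyC /= rootC fmorph_eq0.
have prim_w : n.-primitive_root w.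
  have [u prim_u] := C_prim_root_exists n0.
  rewrite -(root_cyclotomic prim_u) -(Cintr_Cyclotomic prim_u).
  have -> : map_poly intr 'Phi_n = map_poly ratr PhiQ :> {poly algC}.
    by rewrite -map_poly_comp; apply: eq_map_poly => x; rewrite /= ratr_int.
  by apply: root_dvdp gw; rewrite dvdp_map dvdp_gcdr.
by rewrite (dvdp_trans _ (dvdp_gcdl p PhiQ)) // -(algPhi w).
Qed.

Lemma root_rat_conj (z : F) (p : {poly rat}) k :
  n.-primitive_root z -> coprime k n -> root (ratF p) z -> root (ratF p) (z ^+ k).
Proof.
move=> prim_z co_kn /(Cyclotomic_dvd prim_z) dvd_p.
have: root (ratF PhiQ) (z ^+ k).
  by rewrite root_Cyclotomic // prim_root_exp_coprime.
by apply: root_dvdp; rewrite dvdp_map.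
Qed.
End CyclotomicConjugates.

Section PolynomialFamilies.
Variables (F : fieldType) (G : finGroupType) (n : nat) (a : cocycle 'I_n.+1 G).
Local Notation ca un := (cocycle_map (Zp_mulrn un) a).
Local Notation intF := (map_poly (intr : int -> F)).

(** The coordinates are fixed integer polynomials in the root of unity [u]. Varying [u] takes the
    place of a field automorphism of [F]. *)
Definition poly_family
    (z : forall (u : units F) (un : u *+ n.+1 = 0), twisted_alg (ca un)) :=
  exists Q : G -> {poly int}, forall u un g, z u un g = (intF (Q g)).[uval u].

Lemma poly_family_basis g : poly_family (fun u un => tw_basis (ca un) g).
Proof.
exists (fun h => (h == g)%:R) => u un h.
by rewrite ffunE rmorph_nat hornerMn hornerC.
Qed.

Lemma poly_family_sum (I : Type) (r : seq I) z :
  (forall i : I, poly_family (z i)) ->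
  poly_family (fun u un => \sum_(i <- r) z i u un).
Proof.
move=> /choice[Q QP]; exists (fun g => \sum_(i <- r) Q i g) => u un g.
rewrite sum_ffunE rmorph_sum horner_sum; apply: eq_bigr => i _; exact: QP.
Qed.

Lemma poly_family_mul z w : poly_family z -> poly_family w ->
  poly_family (fun u un => z u un * w u un).
Proof.
move=> [Q QP] [R RP].
exists (fun k => \sum_g \sum_h Q g * R h * 'X^(a (g, h)) * (k == (g * h)%g)%:R).
move=> u un k; rewrite [_ * _]/(tw_mul _ _) sum_ffunE rmorph_sum horner_sum.
apply: eq_bigr => g _; rewrite sum_ffunE rmorph_sum horner_sum.
apply: eq_bigr => h _; rewrite !ffunE !rmorphM /= map_polyXn rmorph_nat.
by rewrite !hornerM hornerXn hornerMn hornerC -QP -RP -uvalMn.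
Qed.

Lemma poly_family_inv g : poly_family (fun u un => tw_inv (ca un) g).
Proof.
(* Negating in ['I_n.+1] gives a natural exponent for the inverse, as [u] is a root of unity. *)
exists (fun h => 'X^(- (a (g, (g^-1)%g) + a (1%g, 1%g))) * (h == (g^-1)%g)%:R).
move=> u un h; move eE: (- (_ + _)) => e; rewrite !ffunE rmorphM /= map_polyXn rmorph_nat.
rewrite hornerM hornerXn hornerMn hornerC -uvalMn.
by rewrite -[u *+ _]/(Zp_mulrn un _) -eE raddfN raddfD uvalN uvalD.
Qed.

Lemma poly_family_one : poly_family (fun u un => 1).
Proof.
exists (fun h => 'X^(- a (1%g, 1%g)) * (h == 1%g)%:R).
move=> u un h; move eE: (- a _) => e; rewrite !ffunE rmorphM /= map_polyXn rmorph_nat.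
rewrite hornerM hornerXn hornerMn hornerC -uvalMn.
by rewrite -[u *+ _]/(Zp_mulrn un _) -eE raddfN uvalN.
Qed.

Lemma spectrum_poly k : exists P : {poly int},
  forall (u : units F) (un : u *+ n.+1 = 0), spectrum (ca un) k = (intF P).[uval u].
Proof.
have [Q QP] : poly_family (fun u un => commutator_sum (ca un) ^+ k).
  have fT : poly_family (fun u un => commutator_sum (ca un)).
    do 2!(apply: poly_family_sum => ?).
    by do !apply: poly_family_mul; try exact: poly_family_basis;
       exact: poly_family_inv.
  elim: k => [|k IHk]; first exact: poly_family_one.
  have [Q QP] := poly_family_mul fT IHk.
  by exists Q => u un g; rewrite exprS QP.
exists (#|G|%:R * 'X^(a (1%g, 1%g)) * Q 1%g) => u un.
rewrite /spectrum QP !rmorphM /= map_polyXn rmorph_nat !hornerM hornerXn.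
by rewrite hornerMn hornerC cocycle_mapE uvalMn.
Qed.
End PolynomialFamilies.

(* By [spectrumE] the spectrum is rational, and by [spectrum_poly] it is the  *)
(* value of a rational polynomial at a root of unity: it is unchanged when    *)
(* the root of unity is replaced by a conjugate.                              *)
Theorem Galois_alg_iso (F : numClosedFieldType) (G : finGroupType)
    (a b : cocycle (units F) G) n k :
  (0 < n)%N -> coprime k n -> class2 a *+ n = 0 -> class2 b = class2 a *+ k ->
  alg_iso (twisted_alg a) (twisted_alg b).
Proof.
case: n => // n _ co_kn an0 bE.
have [z prim_z] := @prim_root_exists F n.+1 isT.
have z0 : z != 0.
  apply/eqP => z0; have := prim_expr_order prim_z.
  by rewrite z0 expr0n /= => /eqP; rewrite eq_sym oner_eq0.
pose u := Units z0.
have un : u *+ n.+1 = 0 by apply: uval_inj; rewrite uvalMn (prim_expr_order prim_z).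
have ukn : (u *+ k) *+ n.+1 = 0 by rewrite mulrnAC un mul0rn.
have [|a' aa'] := root_of_unity_cocycle un prim_z (a := a); first by [].
(* Up to a coboundary, [b] is the cocycle [a'] evaluated at the k-th power of the root of unity
   [u]. *)
have ba' : class2 b = class2 (cocycle_map (Zp_mulrn ukn) a').
  rewrite bE aa' -raddfMn; congr class2; apply: val_inj; apply/ffunP => p.
  rewrite /= -[LHS]/((cocycle_map (Zp_mulrn un) a' *+ k) p) cocycleMnE.
  by rewrite !ffunE /Zp_mulrn /= mulrnAC.
apply: alg_iso_trans (class2_alg_iso aa') _.
apply: alg_iso_trans (alg_iso_sym (class2_alg_iso ba')).
apply/alg_isoP => m.
have [I [d [rho rhoS]]] := splitting_exists (cocycle_map (Zp_mulrn un) a').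
have [P PP] := spectrum_poly F a' m.
pose q : rat := \sum_i (d i)%:R ^+ 2 * ((#|G|%:R / (d i)%:R) ^+ 2) ^+ m.
have qE : spectrum (cocycle_map (Zp_mulrn un) a') m = ratr q.
  rewrite (spectrumE rhoS) rmorph_sum; apply: eq_bigr => i _ /=.
  by rewrite !(rmorphM, rmorphXn, fmorphV, ratr_nat) /= !ratr_nat.
pose p : {poly rat} := map_poly intr P - q%:P.
have rootpE x : root (map_poly ratr p) x = ((map_poly intr P).[x] == ratr q :> F).
  rewrite rmorphB /= map_polyC -map_poly_comp /root hornerD hornerN hornerC.
  rewrite subr_eq0; congr (_.[_] == _); apply: eq_map_poly => y.
  by rewrite /= ratr_int.
have: root (map_poly (ratr : rat -> F) p) (z ^+ k).
  by apply: (root_rat_conj prim_z co_kn); rewrite rootpE -qE PP.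
by rewrite rootpE => /eqP; rewrite qE PP uvalMn.
Qed.

(** * Dimensions of projective representations *)

Section ProjectiveDimensions.
Variable F : fieldType.
Implicit Type G : finGroupType.

Definition proj_dim G (a : cocycle (units F) G) n :=
  (0 < n)%N /\ exists X : G -> 'M[F]_n, proj_rep a X.

Lemma proj_dim_fin G (a : cocycle (units F) G) (I : finType)
    (X : G -> I -> I -> F) : (0 < #|I|)%N ->
  (forall i j, X 1%g i j = uval (a (1%g, 1%g)) * (i == j)%:R) ->
  (forall g h i k, \sum_j X g i j * X h j k =
                   uval (a (g, h)) * X (g * h)%g i k) ->
  proj_dim a #|I|.
Proof.
move=> I0 X1 XM; split=> //.
exists (fun g => \matrix_(i, j) X g (enum_val i) (enum_val j)); split=> [|g h].
  by apply/matrixP => i j; rewrite !mxE X1 (inj_eq enum_val_inj) mulr_natr.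
apply/matrixP => i k; rewrite !mxE -XM.
rewrite [RHS](reindex _ (onW_bij _ (@enum_val_bij I))) /=.
by apply: eq_bigr => j _; rewrite !mxE.
Qed.

Lemma proj_dim_alg_iso G H (a : cocycle (units F) G) (b : cocycle (units F) H) n :
  alg_iso (twisted_alg a) (twisted_alg b) -> proj_dim b n -> proj_dim a n.
Proof.
move=> [f _] [n0 [X repX]]; split=> //.
by exists (fun g => proj_op X (f (tw_basis a g))); apply: proj_rep_transport.
Qed.

Lemma proj_dim_regular G (a : cocycle (units F) G) : proj_dim a #|G|.
Proof.
apply: (@proj_dim_fin _ _ _ (fun g x y => uval (a (g, y)) * (x == (g * y)%g)%:R)).
- by rewrite -cardsT cardG_gt0.
- by move=> x y; rewrite mul1g cocycle1l.
move=> g h x z; rewrite (bigD1 (h * z)%g) //= eqxx mulr1 big1 ?addr0.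
  by rewrite mulgA mulrAC mulrA -!uvalD cocycleE addrC.
by move=> y yhz; rewrite (negPf yhz) !mulr0.
Qed.

(** The determinants of the matrices [X g] form a cochain whose coboundary is the n-th power of the
    cocycle. *)
Lemma proj_dim_det G (a : cocycle (units F) G) n :
  proj_dim a n -> class2 a *+ n = 0.
Proof.
move=> [n0 [X repX]]; have [_ XM] := repX.
have detX g : \det (X g) != 0.
  have /(congr1 determinant): X g *m proj_op X (tw_inv a g) = 1%:M.
    by rewrite -{1}(proj_op_basis a X g) -proj_opM // tw_mul_inv proj_op1.
  rewrite det_mulmx det1 => /eqP; apply: contraTneq => ->.
  by rewrite mul0r eq_sym oner_eq0.
rewrite -raddfMn -(raddf0 (@class2 _ G)); apply/class2_eq.
exists (fun g => Units (detX g)) => g h; rewrite cocycleMnE ffunE add0r.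
apply: uval_inj; rewrite !uvalD uvalN uvalMn /= -det_mulmx XM detZ.
by rewrite mulfK.
Qed.

Lemma proj_dim0 G : proj_dim (0 : cocycle (units F) G) 1.
Proof.
split=> //; exists (fun=> 1%:M); split=> [|g h]; first by rewrite ffunE.
by rewrite ffunE uval0 scale1r mulmx1.
Qed.

Lemma proj_dimD G (a b : cocycle (units F) G) m n :
  proj_dim a m -> proj_dim b n -> proj_dim (a + b) (m * n).
Proof.
move=> [m0 [X [X1 XM]]] [n0 [Y [Y1 YM]]].
have -> : (m * n)%N = #|{: 'I_m * 'I_n}| by rewrite card_prod !card_ord.
apply: (@proj_dim_fin _ _ _ (fun g i j => X g i.1 j.1 * Y g i.2 j.2)).
- by rewrite card_prod !card_ord muln_gt0 m0.
- move=> [i i'] [j j'] /=; rewrite X1 Y1 !mxE ffunE uvalD.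
  by rewrite xpair_eqE -mulnb natrM mulrACA !mulr_natr.
move=> g h [i i'] [k k'] /=.
rewrite -(pair_big xpredT xpredT (fun j j' => X g i j * Y g i' j' *
   (X h j k * Y h j' k'))) /= ffunE uvalD mulrACA.
have /matrixP/(_ i k) := XM g h; have /matrixP/(_ i' k') := YM g h.
rewrite !mxE => <- <-; rewrite mulr_suml; apply: eq_bigr => j _.
by rewrite mulr_sumr; apply: eq_bigr => j' _; rewrite mulrACA.
Qed.

Section SymmetricPower.
Variables (G : finGroupType) (a : cocycle (units F) G) (n p : nat).
Variable X : G -> 'M[F]_n.+1.
Hypothesis repX : proj_rep a X.
Local Notation r := (relpre (@nat_of_ord n.+1) leq).
Local Notation T := (p.-tuple 'I_n.+1).
Local Notation S := {t : T | sorted leq (map val t)}.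

Let r_total : total r. Proof. by move=> i j; exact: leq_total. Qed.
Let r_trans : transitive r. Proof. by move=> i j k; exact: leq_trans. Qed.
Let r_anti : antisymmetric r.
Proof. by move=> i j /anti_leq/val_inj. Qed.

Lemma prod_sum_tuple (I : finType) (f : 'I_p -> I -> F) :
  \prod_k \sum_i f k i = \sum_(t : p.-tuple I) \prod_k f k (tnth t k).
Proof.
rewrite bigA_distr_bigA /= (reindex (fun t : p.-tuple I => [ffun k => tnth t k])).
  by apply: eq_bigr => t _; apply: eq_bigr => k _; rewrite ffunE.
exists (fun f : {ffun 'I_p -> I} => [tuple f k | k < p]) => t _.
  by apply: eq_from_tnth => k; rewrite tnth_mktuple ffunE.
by apply/ffunP => k; rewrite ffunE tnth_mktuple.
Qed.

(** The matrix of the p-th symmetric power in the basis of monomials, which are indexed by sorted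
    tuples: all rearrangements of [t'] contribute. The tuple [t] is left unsorted, since
    intermediate tuples in a product are. *)
Definition sym_entry g (t : T) (t' : S) : F :=
  \sum_(f : T | sort r f == val t') \prod_k X g (tnth t k) (tnth f k).

Lemma sym_entry_perm g (t u : T) t' :
  perm_eq t u -> sym_entry g t t' = sym_entry g u t'.
Proof.
move=> /tuple_permP[s ts]; have {ts}-> : t = [tuple tnth u (s k) | k < p].
  exact: val_inj.
rewrite /sym_entry (reindex (fun f : T => [tuple tnth f (s k) | k < p])) /=.
  apply: eq_big => f.
    congr (_ == _); apply/(perm_sortP r_total r_trans r_anti).
    by apply/tuple_permP; exists s.
  move=> _; rewrite [RHS](reindex_inj (@perm_inj _ s)) /=.
  by apply: eq_bigr => k _; rewrite !tnth_mktuple.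
exists (fun f : T => [tuple tnth f ((s^-1)%g k) | k < p]) => f _;
  by apply: eq_from_tnth => k; rewrite !tnth_mktuple ?permK ?permKV.
Qed.

Fact sort_sorted (f : T) : sorted leq (map val (sort_tuple r f)).
Proof. by rewrite sorted_map sort_sorted. Qed.

Lemma proj_dim_sym : proj_dim (a *+ p) 'C(p + n, p).
Proof.
have cardS : #|{: S}| = 'C(p + n, p).
  by rewrite -card_sorted_tuples cardsE card_sig.
have sort_id (t : S) : sort r (val t) = val t.
  by apply: sorted_sort => //; have := valP t; rewrite sorted_map.
rewrite -cardS.
apply: (@proj_dim_fin _ _ _ (fun g (t t' : S) => sym_entry g (val t) t')).
- by rewrite cardS bin_gt0 leq_addr.
- move=> t t'; rewrite /sym_entry cocycleMnE uvalMn; have [-> _] := repX.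
  have prodE (f : T) : \prod_k (uval (a (1%g, 1%g)))%:M (tnth (val t) k) (tnth f k) =
      uval (a (1%g, 1%g)) ^+ p * (val t == f)%:R :> F.
    have [<-|tf] := eqVneq.
      have -> x : x ^+ p = \prod_(k < p) x :> F by rewrite prodr_const card_ord.
      rewrite mulr1; apply: eq_bigr => k _; by rewrite mxE eqxx.
    have /forallPn[k tfk] : ~~ [forall k, tnth (val t) k == tnth f k].
      apply: contra tf => /forallP tf; apply/eqP/eq_from_tnth => k.
      exact/eqP.
    by rewrite (bigD1 k) //= mxE (negPf tfk) mul0r mulr0.
  under eq_bigr do rewrite prodE.
  rewrite -mulr_sumr; congr (_ * _).
  have [<-|tt'] := eqVneq t t'.
    rewrite (bigD1 (val t)) /=; last by rewrite sort_id.
    by rewrite eqxx big1 ?addr0 // => f /andP[_ ft]; rewrite eq_sym (negPf ft).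
  rewrite big1 // => f /eqP ft'; case: eqP => // tf.
  by case/eqP: tt'; apply: val_inj; apply: val_inj; rewrite /= -ft' -tf sort_id.
move=> g h t t''.
(* Rearrangements of one tuple contribute equally, so the sum over sorted tuples unfolds into a sum
   over all tuples. *)
pose srt (f : T) : S := exist _ (sort_tuple r f) (sort_sorted f).
transitivity (\sum_(f : T) (\prod_k X g (tnth (val t) k) (tnth f k)) *
    sym_entry h f t'').
  rewrite [RHS](partition_big srt xpredT) //=; apply: eq_bigr => t' _.
  rewrite mulr_suml; apply: eq_big => f.
    by rewrite -val_eqE /= -val_eqE.
  move/eqP=> ft'; congr (_ * _); apply: sym_entry_perm.
  by rewrite -ft' perm_sort.
rewrite /sym_entry cocycleMnE uvalMn mulr_sumr.
under eq_bigr do rewrite mulr_sumr.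
rewrite exchange_big /=; apply: eq_bigr => f _.
have [_ XM] := repX.
transitivity (\prod_k \sum_i X g (tnth (val t) k) i * X h i (tnth f k)).
  by rewrite prod_sum_tuple; apply: eq_bigr => u _; rewrite big_split.
have -> x : x ^+ p = \prod_(k < p) x :> F by rewrite prodr_const card_ord.
rewrite -big_split; apply: eq_bigr => k _ /=.
by have /matrixP/(_ (tnth (val t) k) (tnth f k)) := XM g h; rewrite !mxE.
Qed.
End SymmetricPower.
End ProjectiveDimensions.

(** From p C(p+n, p) = (n+1) C(p+n, p-1), where the last binomial is prime to p: the factors n+2,
    ..., n+p of the falling factorial are not divisible by p. *)
Lemma logn_bin p n : prime p -> (p %| n.+1)%N ->
  (logn p 'C(p + n, p)).+1 = logn p n.+1.
Proof.
move=> p_pr p_n; have p0 := prime_gt0 p_pr.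
have := mul_bin_left (p + n) p.-1; rewrite prednK // => e.
have e2 : (p + n - p.-1 = n.+1)%N by rewrite -{1}(prednK p0) addSnnS addKn.
have nd : ~~ (p %| 'C(p + n, p.-1))%N.
  suff : ~~ (p %| (p + n) ^_ p.-1)%N by rewrite -bin_ffact Euclid_dvdM // negb_or => /andP[].
  rewrite ffact_prod; elim/big_ind: _ => [|x y Hx Hy|i _].
  - by rewrite dvdn1 neq_ltn prime_gt1 ?orbT.
  - by rewrite Euclid_dvdM // negb_or Hx.
  have ip : (i < p.-1)%N := ltn_ord i.
  have -> : (p + n - i = n.+1 + (p.-1 - i))%N.
    rewrite addnBA; last exact: ltnW.
    by rewrite -{1}(prednK p0) addSnnS addnC.
  rewrite dvdn_addr // gtnNdvd // ?subn_gt0 //.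
  by rewrite (leq_ltn_trans (leq_subr _ _)) // prednK.
have C0 : (0 < 'C(p + n, p))%N by rewrite bin_gt0 leq_addr.
have C1 : (0 < 'C(p + n, p.-1))%N.
  by rewrite bin_gt0 (leq_trans (leq_pred p)) // leq_addr.
move: e; rewrite e2 => /(congr1 (logn p)).
rewrite !lognM // (logn_prime p p_pr) eqxx add1n => ->.
by rewrite [X in (_ + X)%N]lognE (negPf nd) !andbF addn0.
Qed.

Lemma eq_mulrn_mod (V : zmodType) (x : V) n j k :
  x *+ n = 0 -> (j = k %[mod n])%N -> x *+ j = x *+ k.
Proof.
have modE m : x *+ n = 0 -> x *+ m = x *+ (m %% n).
  by move=> xn; rewrite {1}(divn_eq m n) mulrnDr mulnC mulrnA xn mul0rn add0r.
by move=> xn jk; rewrite modE // jk -modE.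
Qed.

(* Abstracts "the class x has a projective representation of dimension n":    *)
(* tensor products, determinants and symmetric powers.                        *)
Record dim_structure (V : zmodType) (D : V -> nat -> Prop) : Prop := {
  dim_gt0 : forall x n, D x n -> (0 < n)%N;
  dim_ex : forall x, exists n, D x n;
  dim_zero : D 0 1;
  dim_add : forall x y m n, D x m -> D y n -> D (x + y) (m * n)%N;
  dim_sym : forall p x n, prime p -> (p %| n)%N -> D x n ->
    exists2 m, D (x *+ p) m & (logn p m).+1 = logn p n;
  dim_det : forall x n, D x n -> x *+ n = 0;
  dim_gal : forall x n k m, (0 < n)%N -> coprime k n -> x *+ n = 0 ->
    D x m <-> D (x *+ k) m }.

(** * The least p-adic valuation of the dimensions of a class *)

Section DimValuation.
Variables (V : zmodType) (D : V -> nat -> Prop).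
Hypothesis DS : dim_structure D.
Variable p : nat.
Hypothesis p_pr : prime p.

Fact dim_val_subproof x : exists v, `[< exists2 n, D x n & v = logn p n >].
Proof. by have [n Dn] := dim_ex DS x; exists (logn p n); apply/asboolP; exists n. Qed.

(* The least p-adic valuation of a dimension of x.                            *)
Definition dim_val x := ex_minn (dim_val_subproof x).

Lemma dim_val_ex x : exists2 n, D x n & dim_val x = logn p n.
Proof. by rewrite /dim_val; case: ex_minnP => v /asboolP[n Dn ->] _; exists n. Qed.

Lemma dim_val_min x n : D x n -> (dim_val x <= logn p n)%N.
Proof.
move=> Dn; rewrite /dim_val; case: ex_minnP => v _; apply.
by apply/asboolP; exists n.
Qed.

Lemma dim_valD x y : (dim_val (x + y) <= dim_val x + dim_val y)%N.
Proof.
have [m Dm ->] := dim_val_ex x; have [n Dn ->] := dim_val_ex y.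
rewrite -lognM ?(dim_gt0 DS Dm) ?(dim_gt0 DS Dn) //.
exact: dim_val_min (dim_add DS Dm Dn).
Qed.

Lemma dim_val0 : dim_val 0 = 0%N.
Proof. by apply/eqP; rewrite -leqn0 -(logn1 p); apply: dim_val_min (dim_zero DS). Qed.

Lemma dim_val_mulp x : (0 < dim_val x)%N -> (dim_val (x *+ p) < dim_val x)%N.
Proof.
have [n Dn xn] := dim_val_ex x; rewrite xn logn_gt0 mem_primes => /and3P[_ _ pn].
have [m Dm <-] := dim_sym DS p_pr pn Dn.
by rewrite ltnS dim_val_min.
Qed.

Lemma dim_val_eq0 x : dim_val x = 0%N -> exists2 n, ~~ (p %| n)%N & x *+ n = 0.
Proof.
have [n Dn ->] := dim_val_ex x; have n0 := dim_gt0 DS Dn.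
move=> /eqP; rewrite -leqn0 leqNgt logn_gt0 mem_primes p_pr n0 /= => pn.
by exists n => //; apply: dim_det Dn.
Qed.

Lemma dim_val_Mn_le x m : dim_val x = 0%N -> dim_val (x *+ m) = 0%N.
Proof.
move=> x0; elim: m => [|m IHm]; first by rewrite mulr0n dim_val0.
by apply/eqP; rewrite -leqn0 mulrS (leq_trans (dim_valD _ _)) // x0 IHm.
Qed.

(** Multiplication by p lowers a positive valuation, so some multiple p^j x has valuation 0. As p^j
    is invertible modulo [n], [x] is a multiple of p^j x. *)
Lemma dim_val_coprime x n : ~~ (p %| n)%N -> x *+ n = 0 -> dim_val x = 0%N.
Proof.
move=> pn xn.
have [j jP] : exists j, dim_val (x *+ p ^ j) = 0%N.
  have: (dim_val x <= dim_val x)%N by [].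
  move: {2}(dim_val x) => v; elim: v => [|v IHv] in x {xn} *.
    by rewrite leqn0 => /eqP x0; exists 0%N; rewrite mulr1n.
  have [x0 _|x_gt0 xv] := posnP (dim_val x); first by exists 0%N; rewrite mulr1n.
  have [|j jP] := IHv (x *+ p).
    by rewrite -ltnS (leq_trans (dim_val_mulp x_gt0)).
  by exists j.+1; rewrite expnS mulrnA.
have co : coprime (p ^ j) n by rewrite coprimeXl // prime_coprime.
have n_gt0 : (0 < n)%N by case: n pn {xn co} => //; rewrite dvdn0.
pose c := chinese (p ^ j) n 0 1.
have /dvdnP[s cE] : (p ^ j %| c)%N by rewrite /dvdn (chinese_modl co) mod0n.
have -> : x = x *+ p ^ j *+ s.
  rewrite -mulrnA mulnC -cE -[LHS]mulr1n; apply: eq_mulrn_mod xn _.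
  by rewrite (chinese_modr co).
exact: dim_val_Mn_le.
Qed.

Lemma dim_val_addK x y n : ~~ (p %| n)%N -> y *+ n = 0 ->
  dim_val (x + y) = dim_val x.
Proof.
move=> pn yn; apply/eqP; rewrite eqn_leq; apply/andP; split.
  by rewrite (leq_trans (dim_valD _ _)) // (dim_val_coprime pn yn) addn0.
rewrite -{1}(addrK y x) (leq_trans (dim_valD _ _)) //.
by rewrite (@dim_val_coprime (- y) n pn) ?addn0 // mulNrn yn oppr0.
Qed.

(** The part of [x] of order prime to p does not affect the valuation, and on the p-primary part
    multiplication by [m] is a Galois conjugation. *)
Lemma dim_val_mul_coprime x m : ~~ (p %| m)%N -> dim_val (x *+ m) = dim_val x.
Proof.
move=> pm; have [N DN] := dim_ex DS x.
have N0 := dim_gt0 DS DN; have xN := dim_det DS DN.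
have [N' coN' NE'] := pfactor_coprime p_pr N0.
move: (logn p N) NE' => e NE'.
have [q [NE co co_m q0]] : exists q, [/\ (q * N' = N)%N, coprime q N', coprime m q & (0 < q)%N].
  exists (p ^ e)%N; rewrite mulnC -NE' expn_gt0 prime_gt0 //.
  by rewrite coprimeXl // coprime_sym coprimeXl // prime_coprime.
have pN' : ~~ (p %| N')%N by rewrite -prime_coprime.
(* Multiplication by [c] is the projection onto the p-primary part. *)
pose c := chinese q N' 1 0.
have c1 : (c = 1 %[mod q])%N by apply: chinese_modl.
have cN' : (N' %| c)%N by rewrite /dvdn (chinese_modr co) mod0n.
pose xp := x *+ c; pose xq := x - xp.
have xpq : xp *+ q = 0.
  by rewrite -mulrnA; case/dvdnP: cN' => s ->; rewrite -mulnA (mulnC N') NE mulnC mulrnA xN mul0rn.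
have xqN : xq *+ N' = 0.
  rewrite mulrnBl -mulrnA; apply/eqP; rewrite subr_eq0; apply/eqP.
  apply: eq_mulrn_mod xN _.
  by rewrite -NE -{1}(mul1n N') -!muln_modl c1.
have xE : x = xp + xq by rewrite addrC subrK.
move: xp xq xpq xqN xE => xp xq xpq xqN ->.
have xqmN : xq *+ m *+ N' = 0 by rewrite mulrnAC xqN mul0rn.
rewrite mulrnDl (dim_val_addK _ pN' xqmN) (dim_val_addK _ pN' xqN).
have gal := dim_gal DS _ q0 co_m xpq.
have [n1 D1 v1] := dim_val_ex xp; have [n2 D2 v2] := dim_val_ex (xp *+ m).
apply/eqP; rewrite eqn_leq {2}v1 {1}v2 !(v1, v2); apply/andP; split.
  by rewrite -v2 dim_val_min //; apply/gal.
by rewrite -v1 dim_val_min //; apply/gal.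
Qed.

End DimValuation.

Section CyclicDim.
Variables (V : zmodType) (D : V -> nat -> Prop) (DS : dim_structure D).
Variables (x : V) (n : nat).
Hypotheses (n_gt0 : (0 < n)%N) (xn : x *+ n = 0).
Hypothesis x_order : forall j, x *+ j = 0 -> (n %| j)%N.

Section Prime.
Variable p : nat.
Hypothesis p_pr : prime p.

(** The order of p^e x is still divisible by p, so its valuation is positive by [dim_val_eq0], and
    symmetric powers lower it. *)
Lemma dim_val_exp_lt e : (e < logn p n)%N ->
  (dim_val DS p (x *+ p ^ e.+1) < dim_val DS p (x *+ p ^ e))%N.
Proof.
move=> lt_e; rewrite expnSr mulrnA dim_val_mulp // lt0n; apply/eqP.
move/(dim_val_eq0 p_pr) => [m pm]; rewrite -mulrnA => /x_order dvd_n.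
move: lt_e; rewrite ltnNge => /negP[].
have m0 : (0 < m)%N by case: m pm {dvd_n} => //; rewrite dvdn0.
have := dvdn_leq_log p _ dvd_n; rewrite muln_gt0 m0 expn_gt0 prime_gt0 // => /(_ isT).
by rewrite mulnC logn_Gauss ?prime_coprime // pfactorK.
Qed.

Lemma dim_val_exp_anti e e' : (e <= e')%N -> (e' <= logn p n)%N ->
  (dim_val DS p (x *+ p ^ e') <= dim_val DS p (x *+ p ^ e) ?= iff (e == e'))%N.
Proof.
move=> le_ee'; rewrite -(subnK le_ee'); move: (e' - e)%N => k {e' le_ee'}.
case: k => [|k]; first by rewrite add0n eqxx => _; split; rewrite ?eqxx.
have -> : (e == k.+1 + e)%N = false by rewrite -{1}(add0n e) eqn_add2r.
move=> lt_k.
suff lt : (dim_val DS p (x *+ p ^ (k.+1 + e)) < dim_val DS p (x *+ p ^ e))%N.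
  by split; [apply: ltnW | rewrite ltn_eqF].
elim: k lt_k => [|k IHk] lt_k; first by rewrite add1n dim_val_exp_lt.
by apply: ltn_trans (IHk (ltnW lt_k)); rewrite [(k.+2 + e)%N]addSn dim_val_exp_lt.
Qed.

Lemma dim_val_gcd j :
  dim_val DS p (x *+ j) = dim_val DS p (x *+ p ^ logn p (gcdn j n)).
Proof.
(* For j = 0 the index [n] stands for the same element and has the same gcd with [n]. *)
wlog j0 : j / (0 < j)%N.
  case: (posnP j) => [-> wl|j0 wl]; last exact: wl.
  by have := wl n n_gt0; rewrite xn mulr0n gcdnn gcd0n.
have [m co_m jE] := pfactor_coprime p_pr j0.
have -> : dim_val DS p (x *+ j) = dim_val DS p (x *+ p ^ logn p j).
  by rewrite {1}jE mulnC mulrnA (@dim_val_mul_coprime _ _ DS p p_pr _ m) // -prime_coprime.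
rewrite logn_gcd // /minn; case: ltnP => // le_f.
have [m' co_m' nE] := pfactor_coprime p_pr n_gt0.
have kill e : (logn p n <= e)%N -> dim_val DS p (x *+ p ^ e) = 0%N.
  move=> le_e; apply: (@dim_val_coprime _ _ DS p p_pr _ m').
    by rewrite -prime_coprime.
  by rewrite -mulrnA -(subnKC le_e) expnD -mulnA mulnC -mulnA -nE mulnC mulrnA xn mul0rn.
by rewrite !kill.
Qed.

Lemma dim_val_leE i j :
  (dim_val DS p (x *+ i) <= dim_val DS p (x *+ j))%N =
  (logn p (gcdn j n) <= logn p (gcdn i n))%N.
Proof.
rewrite (dim_val_gcd i) (dim_val_gcd j).
have le_n k : (logn p (gcdn k n) <= logn p n)%N by rewrite dvdn_leq_log ?dvdn_gcdr.
have [le_ji|lt_ij] := leqP (logn p (gcdn j n)) (logn p (gcdn i n)); first by have [] := dim_val_exp_anti le_ji (le_n i).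
have := dim_val_exp_anti (ltnW lt_ij) (le_n j).
by rewrite (ltn_eqF lt_ij) => -[le_d /negbT neq_d]; apply/negbTE; rewrite -ltnNge ltn_neqAle neq_d.
Qed.
End Prime.
End CyclicDim.

(** * Cyclic multipliers *)

Section CyclicPermutation.
Variables (V W : zmodType) (D : V -> nat -> Prop) (D' : W -> nat -> Prop).
Hypotheses (DS : dim_structure D) (DS' : dim_structure D').
Variables (x : V) (y : W) (n : nat).
Hypotheses (n_gt0 : (0 < n)%N) (xn : x *+ n = 0) (yn : y *+ n = 0).
Hypothesis x_order : forall j, x *+ j = 0 -> (n %| j)%N.
Hypothesis y_order : forall j, y *+ j = 0 -> (n %| j)%N.
Variable s : 'I_n -> 'I_n.
Hypothesis s_inj : injective s.
Hypothesis sD : forall (j : 'I_n) m, D (x *+ j) m <-> D' (y *+ s j) m.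

(** At each prime, [s] preserves the valuations, hence by [dim_val_leE] the order of the levels logn
    p (gcd(i, n)). The number of indices at least as high as [j] is therefore the same for [s j],
    and this number determines the level. *)
Lemma cyclic_perm_gcdn (j : 'I_n) : gcdn (s j) n = gcdn j n.
Proof.
apply: eqn_from_log; rewrite ?gcdn_gt0 ?n_gt0 ?orbT // => p.
have [p_pr|/negPf p_npr] := boolP (prime p); last by rewrite [LHS]lognE [RHS]lognE p_npr.
have valE (i : 'I_n) : dim_val DS p (x *+ i) = dim_val DS' p (y *+ s i).
  have [m Dm vm] := dim_val_ex DS p (x *+ i).
  have [k Dk vk] := dim_val_ex DS' p (y *+ s i).
  apply/eqP; rewrite eqn_leq; apply/andP; split.
    by rewrite vk; apply: dim_val_min; apply/sD.
  by rewrite vm; apply: dim_val_min; apply/sD.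
have leE (i k : 'I_n) : (logn p (gcdn k n) <= logn p (gcdn i n))%N =
    (logn p (gcdn (s k) n) <= logn p (gcdn (s i) n))%N.
  rewrite -(dim_val_leE DS n_gt0 xn x_order p_pr).
  by rewrite -(dim_val_leE DS' n_gt0 yn y_order p_pr) !valE.
pose lev e := [set i : 'I_n | (e <= logn p (gcdn i n))%N].
have cardlev : #|lev (logn p (gcdn j n))| = #|lev (logn p (gcdn (s j) n))|.
  rewrite -(card_imset _ s_inj); apply: eq_card => i.
  have [si sK siK] := injF_bij s_inj.
  by rewrite -(siK i) mem_imset // !inE leE.
have le_n (k : nat) : (logn p (gcdn k n) <= logn p n)%N.
  by rewrite dvdn_leq_log ?dvdn_gcdr.
have strict e e' : (e < e')%N -> (e' <= logn p n)%N -> (#|lev e'| < #|lev e|)%N.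
  move=> lt_e le_e'; apply: proper_card; apply/properP; split.
    by apply/subsetP => i; rewrite !inE; apply: leq_trans; apply: ltnW.
  have lt_en := leq_trans lt_e le_e'.
  have p1 := prime_gt1 p_pr.
  have pen : (p ^ e < n)%N.
    by rewrite (leq_trans _ (dvdn_leq n_gt0 (pfactor_dvdnn p n))) // ltn_exp2l.
  have dvd_pe : (p ^ e %| n)%N by rewrite pfactor_dvdn // ltnW.
  (* The index p^e has level exactly [e], so the inclusion of level sets is strict. *)
  by exists (Ordinal pen); rewrite !inE /= (gcdn_idPl dvd_pe) pfactorK // -ltnNge.
by case: (ltngtP (logn p (gcdn (s j) n)) (logn p (gcdn j n))) => // lt;
  have := strict _ _ lt (le_n _); rewrite cardlev ltnn.
Qed.

(** With g the common gcd, [j %/ g] and [s j %/ g] are units modulo [n %/ g], and [k] is their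
    quotient. *)
Lemma cyclic_perm_mult (j : 'I_n) :
  exists2 k, coprime k (n %/ gcdn j n) & y *+ s j = y *+ j *+ k.
Proof.
have g0 : (0 < gcdn j n)%N by rewrite gcdn_gt0 n_gt0 orbT.
have eg := cyclic_perm_gcdn j; move: g0 eg; set g := gcdn j n => g0 eg.
pose m := (n %/ g)%N.
have nE : (m * g)%N = n by rewrite divnK // dvdn_gcdr.
have jE : (j %/ g * g)%N = j by rewrite divnK // dvdn_gcdl.
have sjE : (s j %/ g * g)%N = s j by rewrite divnK // -eg dvdn_gcdl.
have co1 : coprime (j %/ g) m.
  by rewrite /coprime -(eqn_pmul2r g0) muln_gcdl jE nE mul1n.
have co2 : coprime (s j %/ g) m.
  by rewrite /coprime -(eqn_pmul2r g0) muln_gcdl sjE nE mul1n eg.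
pose c := chinese (j %/ g) m 0 1.
have /dvdnP[u cE] : (j %/ g %| c)%N by rewrite /dvdn (chinese_modl co1) mod0n.
have c1 : (c = 1 %[mod m])%N by apply: chinese_modr.
have co_u : coprime u m.
  have : coprime c m by rewrite -coprime_modl c1 coprime_modl coprime1n.
  by rewrite cE coprimeMl => /andP[].
exists (u * (s j %/ g))%N; first by rewrite coprimeMl co_u.
rewrite -mulrnA; apply: eq_mulrn_mod yn _.
have modE w : (w * g = c * w * g %[mod m * g])%N.
  by rewrite -!muln_modl -modnMml c1 modnMml mul1n.
have := modE (s j %/ g)%N; rewrite nE sjE => ->.
by rewrite -jE cE -!mulnA mulnCA (mulnC g) -!mulnA.
Qed.
End CyclicPermutation.

Section ClassDimension.
Variables (F : numClosedFieldType) (G : finGroupType).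
Local Notation M := (H2 (units F) G).

Definition class_dim (x : M) n := exists2 a, x = class2 a & proj_dim a n.

Lemma class_dimE a n : class_dim (class2 a) n <-> proj_dim a n.
Proof.
split=> [[b ab bn]|an]; last by exists a.
by apply: proj_dim_alg_iso bn; apply: class2_alg_iso.
Qed.

Lemma class_dim_structure : dim_structure class_dim.
Proof.
split.
- by move=> x n [a _ []].
- by move=> x; have [a ->] := class2_surj x; exists #|G|, a; last exact: proj_dim_regular.
- by exists 0; [rewrite raddf0 | apply: proj_dim0].
- move=> x y m n [a -> am] [b -> bn]; exists (a + b); first by rewrite raddfD.
  exact: proj_dimD.
- move=> p x [|n] p_pr pn [a -> [n0 [X repX]]] //.
  exists 'C(p + n, p); last exact: logn_bin.
  by exists (a *+ p); [rewrite raddfMn | apply: proj_dim_sym repX].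
- by move=> x n [a -> an]; apply: proj_dim_det.
move=> x n k m n0 co_k xn; have [a ax] := class2_surj x.
rewrite {}ax in xn *; rewrite -raddfMn !class_dimE.
have iso : alg_iso (twisted_alg a) (twisted_alg (a *+ k)).
  by apply: Galois_alg_iso n0 co_k xn _; rewrite raddfMn.
by split; apply: proj_dim_alg_iso => //; apply: alg_iso_sym.
Qed.

Lemma class2_order : exists2 n, (0 < n)%N & forall x : M, x *+ n = 0.
Proof.
exists #|G| => [|x]; first by rewrite -cardsT cardG_gt0.
by have [a ->] := class2_surj x; rewrite class2_card.
Qed.
End ClassDimension.

Section Preservation.
Variables (F : numClosedFieldType) (G H : finGroupType).
Variable phi : H2 (units F) G -> H2 (units F) H.
Hypothesis phiP : preserves_twisted_algs phi.

Lemma preserves_class_dim x n : class_dim x n <-> class_dim (phi x) n.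
Proof.
have [a ->] := class2_surj x; have [b bE] := class2_surj (phi (class2 a)).
rewrite bE !class_dimE; have iso := phiP bE.
by split; apply: proj_dim_alg_iso => //; apply: alg_iso_sym.
Qed.

(** Only the zero class has a projective representation of dimension 1. *)
Lemma preserves_zero : phi 0 = 0.
Proof.
have : class_dim (phi 0) 1.
  by apply/preserves_class_dim; apply: dim_zero (class_dim_structure F G).
by move/(dim_det (class_dim_structure F H)).
Qed.
End Preservation.

Section CyclicMultiplier.
Variables (F : numClosedFieldType) (G H : finGroupType).
Local Notation MG := (H2 (units F) G).
Local Notation MH := (H2 (units F) H).
Variables (f : {additive MG -> MH}) (phi : MG -> MH).
Hypotheses (bij_f : bijective f) (bij_phi : bijective phi).
Hypothesis phiP : preserves_twisted_algs phi.

(** On each class [f] and [phi] differ by a multiplier prime to the order of the image, so their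
    values define isomorphic algebras. *)
Lemma cyclic_preserves : zmod_cyclic MG -> preserves_twisted_algs f.
Proof.
move=> [x xgen]; have [N N0 MN] := class2_order F G.
have exn : exists n, (0 < n)%N && (x *+ n == 0) by exists N; rewrite N0 MN eqxx.
have [n /andP[n0 /eqP xn] n_min] := ex_minnP exn.
have x_order j : x *+ j = 0 -> (n %| j)%N.
  move=> xj; rewrite /dvdn; apply: contraTT isT; rewrite -lt0n => jn.
  have := n_min (j %% n)%N; rewrite jn (eq_mulrn_mod (k := j) xn) ?modn_mod //.
  by rewrite xj eqxx leqNgt ltn_mod n0 => /(_ isT).
have inj_f := bij_inj bij_f; pose y := f x.
have yMn j : y *+ j = f (x *+ j) by rewrite raddfMn.
have yn : y *+ n = 0 by rewrite yMn xn raddf0.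
have y_order j : y *+ j = 0 -> (n %| j)%N.
  by rewrite yMn -[0](raddf0 f) => /inj_f/x_order.
have xall (z : MG) : exists j : 'I_n, z = x *+ j.
  have [k ->] := xgen z.
  have [j ->] : exists j : nat, x *~ k = x *+ j.
    case: k => k; first by exists k.
    (* A negative multiple is made natural by adding a multiple of [n]. *)
    exists (n * k.+1 - k.+1)%N; rewrite NegzE mulrNz pmulrn.
    apply: (addIr (x *+ k.+1)); rewrite addNr -mulrnDr subnK ?leq_pmull //.
    by rewrite mulrnA xn mul0rn.
  exists (Ordinal (ltn_pmod j n0)) => /=.
  by apply: eq_mulrn_mod xn _; rewrite modn_mod.
have yall (w : MH) : exists j : 'I_n, w = y *+ j.
  have [g _ fg] := bij_f; have [j gw] := xall (g w).
  by exists j; rewrite yMn -gw fg.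
have [s sE] := choice (fun j : 'I_n => yall (phi (x *+ j))).
have s_inj : injective s.
  move=> i j sij; have /(bij_inj bij_phi) : phi (x *+ i) = phi (x *+ j) by rewrite !sE sij.
  wlog le_ij : i j {sij} / (i <= j)%N.
    by move=> wl; case/orP: (leq_total i j) => le xij; [|symmetry]; apply: wl.
  move=> xij; have : x *+ (j - i) = 0.
    by apply: (addIr (x *+ i)); rewrite -mulrnDr subnK // add0r.
  move/x_order; case: (posnP (j - i)%N) => [/eqP|ji0 /(dvdn_leq ji0)].
    by rewrite subn_eq0 => le_ji _; apply/val_inj/eqP; rewrite eqn_leq le_ij.
  by rewrite leqNgt (leq_ltn_trans (leq_subr _ _)).
have sD (j : 'I_n) m : class_dim (x *+ j) m <-> class_dim (y *+ s j) m.
  by rewrite -sE; apply: preserves_class_dim.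
have mult := cyclic_perm_mult (class_dim_structure F G) (class_dim_structure F H)
  n0 xn yn x_order y_order s_inj sD.
move=> a b; have [j aj] := xall (class2 a); rewrite aj -yMn => bj.
have [k co_k sj] := mult j.
have [b' b'E] := class2_surj (phi (class2 a)).
have iso_ab' := phiP b'E; apply: alg_iso_trans iso_ab' (alg_iso_sym _).
have g0 : (0 < gcdn j n)%N by rewrite gcdn_gt0 n0 orbT.
apply: (@Galois_alg_iso F H b b' (n %/ gcdn j n) k) => //.
- by rewrite divn_gt0 // dvdn_leq // dvdn_gcdr.
- rewrite -bj -mulrnA muln_divCA_gcd.
  by rewrite mulrnA yn mul0rn.
by rewrite -bj -sj -sE -aj.
Qed.
End CyclicMultiplier.

(** * Elementary abelian multipliers of order 4 and 9 *)

Section KleinMultiplier.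
Variables (F : numClosedFieldType) (G H : finGroupType).
Local Notation MG := (H2 (units F) G).
Local Notation MH := (H2 (units F) H).
Local Notation K := ('Z_2 * 'Z_2)%type.

Lemma klein_third (u v w : K) :
  u != 0 -> v != 0 -> u != v -> w != 0 -> w != u -> w != v -> w = u + v.
Proof.
have K_all (x : K) : x \in ([:: (0, 0); (0, 1); (1, 0); (1, 1)] : seq K).
  by case: x => [[[|[|x]] xP] [[|[|y]] yP]].
pose L : seq K := [:: (0, 0); (0, 1); (1, 0); (1, 1)].
have test : all (fun u : K => all (fun v : K => all (fun w : K =>
  [&& u != 0, v != 0, u != v, w != 0, w != u & w != v] ==> (w == u + v)) L) L) L.
  by [].
move=> u0 v0 uv w0 wu wv; apply/eqP.
have /allP/(_ u (K_all u))/allP/(_ v (K_all v))/allP/(_ w (K_all w)) := test.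
by rewrite u0 v0 uv w0 wu wv.
Qed.

Lemma klein_double (u : K) : u + u = 0.
Proof. by apply/eqP; case: u => [[[|[|x]] xP] [[|[|y]] yP]]. Qed.

Lemma klein_preserves (phi : MG -> MH) :
  zmod_iso MG K -> zmod_iso MH K -> bijective phi ->
  preserves_twisted_algs phi -> twisted_equiv F G H.
Proof.
move=> [f bij_f] [g bij_g] bij_phi phiP.
have phi0 := preserves_zero phiP.
have inj_phi := bij_inj bij_phi; have inj_f := bij_inj bij_f.
have inj_g := bij_inj bij_g.
have dblG x : x + x = 0 :> MG.
  by apply: inj_f; rewrite raddfD raddf0 klein_double.
have dblH x : x + x = 0 :> MH.
  by apply: inj_g; rewrite raddfD raddf0 klein_double.
have phiD x y : phi (x + y) = phi x + phi y.
  have [->|x0] := eqVneq x 0; first by rewrite phi0 !add0r.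
  have [->|y0] := eqVneq y 0; first by rewrite phi0 !addr0.
  have [<-|xy] := eqVneq x y; first by rewrite dblG dblH.
  have nz z : z != 0 -> g (phi z) != 0.
    apply: contra_neq => gz; apply: inj_phi; apply: inj_g.
    by rewrite gz phi0 raddf0.
  have xy0 : x + y != 0.
    by apply: contra_neq xy => e; apply: (addrI x); rewrite dblG e.
  have xyx : x + y != x by apply: contra_neq y0 => e; apply: (addrI x); rewrite e addr0.
  have xyy : x + y != y by apply: contra_neq x0 => e; apply: (addIr y); rewrite e add0r.
  apply: (inj_g); rewrite raddfD; apply: klein_third; try exact: nz;
    by rewrite (inj_eq inj_g) (inj_eq inj_phi).
have phiZ : zmod_morphism phi.
  by move=> x y; apply/eqP; rewrite eq_sym subr_eq -phiD subrK.
pose p1 := GRing.isZmodMorphism.Build MG MH phi phiZ.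
pose ff : {additive MG -> MH} := HB.pack phi p1.
by exists ff.
Qed.
End KleinMultiplier.

Section NineMultiplier.
Local Notation T := ('Z_3 * 'Z_3)%type.
Let pts : seq T := [:: (1, 0); (0, 1); (1, 1); (1, -1)].
Let all9 : seq T := 0 :: pts ++ map -%R pts.

Lemma all9E (v : T) : v \in all9.
Proof. by case: v => [[[|[|[|x]]] xP] [[|[|[|y]]] yP]]. Qed.

(** The columns [m.1] and [m.2] are the images of the two basis vectors. *)
Definition lin9 (m : T * T) (v : T) : T :=
  (m.1.1 * v.1 + m.2.1 * v.2, m.1.2 * v.1 + m.2.2 * v.2).

Lemma lin9_zmod_morphism m : zmod_morphism (lin9 m).
Proof.
move: m => [[a b] [c d]] [u1 u2] [v1 v2].
transitivity (a * (u1 - v1) + c * (u2 - v2), b * (u1 - v1) + d * (u2 - v2)) => //.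
transitivity (a * u1 + c * u2 - (a * v1 + c * v2), b * u1 + d * u2 - (b * v1 + d * v2)) => //.
by congr (_, _); rewrite !mulrBr opprD addrACA.
Qed.

(* Every permutation of the four lines of F_3^2 is induced by a linear map.   *)
Lemma lin9_lines : all (fun s => has (fun c1 => has (fun c2 =>
    all (fun i => (lin9 (c1, c2) (nth 0 pts i) == nth 0 pts (nth 0%N s i)) ||
                  (lin9 (c1, c2) (nth 0 pts i) == - nth 0 pts (nth 0%N s i)))
      (iota 0 4) &&
    all (fun v => (lin9 (c1, c2) v == 0) ==> (v == 0)) all9) all9) all9)
  (permutations (iota 0 4)).
Proof. by vm_compute. Qed.

(** Both functions are even and agree at 0, so their values on the four lines form the same
    multiset. The resulting permutation of the lines comes from a linear map by [lin9_lines]. *)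
Lemma nine_linearize (K : Type) (t t' : T -> K) (s : T -> T) :
  bijective s -> (forall v, t v = t' (s v)) -> s 0 = 0 ->
  (forall v, t (- v) = t v) -> (forall v, t' (- v) = t' v) ->
  exists2 f : {additive T -> T}, bijective f & forall v, t v = t' (f v).
Proof.
move=> bij_s ts s0 tN t'N.
(* [perm_eq] requires decidable equality, which [K] need not have, so a value of [t'] is coded by a
   chosen preimage. *)
pose tag (k : K) : option T := [pick w | `[< t' w = k >]].
have tagP v u : tag (t v) = tag (t' u) -> t v = t' u.
  rewrite /tag; case: pickP => [w /asboolP <-|/(_ (s v))]; last first.
    by rewrite ts asboolT.
  case: pickP => [w' /asboolP <- [->]//|_]; by [].
have cnt : perm_eq [seq tag (t v) | v <- pts] [seq tag (t' v) | v <- pts].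
  have p9 : perm_eq [seq tag (t v) | v <- all9] [seq tag (t' v) | v <- all9].
    have es : perm_eq (map s all9) all9.
      apply: uniq_perm => [||v]; rewrite // ?map_inj_uniq //; first exact: bij_inj.
      have [s' sK s'K] := bij_s.
      by rewrite all9E -(s'K v) map_f ?all9E.
    rewrite (eq_map (fun v => congr1 tag (ts v))) (map_comp (tag \o t') s).
    exact: perm_map es.
  have all9_map (r : T -> K) : (forall v, r (- v) = r v) ->
      [seq tag (r v) | v <- all9] =
      tag (r 0) :: [seq tag (r v) | v <- pts] ++ [seq tag (r v) | v <- pts].
    move=> rN; rewrite map_cons map_cat -map_comp; congr (_ :: _ ++ _).
    by apply: eq_map => v; rewrite /= rN.
  move: p9; rewrite !all9_map // ts s0 perm_cons => /seq.permP p9.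
  (* Every line is counted twice, through v and -v. *)
  apply/seq.permP => P; apply: double_inj; rewrite -!addnn.
  by have := p9 P; rewrite !count_cat.
have [Is permIs eIs] := perm_iotaP None cnt.
have /allP/(_ Is) := lin9_lines.
rewrite mem_permutations perm_sym; rewrite perm_sym in permIs.
move/(_ permIs)/hasP => [c1 _] /hasP[c2 _] /andP[/allP lines /allP ker0].
pose h := lin9 (c1, c2).
pose h1 := GRing.isZmodMorphism.Build T T h (lin9_zmod_morphism (c1, c2)).
pose ff : {additive T -> T} := HB.pack h h1.
have inj_h : injective ff.
  move=> u v /eqP; rewrite -subr_eq0 -raddfB => uv.
  apply/eqP; rewrite -subr_eq0; exact: (implyP (ker0 _ (all9E _))).
exists ff; first by apply: injF_bij.
have tpts i : (i < 4)%N -> t (nth 0 pts i) = t' (ff (nth 0 pts i)).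
  move=> i4; have sizeIs : size Is = 4 by rewrite -(perm_size permIs) size_iota.
  have : tag (t (nth 0 pts i)) = tag (t' (nth 0 pts (nth 0%N Is i))).
    have := congr1 (fun r => nth None r i) eIs.
    rewrite (nth_map 0) // (nth_map 0%N) ?sizeIs // => ->.
    rewrite (nth_map 0) //; have : nth 0%N Is i \in iota 0 4.
      by rewrite (perm_mem permIs) mem_nth ?sizeIs.
    by rewrite mem_iota.
  move/tagP ->; have := lines i; rewrite mem_iota => /(_ i4).
  by case/orP => /eqP e; rewrite [ff _]e ?t'N.
move=> v; have := all9E v; rewrite inE => /orP[/eqP->|].
  by rewrite raddf0 ts s0.
rewrite -[_ \in _]/(v \in pts ++ map -%R pts) mem_cat => /orP[|/mapP[w]] /(nthP 0)[i i4].
  by move=> <-; apply: tpts.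
by move=> <- ->; rewrite raddfN tN t'N; apply: tpts.
Qed.

End NineMultiplier.

Lemma zmod_iso_inv (U V : zmodType) (f : {additive U -> V}) :
  bijective f -> exists2 g : {additive V -> U}, cancel f g & cancel g f.
Proof.
move=> [g fK gK]; have gZ : zmod_morphism g.
  by move=> x y; apply: (can_inj fK); rewrite gK raddfB /= !gK.
pose g1 := GRing.isZmodMorphism.Build V U g gZ.
pose gg : {additive V -> U} := HB.pack g g1.
by exists gg.
Qed.

Lemma zmod_iso_sym (U V : zmodType) : zmod_iso U V -> zmod_iso V U.
Proof.
move=> [f /zmod_iso_inv[g fK gK]]; exists g; exact: Bijective gK fK.
Qed.

Lemma zmod_iso_trans (U V W : zmodType) :
  zmod_iso U V -> zmod_iso V W -> zmod_iso U W.
Proof.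
move=> [f bij_f] [g bij_g]; exists (g \o f : {additive U -> W}).
exact: bij_comp.
Qed.

Section SmallMultipliers.
Variables (F : numClosedFieldType) (G H : finGroupType).
Local Notation MG := (H2 (units F) G).
Local Notation MH := (H2 (units F) H).

Definition class_spectrum (K : finGroupType) (x : H2 (units F) K) : nat -> F :=
  spectrum (repr x).

Lemma class_spectrumE (K : finGroupType) (a : cocycle (units F) K) :
  class_spectrum (class2 a) = spectrum a.
Proof.
apply/funext; apply/alg_isoP; apply: class2_alg_iso.
by rewrite [LHS]reprK.
Qed.

(** Here -x = 2x is a Galois conjugate of x. *)
Lemma class_spectrumN (K : finGroupType) (x : H2 (units F) K) :
  x *+ 3 = 0 -> class_spectrum (- x) = class_spectrum x.
Proof.
move=> x3; have [a ax] := class2_surj x; rewrite ax -raddfN !class_spectrumE.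
apply/esym/funext/alg_isoP; apply: (@Galois_alg_iso _ _ _ _ 3 2) => //.
  by rewrite -ax.
by rewrite raddfN; apply: (addIr (class2 a)); rewrite addNr -mulrSr -ax x3.
Qed.

Lemma nine_preserves (phi : MG -> MH) :
  zmod_iso MG ('Z_3 * 'Z_3)%type -> zmod_iso MH ('Z_3 * 'Z_3)%type ->
  bijective phi -> preserves_twisted_algs phi -> twisted_equiv F G H.
Proof.
move=> [f bij_f] [g bij_g] bij_phi phiP.
have [f' fK f'K] := zmod_iso_inv bij_f; have [g' gK g'K] := zmod_iso_inv bij_g.
have T3 (v : 'Z_3 * 'Z_3) : v *+ 3 = 0.
  by apply/eqP; case: v => [[[|[|[|x]]] xP] [[|[|[|y]]] yP]].
pose t v := class_spectrum (f' v); pose t' v := class_spectrum (g' v).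
have [||||| h bij_h tE] := @nine_linearize (nat -> F) t t' (g \o phi \o f').
- by apply: bij_comp; [apply: bij_comp | exists f].
- move=> v; rewrite /t /t' /= gK; have [a ->] := class2_surj (f' v).
  have [b bE] := class2_surj (phi (class2 a)).
  rewrite bE !class_spectrumE; apply/funext/alg_isoP; exact: phiP.
- by rewrite /= raddf0 (preserves_zero phiP) raddf0.
- by move=> v; rewrite /t raddfN class_spectrumN // -raddfMn T3 raddf0.
- by move=> v; rewrite /t' raddfN class_spectrumN // -raddfMn T3 raddf0.
exists (g' \o h \o f : {additive MG -> MH}); split.
  by apply: bij_comp => //; apply: bij_comp => //; exists g.
move=> a b /= ab; apply/alg_isoP => k.
rewrite -!class_spectrumE -ab; congr (_ k).
by have := tE (f (class2 a)); rewrite /t /t' fK.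
Qed.

Theorem small_multiplier_equiv :
  zmod_iso MG MH -> bijectivity_condition F G H ->
  [\/ zmod_cyclic MG, zmod_iso MG ('Z_2 * 'Z_2)%type
    | zmod_iso MG ('Z_3 * 'Z_3)%type] ->
  twisted_equiv F G H.
Proof.
move=> isoM [phi [bij_phi phiP]] [cyc|K4|K9].
- have [f bij_f] := isoM; exists f; split=> //.
  exact: cyclic_preserves bij_f bij_phi phiP cyc.
- apply: klein_preserves (K4) _ bij_phi phiP.
  exact: zmod_iso_trans (zmod_iso_sym isoM) K4.
- apply: nine_preserves (K9) _ bij_phi phiP.
  exact: zmod_iso_trans (zmod_iso_sym isoM) K9.
Qed.
End SmallMultipliers.

(** * Detecting trivial classes *)

Section Pullback.
Variables (A : zmodType) (G K : finGroupType) (f : K -> G).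
Hypothesis fM : {morph f : x y / (x * y)%g}.

Fact cocycle_pull_subproof (a : cocycle A G) :
  [ffun p => a (f p.1, f p.2)] \in Z2 (A := A) (G := K).
Proof. by apply/Z2P => g h k; rewrite !ffunE /= !fM cocycleE. Qed.

Definition cocycle_pull (a : cocycle A G) : cocycle A K :=
  Cocycle (cocycle_pull_subproof a).

Lemma cocycle_pullE a g h : cocycle_pull a (g, h) = a (f g, f h).
Proof. by rewrite ffunE. Qed.

Lemma cocycle_pull_class a b :
  class2 a = class2 b -> class2 (cocycle_pull a) = class2 (cocycle_pull b).
Proof.
move=> /class2_eq[s sP]; apply/class2_eq; exists (s \o f) => g h.
by rewrite !cocycle_pullE sP /= fM.
Qed.

Fact cocycle_pull_zmod_morphism : zmod_morphism cocycle_pull.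
Proof. by move=> a b; apply: val_inj; apply/ffunP => p; rewrite !ffunE. Qed.
HB.instance Definition _ :=
  GRing.isZmodMorphism.Build (cocycle A G) (cocycle A K) cocycle_pull
    cocycle_pull_zmod_morphism.
End Pullback.

Section CommutatorPairing.
Variables (A : zmodType) (G : finGroupType).
Implicit Types (a b : cocycle A G) (g h z : G).

(** For commuting [g] and [h] this is the scalar u_g u_h u_g^-1 u_h^-1, which depends only on the
    class. *)
Definition comm_pair a g h := a (g, h) - a (h, g).

Lemma comm_pair_class a b g h : commute g h ->
  class2 a = class2 b -> comm_pair a g h = comm_pair b g h.
Proof.
move=> gh /class2_eq[s sP]; rewrite /comm_pair !sP gh (addrC (s g) (s h)).
by rewrite opprD addrACA subrr addr0.
Qed.

Lemma comm_pairD a b g h : comm_pair (a + b) g h = comm_pair a g h + comm_pair b g h.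
Proof. by rewrite /comm_pair !ffunE opprD addrACA. Qed.

Lemma comm_pairC a g h : comm_pair a h g = - comm_pair a g h.
Proof. by rewrite opprB. Qed.

Lemma comm_pair1 a g : comm_pair a g 1%g = 0.
Proof. by rewrite /comm_pair cocycle1l cocycle1r subrr. Qed.

Lemma comm_pairM a z g h : commute z g -> commute z h ->
  comm_pair a z (g * h)%g = comm_pair a z g + comm_pair a z h.
Proof.
move=> zg zh; have := cocycleE a z g h; have := cocycleE a g z h.
have := cocycleE a g h z; rewrite -zg -zh /comm_pair => e3 e2 e1.
have -> : a (z, (g * h)%g) = a (z, g) + a ((z * g)%g, h) - a (g, h).
  by rewrite e1 addrC addKr.
have -> : a ((g * h)%g, z) = a (h, z) + a (g, (z * h)%g) - a (g, h).
  by rewrite -e3 addrC addKr.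
have -> : a (g, (z * h)%g) = a (g, z) + a ((z * g)%g, h) - a (z, h).
  by rewrite e2 addrC addKr.
move: (a (z, g)) (a ((z * g)%g, h)) (a (g, h)) (a (h, z)) (a (g, z)) (a (z, h)).
move=> p u q r v w; rewrite [- (_ - q)]opprB addrA subrK.
have -> : r + (v + u - w) = u + (r + (v - w)).
  by rewrite (addrC v u) -[u + v - w]addrA [LHS]addrCA.
rewrite addrKA opprD opprB.
have -> : - r + (w - v) = - v + (w - r) by rewrite addrC addrAC addrC.
by rewrite addrA.
Qed.

Lemma comm_pairX a z g n : commute z g ->
  comm_pair a z (g ^+ n)%g = comm_pair a z g *+ n.
Proof.
move=> zg; elim: n => [|n IHn]; first by rewrite expg0 comm_pair1.
by rewrite expgS comm_pairM ?IHn ?mulrS //; apply: commuteX.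
Qed.
End CommutatorPairing.

Section Monomial.
Variables (F : fieldType) (G : finGroupType) (a : cocycle (units F) G).
Variables (I : finType) (act : G -> I -> I) (m : G -> I -> units F).
Hypotheses (I_gt0 : (0 < #|I|)%N) (act1 : forall i, act 1%g i = i).
Hypothesis actM : forall g h i, act (g * h)%g i = act g (act h i).
Hypothesis m1 : forall i, m 1%g i = a (1%g, 1%g).
Hypothesis mM : forall g h i,
  m g (act h i) + m h i = a (g, h) + m (g * h)%g i.

Lemma monomial_proj_dim : proj_dim a #|I|.
Proof.
apply: (@proj_dim_fin _ _ _ _ (fun g i k => uval (m g k) * (i == act g k)%:R)).
- by [].
- by move=> i j; rewrite m1 act1.
move=> g h i k; rewrite (bigD1 (act h k)) //= eqxx mulr1 big1 ?addr0.
  by rewrite actM mulrAC mulrA -!uvalD mM.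
by move=> j jk; rewrite (negPf jk) !mulr0.
Qed.
End Monomial.

(* If a becomes trivial on K, inducing a one-dimensional projective           *)
(* representation of K gives one of G of dimension the index of K, whose      *)
(* determinant kills this multiple of a.                                      *)
Lemma induced_kill (F : fieldType) (G K : finGroupType) (f : K -> G)
    (fM : {morph f : x y / (x * y)%g}) (a : cocycle (units F) G)
    (I : finType) (r : I -> G) (act : G -> I -> I) (k : G -> I -> K) :
  (0 < #|I|)%N ->
  (forall i, act 1%g i = i) -> (forall i, k 1%g i = 1%g) ->
  (forall g h i, act (g * h)%g i = act g (act h i)) ->
  (forall g h i, k (g * h)%g i = (k g (act h i) * k h i)%g) ->
  (forall g i, (g * r i = r (act g i) * f (k g i))%g) ->
  class2 (cocycle_pull fM a) = 0 -> class2 a *+ #|I| = 0.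
Proof.
move=> I0 act1 k1 actM kM rE.
rewrite -(raddf0 (@class2 (units F) K)) => /class2_eq[s sP].
have {}sP x y : a (f x, f y) = s x + s y - s (x * y)%g.
  by have := sP x y; rewrite cocycle_pullE ffunE add0r.
apply: proj_dim_det.
(* The multiplier comes from u_g u_(r i) = a(g, r i) u_(r' f k) and u_(r' f k) = a(r', f k)^-1 u_r'
   u_(f k), with r' = r (act g i) and k = k g i; on the induced vector u_(f k) acts by [s]. *)
apply: (@monomial_proj_dim _ _ _ _ act
  (fun g i => a (g, r i) - a (r (act g i), f (k g i)) + s (k g i))) => //.
  move=> i; rewrite act1 k1 cocycle1l.
  have f1 : f 1%g = 1%g by apply: (mulgI (f 1%g)); rewrite -fM !mulg1.
  have := sP 1%g 1%g; rewrite f1 mulg1 addrK => <-.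
  by rewrite (cocycle1r a (r i)) subrK.
move=> g h i; rewrite actM kM.
set r' := r (act h i); set r'' := r (act g (act h i)).
set x := k g (act h i); set y := k h i.
have e1 : a (g, h) + a ((g * h)%g, r i) = a (h, r i) + a (g, (r' * f y)%g).
  by rewrite cocycleE rE.
have e2 : a (g, (r' * f y)%g) = a (g, r') + a ((r'' * f x)%g, f y) - a (r', f y).
  have := cocycleE a g r' (f y); rewrite rE -/x -/r'' => ->.
  by rewrite addrC addKr.
have e3 : a ((r'' * f x)%g, f y) =
    a (f x, f y) + a (r'', f (x * y)%g) - a (r'', f x).
  have := cocycleE a r'' (f x) (f y); rewrite -fM => <-.
  by rewrite addrC addKr.
rewrite [RHS]addrA [a (g, h) + _]addrA e1 e2 e3 sP.
move: (a (h, r i)) (a (g, r')) (a (r'', f (x * y)%g)) (a (r'', f x)).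
move: (a (r', f y)) (s x) (s y) (s (x * y)%g).
move=> A B C D E1 G1 H1 J1. rewrite !addrA [in RHS](addrAC _ (- A) (- H1)) [in RHS](addrAC _ (- J1) (- H1)).
rewrite addrK [in RHS](addrAC _ (- A) D) [in RHS](addrAC _ (- J1) D) subrK.
by rewrite [LHS](ACl (4*1*3*6*2*5)).
Qed.

Section TrivialClass.
Variables (F : fieldType) (G : finGroupType) (a : cocycle (units F) G).

Definition monomial (x : twisted_alg a) g :=
  exists l : units F, x = uval l *: tw_basis a g.

Lemma monomialM x y g h :
  monomial x g -> monomial y h -> monomial (x * y) (g * h)%g.
Proof.
move=> [l ->] [m ->]; exists (l + m + a (g, h)).
by rewrite -scalerAl -scalerAr tw_basisM !scalerA !uvalD.
Qed.

Lemma monomial1 : monomial 1 1%g.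
Proof. by exists (- a (1%g, 1%g)). Qed.

Lemma monomialX x g n : monomial x g -> monomial (x ^+ n) (g ^+ n)%g.
Proof.
move=> xg; elim: n => [|n IHn]; first exact: monomial1.
by rewrite exprS expgS; apply: monomialM.
Qed.

Lemma monomialZ (l : units F) x g : monomial x g -> monomial (uval l *: x) g.
Proof. by move=> [m ->]; exists (l + m); rewrite scalerA uvalD. Qed.

Lemma class2_eq0_lift (U : G -> twisted_alg a) :
  (forall g, monomial (U g) g) -> {morph U : g h / (g * h)%g >-> g * h} ->
  class2 a = 0.
Proof.
move=> /choice[s sP] UM; rewrite -(raddf0 (@class2 _ G)); apply/class2_eq.
exists (fun g => - s g) => g h; have := UM g h; rewrite !sP.
rewrite -scalerAl -scalerAr tw_basisM !scalerA => /ffunP/(_ (g * h)%g).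
rewrite !ffunE eqxx /GRing.scale /= !mulr1 -!uvalD => e.
have -> : s (g * h)%g = s g + s h + a (g, h) by apply: uval_inj.
by rewrite add0r opprK -opprD addKr.
Qed.
End TrivialClass.

Section Normalization.
Variables (F : numClosedFieldType) (G : finGroupType) (a : cocycle (units F) G).

Lemma units_root (l : units F) n : (0 < n)%N -> exists m : units F, m *+ n = l.
Proof.
move=> n0; have r0 : n.-root (uval l) != 0 by rewrite rootC_eq0 // uvalP.
by exists (Units r0); apply: uval_inj; rewrite uvalMn rootCK.
Qed.

(** Over a closed field u_g can be rescaled so that a prescribed relation on g^n lifts exactly. *)
Lemma monomial_root x g n : (0 < n)%N -> monomial (a := a) x (g ^+ n)%g ->
  exists2 y, monomial y g & y ^+ n = x.
Proof.
move=> n0 [l ->]; have ug : monomial (tw_basis a g) g.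
  by exists 0; rewrite uval0 scale1r.
have [m mE] := monomialX n ug; have [t tE] := units_root (l - m) n0.
exists (uval t *: tw_basis a g); first exact: monomialZ.
by rewrite exprZn mE scalerA -uvalMn tE -uvalD subrK.
Qed.

Lemma monomial_comm x y g h : commute g h -> comm_pair a g h = 0 ->
  monomial (a := a) x g -> monomial y h -> x * y = y * x.
Proof.
move=> gh /eqP; rewrite subr_eq0 => /eqP e [l ->] [m ->].
rewrite -!scalerAl -!scalerAr !scalerA !tw_basisM !scalerA gh e.
by rewrite (mulrC (uval l)).
Qed.
End Normalization.

(** Conjugation by u_d is an algebra automorphism that sends each u_x to a scalar multiple of the
    basis element of the conjugate, so commutator scalars are preserved. *)
Lemma comm_pair_conj (F : fieldType) (G : finGroupType)
    (a : cocycle (units F) G) d g h : commute g h ->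
  comm_pair a (d * g * d^-1)%g (d * h * d^-1)%g = comm_pair a g h.
Proof.
move=> gh; pose K x : twisted_alg a := tw_basis a d * x * tw_inv a d.
have KM x y : K (x * y) = K x * K y.
  by rewrite /K !mulrA -[_ * tw_inv a d * tw_basis a d]mulrA tw_inv_mul mulr1.
have KZ l x : K (l *: x) = l *: K x by rewrite /K -[_ * (l *: x)]scalerAr -scalerAl.
have Ku x : exists l, K (tw_basis a x) = uval l *: tw_basis a (d * x * d^-1)%g.
  rewrite /K tw_basisM /tw_inv -scalerAl -scalerAr tw_basisM !scalerA.
  eexists (_ : units F); rewrite -!uvalD -uvalN -!uvalD; reflexivity.
have [l lE] := Ku g; have [m mE] := Ku h.
have e : tw_basis a g * tw_basis a h =
    uval (comm_pair a g h) *: (tw_basis a h * tw_basis a g).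
  by rewrite !tw_basisM scalerA -uvalD subrK gh.
have := congr1 K e; rewrite KZ !KM lE mE -!scalerAl -!scalerAr !scalerA.
set g' := (d * g * d^-1)%g; set h' := (d * h * d^-1)%g.
have gh' : (g' * h' = h' * g')%g.
  by rewrite /g' /h' !mulgA !mulgKV -[(d * g * h)%g]mulgA gh mulgA.
rewrite !tw_basisM !scalerA gh' => /ffunP/(_ (h' * g')%g).
rewrite !ffunE eqxx /GRing.scale /= !mulr1 -!uvalD => e2.
have: l + m + a (g', h') = comm_pair a g h + (m + l) + a (h', g').
  by apply: uval_inj; rewrite e2 addrA.
move: (comm_pair a g h) => c e3; rewrite /comm_pair; apply: (addrI (l + m)).
by rewrite addrA e3 addrK addrC (addrC m).
Qed.

(** * A group of order 32 *)

Definition quarters : seq 'I_4 := [:: 0; 1; 1 + 1; 1 + 1 + 1].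

Lemma quartersE (x : 'I_4) : x \in quarters.
Proof. by case: x => [[|[|[|[|x]]]] xP]. Qed.

Definition dbl (j : bool) (x : 'I_4) : 'I_4 := if j then x + x else 0.
(** If c x = z x c with z of order 4, then (x c^2)^n = z^(n(n-1)) x^n c^(2n); this exponent appears
    when y is moved past x^n. *)
Definition fall2 (j : bool) (x : 'I_4) : 'I_4 := if j then x * (x - 1) else 0.

Lemma dblD j : {morph dbl j : x y / x + y}.
Proof. by case: j => x y; rewrite /dbl ?addr0 // addrACA. Qed.

Lemma dbl_dbl j k x : dbl j (dbl k x) = 0.
Proof.
have test : all (fun x : 'I_4 => x + x + (x + x) == 0) quarters by [].
by case: j; case: k; rewrite /dbl ?addr0 // (eqP (allP test x (quartersE x))).
Qed.

Lemma dbl_addb j k x : dbl (j (+) k) x = dbl j x + dbl k x.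
Proof.
have := dbl_dbl true true x.
by case: j; case: k; rewrite /= ?addr0 ?add0r // => <-.
Qed.

Lemma fall2_cocycle j k x y :
  fall2 j x + dbl j x * y + fall2 (j (+) k) y = fall2 k y + fall2 j (x + y).
Proof.
have test : all (fun j => all (fun k => all (fun x => all (fun y =>
    fall2 j x + dbl j x * y + fall2 (j (+) k) y == fall2 k y + fall2 j (x + y))
    quarters) quarters) [:: true; false]) [:: true; false] by [].
have bE (b : bool) : b \in [:: true; false] by case: b.
apply/eqP; move/allP/(_ j (bE j))/allP/(_ k (bE k)): test.
by move/allP/(_ x (quartersE x))/allP/(_ y (quartersE y)).
Qed.

(* The element (i, k, j) stands for x^i c^k y^j, where x and c have order 4,  *)
(* y has order 2, c is central and y x = x y c^2.                             *)
Definition pgrp : Type := ('I_4 * 'I_4 * bool)%type.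
HB.instance Definition _ := Finite.on pgrp.

Definition pgrp_mul (p q : pgrp) : pgrp :=
  (p.1.1 + q.1.1, p.1.2 + q.1.2 + dbl p.2 q.1.1, p.2 (+) q.2).
Definition pgrp_inv (p : pgrp) : pgrp :=
  (- p.1.1, - (p.1.2 + dbl p.2 (- p.1.1)), p.2).

Fact pgrp_mulA : associative pgrp_mul.
Proof.
move=> [[i k] j] [[i' k'] j'] [[i'' k''] j'']; rewrite /pgrp_mul /=.
rewrite addrA addbA dblD dbl_addb; congr (_, _, _).
by rewrite !addrA [LHS](ACl (1*2*5*3*6*4)).
Qed.

Fact pgrp_mul1 : left_id ((0, 0, false) : pgrp) pgrp_mul.
Proof.
by move=> [[i k] j]; rewrite /pgrp_mul /= !add0r addr0.
Qed.

Fact pgrp_mulV : left_inverse ((0, 0, false) : pgrp) pgrp_inv pgrp_mul.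
Proof.
move=> [[i k] j]; rewrite /pgrp_mul /= addNr addbb; congr (_, _, _).
have -> : dbl j (- i) = dbl j i.
  have test : all (fun x => dbl true (- x) == dbl true x) quarters by [].
  by case: j => //; apply/eqP: (allP test i (quartersE i)).
by rewrite -addrA addNr.
Qed.

HB.instance Definition _ := Finite_isGroup.Build pgrp pgrp_mulA pgrp_mul1 pgrp_mulV.

Lemma pgrpM (p q : pgrp) : (p * q)%g = pgrp_mul p q.
Proof. by []. Qed.

(** The exponent collected when x^i c^k y^j x^i' c^k' y^j' is put in normal form and c x = z x c
    replaces commutation of c with x. *)
Fact cocycle_s_subproof :
  [ffun pq : pgrp * pgrp => pq.1.1.2 * pq.2.1.1 + fall2 pq.1.2 pq.2.1.1]
    \in Z2 (A := 'I_4) (G := pgrp).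
Proof.
apply/Z2P => -[[i k] j] [[i' k'] j'] [[i'' k''] j''].
rewrite !ffunE !pgrpM /pgrp_mul /=; have := fall2_cocycle j j' i' i''.
move: (dbl j i') (fall2 j i') (fall2 (j (+) j') i'') (fall2 j' i'').
move: (fall2 j (i' + i'')) => u1 u2 u3 u4 u5 e.
apply/eqP; rewrite -subr_eq0; apply/eqP; rewrite -[RHS](subrr (u5 + u1)) -{1}e.
ring.
Qed.
Definition cocycle_s : cocycle 'I_4 pgrp := Cocycle cocycle_s_subproof.

(** Here y c = - c y replaces commutation of c with y; the sign is the square of the root of unity,
    whence the doubling. *)
Fact cocycle_t_subproof :
  [ffun pq : pgrp * pgrp => dbl pq.1.2 pq.2.1.2] \in Z2 (A := 'I_4) (G := pgrp).
Proof.
apply/Z2P => -[[i k] j] [[i' k'] j'] [[i'' k''] j''].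
rewrite !ffunE !pgrpM /pgrp_mul /= dbl_addb !dblD.
by rewrite dbl_dbl addr0 [RHS]addrC addrA.
Qed.
Definition cocycle_t : cocycle 'I_4 pgrp := Cocycle cocycle_t_subproof.

Definition pgrp_seq : seq pgrp :=
  [seq (ik, j) | ik <- [seq (i, k) | i <- quarters, k <- quarters],
                 j <- [:: false; true]].

Definition gx : pgrp := (1, 0, false).
Definition gc : pgrp := (0, 1, false).
Definition gy : pgrp := (0, 0, true).

Lemma pgrp_genE (i k : 'I_4) (j : bool) :
  (gx ^+ i * gc ^+ k * gy ^+ j)%g = (i, k, j).
Proof.
have test : all (fun i : 'I_4 => all (fun k : 'I_4 => all (fun j : bool =>
    (gx ^+ i * gc ^+ k * gy ^+ j)%g == (i, k, j)) [:: false; true]) quarters) quarters.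
  by [].
move: test => /allP/(_ i (quartersE i))/allP/(_ k (quartersE k))/allP/(_ j).
by case: j => /(_ isT)/eqP.
Qed.

Lemma gx4 : (gx ^+ 4 = 1)%g. Proof. exact/eqP. Qed.
Lemma gy2 : (gy ^+ 2 = 1)%g. Proof. exact/eqP. Qed.
Lemma gc2 : (gc ^+ 2 = gx ^+ 3 * gy * gx * gy)%g. Proof. exact/eqP. Qed.

Lemma commute_gc (p : pgrp) : commute gc p.
Proof.
case: p => [[i k] j]; rewrite /commute !pgrpM /pgrp_mul /= !add0r.
have -> : dbl j 0 = 0 by case: j; rewrite /dbl ?addr0.
by rewrite !addr0 (addrC 1) addbF.
Qed.

Lemma normal_form_mul (A : nzRingType) (xi xi' ck ck' c2 y yj : A) :
  y * xi' = xi' * c2 * y -> ck * xi' = xi' * ck -> y * ck' = ck' * y ->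
  c2 * ck' = ck' * c2 ->
  xi * xi' * (ck * ck' * c2) * (y * yj) = xi * ck * y * (xi' * ck' * yj).
Proof.
move=> e1 e2 e3 e4; rewrite !mulrA -(mulrA _ y xi') e1 !mulrA.
rewrite -(mulrA _ ck xi') e2 !mulrA -(mulrA _ y ck') e3 !mulrA.
by rewrite -(mulrA _ c2 ck') e4 !mulrA.
Qed.

Section PgrpMultiplier.
Variables (F : numClosedFieldType).
Implicit Type a : cocycle (units F) pgrp.

(** Lifts [X], [Y], [C] of the generators can be scaled to satisfy the relations on x^4, y^2 and
    c^2. The vanishing pairings make [C] central among them, and the products
    [X ^+ i * C ^+ k * Y ^+ j] then multiply as the group elements do. *)
Lemma pgrp_trivial a :
  comm_pair a gc gx = 0 -> comm_pair a gc gy = 0 -> class2 a = 0.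
Proof.
move=> cx cy.
have [X mX X4] : exists2 X, monomial (a := a) X gx & X ^+ 4 = 1.
  by apply: (@monomial_root F _ a 1 gx 4 isT); rewrite gx4; exact: monomial1.
have [Y mY Y2] : exists2 Y, monomial (a := a) Y gy & Y ^+ 2 = 1.
  by apply: (@monomial_root F _ a 1 gy 2 isT); rewrite gy2; exact: monomial1.
have [C mC C2] : exists2 C, monomial (a := a) C gc & C ^+ 2 = X ^+ 3 * Y * X * Y.
  apply: (@monomial_root F _ a _ gc 2 isT); rewrite gc2.
  exact: monomialM (monomialM (monomialM (monomialX 3 mX) mY) mX) mY.
have CX : GRing.comm C X := monomial_comm (commute_gc gx) cx mC mX.
have CY : GRing.comm C Y := monomial_comm (commute_gc gy) cy mC mY.
have YX : Y * X = X * C ^+ 2 * Y.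
  have : X * X ^+ 3 = 1 by rewrite -exprS.
  rewrite C2; move: (X ^+ 3) => X3 XX3.
  by rewrite -!mulrA -expr2 Y2 mulr1 !mulrA XX3 mul1r.
have Y2' : Y * Y = 1 by rewrite -expr2.
have C4 : C ^+ 4 = 1.
  (* Conjugating [X] twice by the involution [Y] gives [X = X * C ^+ 4]. *)
  have: X ^+ 4 = X ^+ 4 * C ^+ 4; last by rewrite X4 mul1r.
  have: C ^+ 4 = C ^+ 2 * C ^+ 2 by rewrite -exprD.
  have: X ^+ 4 = X ^+ 3 * X by rewrite exprSr.
  have: Y * C ^+ 2 = C ^+ 2 * Y by apply: commrX; apply: commr_sym.
  move: (X ^+ 4) (C ^+ 4) (X ^+ 3) (C ^+ 2) YX => X' C' Z D YX YD -> ->.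
  rewrite -mulrA; congr (_ * _).
  have {1}-> : X = Y * (Y * X) by rewrite mulrA Y2' mul1r.
  by rewrite YX !mulrA YX -(mulrA _ Y D) YD mulrA -(mulrA _ Y Y) Y2' mulr1.
have CnX n m : GRing.comm (C ^+ n) (X ^+ m).
  by apply/commrX/commr_sym/commrX/commr_sym.
have CnY n m : GRing.comm (C ^+ n) (Y ^+ m).
  by apply/commrX/commr_sym/commrX/commr_sym.
have YXn n : Y * X ^+ n = X ^+ n * C ^+ (n + n) * Y.
  elim: n => [|n IHn]; first by rewrite expr0 mulr1 !mul1r.
  have: C ^+ (n.+1 + n.+1) = C ^+ 2 * C ^+ (n + n) by rewrite -exprD addSn addnS.
  have: C ^+ 2 * X ^+ n = X ^+ n * C ^+ 2 := CnX 2 n.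
  rewrite (exprS X); move: (C ^+ (n.+1 + n.+1)) (C ^+ (n + n)) (C ^+ 2) (X ^+ n) YX IHn.
  move=> C1 Cn D Xn YX IHn DX ->.
  by rewrite [LHS]mulrA YX -(mulrA _ Y Xn) IHn !mulrA -(mulrA X D) DX !mulrA.
pose U (p : pgrp) := X ^+ p.1.1 * C ^+ p.1.2 * Y ^+ p.2.
apply: (@class2_eq0_lift _ _ _ U).
  move=> [[i k] j]; rewrite -[X in monomial _ X]pgrp_genE.
  exact: monomialM (monomialM (monomialX i mX) (monomialX k mC)) (monomialX j mY).
move=> [[i k] j] [[i' k'] j']; rewrite pgrpM /U /pgrp_mul.
pose Yj := Y ^+ j; pose Cj := C ^+ (dbl j i').
rewrite -[X in Y ^+ X]/(nat_of_bool (j (+) j')).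
have -> : X ^+ (i + i')%R = X ^+ i * X ^+ i' by rewrite (expr_mod _ X4) exprD.
have -> : C ^+ (k + k' + dbl j i')%R = C ^+ k * C ^+ k' * Cj.
  by rewrite (expr_mod _ C4) exprD (expr_mod _ C4) exprD.
have -> : Y ^+ (j (+) j') = Yj * Y ^+ j'.
  by rewrite /Yj; case: j {Yj Cj}; case: j'; rewrite /= ?expr1 ?expr0 ?mulr1 ?mul1r.
apply: normal_form_mul.
- rewrite /Yj /Cj; case: j {Yj Cj}; last first.
    by rewrite -[Y ^+ _]/(Y ^+ 0) -[C ^+ _]/(C ^+ 0) !expr0 !mulr1 mul1r.
  by rewrite /dbl (expr_mod _ C4) expr1 YXn.
- exact: CnX.
- by apply/esym/CnY.
- by rewrite /Cj -!exprD addnC.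
Qed.

Lemma imag_neq0 : 'i != 0 :> F. Proof. exact: neq0Ci. Qed.
Definition imag : units F := Units imag_neq0.

Lemma imag4 : imag *+ 4 = 0.
Proof.
apply: uval_inj; rewrite uvalMn -[4%N]/(2 * 2)%N exprM sqrCi.
by rewrite sqrrN expr1n.
Qed.

Lemma imag_prim : 4.-primitive_root ('i : F).
Proof.
have m1 : (-1 : F) != 1 by rewrite eq_sym -subr_eq0 opprK -(natrD _ 1 1) pnatr_eq0.
have i1 : ('i : F) != 1.
  by apply: contra_neq m1 => i1; rewrite -sqrCi i1 expr1n.
have i3 : ('i : F) ^+ 3 != 1.
  apply: contra_neq i1; rewrite exprS sqrCi mulrN1 => /(canRL opprK) i1.
  by move: m1; rewrite -sqrCi i1 sqrrN expr1n eqxx.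
apply/andP; split=> //; apply/forallP => -[[|[|[|[|k]]]] kP] //=;
  rewrite unity_rootE.
- by rewrite expr1 (negPf i1).
- by rewrite sqrCi (negPf m1).
- by rewrite (negPf i3).
have i4 : ('i : F) ^+ 4 = 1.
  by rewrite -[4%N]/(2 * 2)%N exprM sqrCi sqrrN expr1n.
by rewrite i4 !eqxx.
Qed.

Definition pgrp_cocycle (s t : nat) : cocycle (units F) pgrp :=
  cocycle_map (Zp_mulrn imag4) cocycle_s *+ s +
  cocycle_map (Zp_mulrn imag4) cocycle_t *+ t.

Lemma pgrp_cocycleE s t (p q : pgrp) :
  pgrp_cocycle s t (p, q) = imag *+ (cocycle_s (p, q) * s + cocycle_t (p, q) * t).
Proof.
rewrite /pgrp_cocycle ffunE !cocycleMnE !cocycle_mapE /Zp_mulrn.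
by rewrite -!mulrnA -mulrnDr.
Qed.

Lemma comm_pair_s s t : comm_pair (pgrp_cocycle s t) gc gx = imag *+ s.
Proof.
rewrite /comm_pair !pgrp_cocycleE !ffunE.
by rewrite -[X in _ - _ *+ X]/(0 * s + 0 * t)%N -[X in _ *+ X - _]/(1 * s + 0 * t)%N
  !mul0n mul1n addn0 mulr0n subr0.
Qed.

Lemma comm_pair_t s t : comm_pair (pgrp_cocycle s t) gc gy = (imag *+ 2) *+ t.
Proof.
rewrite /comm_pair !pgrp_cocycleE !ffunE.
rewrite -[X in _ - _ *+ X]/(0 * s + 2 * t)%N -[X in _ *+ X - _]/(0 * s + 0 * t)%N.
rewrite !mul0n mulr0n sub0r add0n mulrnA; apply: (addIr (imag *+ 2 *+ t)).
by rewrite addNr -mulrnDl -mulrnDr imag4 mul0rn.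
Qed.

(** The pairing of c with x is a fourth root of unity and that with y a sign, since x^4 = y^2 = 1;
    subtracting the cocycle with the same pairings leaves a trivial class. *)
Lemma pgrp_classes a : exists s t : nat, [/\ (s < 4)%N, (t < 2)%N &
  class2 a = class2 (pgrp_cocycle s t)].
Proof.
have [s s4 sE] : exists2 s, (s < 4)%N & comm_pair a gc gx = imag *+ s.
  have : comm_pair a gc gx *+ 4 = 0.
    rewrite -comm_pairX; last exact: commute_gc.
    by rewrite gx4 comm_pair1.
  move/(congr1 (@uval F)); rewrite uvalMn => /(prim_rootP imag_prim)[s e].
  by exists s => //; apply: uval_inj; rewrite uvalMn.
have [t t2 tE] : exists2 t, (t < 2)%N & comm_pair a gc gy = imag *+ 2 *+ t.
  have : comm_pair a gc gy *+ 2 = 0.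
    rewrite -comm_pairX; last exact: commute_gc.
    by rewrite gy2 comm_pair1.
  move/(congr1 (@uval F)); rewrite uvalMn => /eqP; rewrite sqrf_eq1.
  case/orP => /eqP e; [exists 0%N | exists 1%N] => //; apply: uval_inj.
    by rewrite e.
  by rewrite e uvalMn expr1 uvalMn sqrCi.
exists s, t; split=> //; apply/eqP; rewrite -subr_eq0 -raddfB; apply/eqP.
have pairB b c g h : comm_pair (b - c) g h = comm_pair b g h - comm_pair c g h.
  by apply: (addIr (comm_pair c g h)); rewrite -comm_pairD !subrK.
by apply: pgrp_trivial; rewrite pairB ?sE ?tE ?comm_pair_s ?comm_pair_t subrr.
Qed.
End PgrpMultiplier.

(** * Extensions of a 2-group by the square of the group of order 3 *)

Record sign_char (P : finGroupType) := SignChar {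
  sign_of :> P -> bool;
  sign_ofM : {morph sign_of : p q / (p * q)%g >-> p (+) q} }.

Lemma sign_of1 (P : finGroupType) (c : sign_char P) : c 1%g = false.
Proof. by have := sign_ofM c 1%g 1%g; rewrite mulg1 addbb. Qed.

Lemma sign_ofV (P : finGroupType) (c : sign_char P) p : c (p^-1)%g = c p.
Proof.
have := sign_ofM c p (p^-1)%g; rewrite mulgV sign_of1.
by case: (c p); case: (c _).
Qed.

Definition flip (V : zmodType) (b : bool) (x : V) : V := if b then - x else x.

Lemma flipD (V : zmodType) b : {morph @flip V b : x y / x + y}.
Proof. by case: b => x y //=; rewrite opprD. Qed.

Lemma flip_addb (V : zmodType) b c (x : V) : flip (b (+) c) x = flip b (flip c x).
Proof. by case: b; case: c; rewrite /= ?opprK. Qed.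

Lemma flip0 (V : zmodType) b : flip b (0 : V) = 0.
Proof. by case: b; rewrite /= ?oppr0. Qed.

Definition sdp (P : finGroupType) (c1 c2 : sign_char P) : Type :=
  ('I_3 * 'I_3 * P)%type.

Section SemidirectProduct.
Variables (P : finGroupType) (c1 c2 : sign_char P).
Local Notation G := (sdp c1 c2).
Local Notation Q := ('I_3 * 'I_3)%type.
HB.instance Definition _ := Finite.on G.

Definition sdp_mul (u v : G) : G :=
  (u.1.1 + flip (c1 u.2) v.1.1, u.1.2 + flip (c2 u.2) v.1.2, (u.2 * v.2)%g).
Definition sdp_inv (u : G) : G :=
  (- flip (c1 u.2) u.1.1, - flip (c2 u.2) u.1.2, (u.2^-1)%g).

Fact sdp_mulA : associative sdp_mul.
Proof.
move=> [[a b] p] [[a' b'] p'] [[a'' b''] p'']; rewrite /sdp_mul /=.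
by rewrite !flipD !sign_ofM !flip_addb !addrA mulgA.
Qed.
Fact sdp_mul1 : left_id ((0, 0, 1%g) : G) sdp_mul.
Proof. by move=> [[a b] p]; rewrite /sdp_mul /= !sign_of1 !add0r mul1g. Qed.
Fact sdp_mulV : left_inverse ((0, 0, 1%g) : G) sdp_inv sdp_mul.
Proof.
by move=> [[a b] p]; rewrite /sdp_mul /sdp_inv /= !sign_ofV !addNr mulVg.
Qed.
HB.instance Definition _ := Finite_isGroup.Build G sdp_mulA sdp_mul1 sdp_mulV.

Lemma sdpM (u v : G) : (u * v)%g = sdp_mul u v. Proof. by []. Qed.

Definition sdp_proj (u : G) : P := u.2.
Definition sdp_inl (q : Q) : G := (q, 1%g).
Definition sdp_inr (p : P) : G := (0, 0, p).

Lemma sdp_projM : {morph sdp_proj : u v / (u * v)%g}. Proof. by []. Qed.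
Lemma sdp_inrM : {morph sdp_inr : p q / (p * q)%g}.
Proof. by move=> p q; rewrite sdpM /sdp_mul /= !flip0 !addr0. Qed.
Lemma sdp_inlM : {morph sdp_inl : p q / (p * q)%g}.
Proof.
by move=> [a b] [a' b']; rewrite sdpM /sdp_mul /= !sign_of1 mulg1.
Qed.

Lemma card_sdp : #|{: G}| = (9 * #|P|)%N.
Proof. by rewrite !card_prod !card_ord. Qed.

Variable F : numClosedFieldType.

Lemma nine_group_trivial (a : cocycle (units F) Q) :
  comm_pair a (1, 0) (0, 1) = 0 -> class2 a = 0.
Proof.
pose e1 : Q := (1, 0); pose e2 : Q := (0, 1) => c12.
have QC (p q : Q) : commute p q.
  by case: p q => [x y] [x' y']; congr (_, _); apply: addrC.
have e13 : (e1 ^+ 3 = 1)%g by apply/eqP.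
have e23 : (e2 ^+ 3 = 1)%g by apply/eqP.
have [X mX X3] : exists2 X, monomial (a := a) X e1 & X ^+ 3 = 1.
  by apply: (@monomial_root F _ a 1 e1 3 isT); rewrite e13; exact: monomial1.
have [Y mY Y3] : exists2 Y, monomial (a := a) Y e2 & Y ^+ 3 = 1.
  by apply: (@monomial_root F _ a 1 e2 3 isT); rewrite e23; exact: monomial1.
have XY : GRing.comm X Y := monomial_comm (QC e1 e2) c12 mX mY.
have XYn m n : X ^+ m * Y ^+ n = Y ^+ n * X ^+ m.
  by apply/commrX/commr_sym/commrX/commr_sym.
pose U (q : Q) := X ^+ q.1 * Y ^+ q.2.
apply: (@class2_eq0_lift _ _ _ U).
  move=> [i j]; have ijE : (i, j) = (e1 ^+ i * e2 ^+ j)%g.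
    have test : all (fun i : 'I_3 => all (fun j : 'I_3 =>
      (i, j) == (e1 ^+ i * e2 ^+ j)%g) [:: 0; 1; 1 + 1]) [:: 0; 1; 1 + 1] by [].
    have I3 (x : 'I_3) : x \in [:: 0; 1; 1 + 1] by case: x => [[|[|[|x]]] xP].
    by apply/eqP; have /allP/(_ i (I3 i))/allP/(_ j (I3 j)) := test.
  by have := monomialM (monomialX i mX) (monomialX j mY); rewrite -ijE.
move=> [i j] [i' j']; rewrite /U.
have -> : X ^+ ((i, j) * (i', j') : Q)%g.1 = X ^+ i * X ^+ i'.
  by rewrite -exprD -(expr_mod (i + i') X3).
have -> : Y ^+ ((i, j) * (i', j') : Q)%g.2 = Y ^+ j * Y ^+ j'.
  by rewrite -exprD -(expr_mod (j + j') Y3).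
rewrite -!mulrA; congr (_ * _); rewrite !mulrA; congr (_ * _).
exact: XYn.
Qed.

Variable d : P.
Hypotheses (d1 : c1 d) (d2 : ~~ c2 d).

(** Conjugation by [d] inverts the first basis vector of Z_3^2 and fixes the second. The pairing of
    the two therefore equals its own double and vanishes. *)
Lemma sdp_inl_trivial (a : cocycle (units F) G) :
  class2 (cocycle_pull sdp_inlM a) = 0.
Proof.
apply: nine_group_trivial; rewrite /comm_pair !cocycle_pullE.
rewrite -/(comm_pair a (sdp_inl (1, 0)) (sdp_inl (0, 1))).
set e1 := sdp_inl (1, 0); set e2 := sdp_inl (0, 1).
have e12 : commute e1 e2.
  by rewrite /commute -!sdp_inlM; congr sdp_inl; apply/eqP.
have D1 : (sdp_inr d * e1 * (sdp_inr d)^-1 = e1 ^+ 2)%g.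
  apply: (mulIg (sdp_inr d)); rewrite mulgKV expg2 -sdp_inlM !sdpM /sdp_mul /=.
  by rewrite d1 (negPf d2) !sign_of1 mulg1 mul1g [(1 * d)%g]mul1g; congr (_, _, _); apply/eqP.
have D2 : (sdp_inr d * e2 * (sdp_inr d)^-1 = e2)%g.
  apply: (mulIg (sdp_inr d)); rewrite mulgKV !sdpM /sdp_mul /=.
  by rewrite d1 (negPf d2) !sign_of1 mulg1 mul1g; congr (_, _, _); apply/eqP.
have := comm_pair_conj a (sdp_inr d) e12; rewrite D1 D2.
rewrite comm_pairC comm_pairX; last exact: commute_sym.
rewrite (comm_pairC a e1 e2) mulNrn opprK mulr2n => e.
by apply: (addrI (comm_pair a e1 e2)); rewrite addr0.
Qed.

Hypothesis co9 : coprime #|P| 9.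

(** Trivial on [P], the class is killed by the index 9; trivial on Z_3^2, it is killed by the index
    |P|. The two are coprime. *)
Lemma sdp_inr_inj (a : cocycle (units F) G) :
  class2 (cocycle_pull sdp_inrM a) = 0 -> class2 a = 0.
Proof.
move=> aP.
have a9 : class2 a *+ 9 = 0.
  have -> : 9%N = #|{: Q}| by rewrite card_prod !card_ord.
  apply: (@induced_kill _ _ _ _ sdp_inrM a _ sdp_inl
    (fun u q => (u.1.1 + flip (c1 u.2) q.1, u.1.2 + flip (c2 u.2) q.2))
    (fun u _ => u.2)) => //.
  - by rewrite card_prod !card_ord.
  - by move=> [x y]; rewrite /= !sign_of1 !add0r.
  - move=> [[x y] p] [[x' y'] p'] [x'' y'']; rewrite sdpM /sdp_mul /=.
    by rewrite !sign_ofM !flip_addb !flipD !addrA.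
  - move=> [[x y] p] [x' y']; rewrite !sdpM /sdp_mul /=.
    by rewrite !flip0 !addr0 mulg1 mul1g.
have aQ : class2 a *+ #|P| = 0.
  apply: (@induced_kill _ _ _ _ sdp_inlM a _ sdp_inr (fun u p => (u.2 * p)%g)
    (fun u p => (flip (c1 (u.2 * p)%g) u.1.1, flip (c2 (u.2 * p)%g) u.1.2))) => //.
  - by rewrite -cardsT cardG_gt0.
  - by move=> p; rewrite mul1g.
  - by move=> p; rewrite !flip0.
  - by move=> u v p; rewrite mulgA.
  - move=> [[x y] p] [[x' y'] p'] q; rewrite sdpM /sdp_mul /= -mulgA.
    have flipE (c : sign_char P) (z : 'I_3) :
        flip (c (p * (p' * q))%g) (flip (c p) z) = flip (c (p' * q)%g) z.
      by rewrite sign_ofM -flip_addb addbC addbA addbb addFb.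
    by rewrite !flipD !flipE.
  - move=> [[x y] p] q; rewrite !sdpM /sdp_mul /=.
    by rewrite !flip0 !addr0 !add0r mulg1 -!flip_addb !addbb.
  exact: sdp_inl_trivial.
rewrite -[class2 a]mulr1n -(eq_mulrn_mod (j := chinese #|P| 9 0 1) a9); last first.
  exact: chinese_modr.
have /dvdnP[k ->] : (#|P| %| chinese #|P| 9 0 1)%N.
  by rewrite /dvdn chinese_modl // mod0n.
by rewrite mulnC mulrnA aQ mul0rn.
Qed.
End SemidirectProduct.

Section SdpMultiplier.
Variables (F : numClosedFieldType) (c1 c2 : sign_char pgrp).
Local Notation G := (sdp c1 c2).

Definition sdp_cocycle (s t : nat) : cocycle (units F) G :=
  cocycle_pull (@sdp_projM pgrp c1 c2) (pgrp_cocycle F s t).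

Definition sdp_class (st : 'I_4 * 'I_2) : H2 (units F) G :=
  class2 (sdp_cocycle st.1 st.2).

Fact sdp_class_zmod_morphism : zmod_morphism sdp_class.
Proof.
pose cs := cocycle_pull (@sdp_projM pgrp c1 c2)
  (cocycle_map (Zp_mulrn (imag4 F)) cocycle_s).
pose ct := cocycle_pull (@sdp_projM pgrp c1 c2)
  (cocycle_map (Zp_mulrn (imag4 F)) cocycle_t).
have cs4 : class2 cs *+ 4 = 0.
  rewrite -raddfMn -(raddf0 (@class2 _ G)); congr class2; apply: val_inj.
  apply/ffunP => p /=; rewrite -[LHS]/((cs *+ 4) p) cocycleMnE !ffunE /Zp_mulrn.
  by rewrite mulrnAC imag4 mul0rn.
have ct2 : class2 ct *+ 2 = 0.
  rewrite -raddfMn -(raddf0 (@class2 _ G)); congr class2; apply: val_inj.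
  apply/ffunP => p /=; rewrite -[LHS]/((ct *+ 2) p) cocycleMnE !ffunE /Zp_mulrn.
  rewrite mulr2n -[_ + _]/(Zp_mulrn (imag4 F) _ + Zp_mulrn (imag4 F) _) -raddfD /=.
  have := dbl_dbl true (sdp_proj p.1).2 (sdp_proj p.2).1.2; rewrite {1}/dbl => ->.
  by [].
have E st : sdp_class st = Zp_mulrn cs4 st.1 + Zp_mulrn ct2 st.2.
  by rewrite /sdp_class /sdp_cocycle /pgrp_cocycle !raddfD !raddfMn.
by move=> st st'; rewrite !E !raddfB opprD addrACA.
Qed.
HB.instance Definition _ := GRing.isZmodMorphism.Build
  ('I_4 * 'I_2)%type (H2 (units F) G) sdp_class sdp_class_zmod_morphism.

Lemma pull_sdp_cocycle s t :
  cocycle_pull (@sdp_inrM pgrp c1 c2) (sdp_cocycle s t) = pgrp_cocycle F s t.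
Proof. by apply: val_inj; apply/ffunP => -[p q]; rewrite !ffunE. Qed.

Variable d : pgrp.
Hypotheses (d1 : c1 d) (d2 : ~~ c2 d).

Lemma card_pgrp : #|{: pgrp}| = 32.
Proof. by rewrite !card_prod !card_ord card_bool. Qed.

(** The pairings on the complement tell inflated classes apart. Any class restricts there to some
    [pgrp_cocycle], so by [sdp_inr_inj] it is the inflation of that one. *)
Lemma sdp_class_bij : bijective sdp_class.
Proof.
have ker z : sdp_class z = 0 -> z = 0.
  case: z => s t z0.
  have : class2 (pgrp_cocycle F s t) = class2 0.
    rewrite -(pull_sdp_cocycle s t) -[0 in RHS](raddf0 (cocycle_pull (@sdp_inrM pgrp c1 c2))).
    by apply: cocycle_pull_class; rewrite raddf0.
  move=> z1; have := comm_pair_class (commute_gc gx) z1.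
  have := comm_pair_class (commute_gc gy) z1.
  rewrite comm_pair_s comm_pair_t /comm_pair !ffunE subrr => t0 s0.
  have /eqP : uval (imag F *+ s) = 1 by rewrite s0.
  rewrite uvalMn -(prim_order_dvd (imag_prim F)) => dvd_s.
  have /eqP : uval (imag F *+ (2 * t)) = 1 by rewrite mulrnA t0.
  rewrite uvalMn -(prim_order_dvd (imag_prim F)) (@dvdn_pmul2l 2 2) // => dvd_t.
  have zero n (i : 'I_n.+1) : (n.+1 %| i)%N -> i = 0.
    by move=> ni; apply: val_inj; rewrite /= -(modn_small (ltn_ord i)); apply/eqP.
  by rewrite (zero _ _ dvd_s) (zero _ _ dvd_t).
have inj : injective sdp_class.
  move=> x y /eqP; rewrite -subr_eq0 -raddfB => /eqP/ker/eqP.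
  by rewrite subr_eq0 => /eqP.
have surj (x : H2 (units F) G) : exists st, sdp_class st = x.
  have [a ->] := class2_surj x.
  have [s [t [s4 t2 aP]]] := pgrp_classes (cocycle_pull (@sdp_inrM pgrp c1 c2) a).
  exists (Ordinal s4, Ordinal t2).
  apply/eqP; rewrite -subr_eq0 -[_ - _](raddfB (@class2 _ G)); apply/eqP.
  apply: (sdp_inr_inj d1 d2); first by rewrite card_pgrp.
  by rewrite raddfB /= pull_sdp_cocycle raddfB /= aP subrr.
have [g gP] := choice surj.
by exists g => z; [apply: inj; rewrite gP | rewrite gP].
Qed.
End SdpMultiplier.

(** * The spectrum of an inflated class *)

(** The exponent of the scalar that relates the commutator of u_g and u_h to the basis element of
    the group commutator, as [tw_commutator] shows. *)
Definition comm_phase (A : zmodType) (G : finGroupType) (a : cocycle A G) (g h : G) : A :=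
  a (g, h) - a (h, g) - a ((g * h * g^-1 * h^-1)%g, (h * g)%g).

Lemma tw_commutator (F : fieldType) (G : finGroupType) (a : cocycle (units F) G) g h :
  tw_basis a g * tw_basis a h * tw_inv a g * tw_inv a h =
  uval (comm_phase a g h) *: tw_basis a (g * h * g^-1 * h^-1)%g.
Proof.
set x : twisted_alg a := LHS; set y : twisted_alg a := RHS.
have eq_hg : x * (tw_basis a h * tw_basis a g) = y * (tw_basis a h * tw_basis a g).
  rewrite /x /y !mulrA -[X in X * tw_basis a g]mulrA tw_inv_mul mulr1.
  rewrite -[LHS]mulrA tw_inv_mul mulr1 -[RHS]mulrA !tw_basisM -scalerAl -scalerAr.
  rewrite tw_basisM !scalerA; congr (_ *: tw_basis a _).
    rewrite -!uvalD /comm_phase; congr uval.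
    by rewrite (addrAC _ _ (a (h, g))) subrK subrK.
  by rewrite !mulgA !mulgKV.
have K : tw_basis a h * tw_basis a g * (tw_inv a g * tw_inv a h) = 1.
  by rewrite mulrA -[X in X * _]mulrA tw_mul_inv mulr1 tw_mul_inv.
by rewrite -[x]mulr1 -[y]mulr1 -K [LHS]mulrA eq_hg -[LHS]mulrA.
Qed.

Lemma commutator_sumE (F : fieldType) (G : finGroupType) (a : cocycle (units F) G) :
  commutator_sum a =
  \sum_g \sum_h uval (comm_phase a g h) *: tw_basis a (g * h * g^-1 * h^-1)%g.
Proof. by apply: eq_bigr => g _; apply: eq_bigr => h _; exact: tw_commutator. Qed.

Lemma idempotent_sum_exp (F : fieldType) (A : algType F) (I : finType)
    (eps : I -> A) (lam : I -> F) k :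
  (forall i j, eps i * eps j = if i == j then eps i else 0) -> \sum_i eps i = 1 ->
  (\sum_i lam i *: eps i) ^+ k = \sum_i lam i ^+ k *: eps i.
Proof.
move=> epsM eps1; elim: k => [|k IHk].
  by rewrite expr0 -[LHS]eps1; apply: eq_bigr => i _; rewrite scale1r.
rewrite exprSr IHk mulr_suml; apply: eq_bigr => i _.
rewrite mulr_sumr (bigD1 i) //= big1 ?addr0 => [|j ji].
  by rewrite -scalerAl -scalerAr scalerA epsM eqxx -exprSr.
by rewrite -scalerAl -scalerAr epsM eq_sym (negPf ji) !scaler0.
Qed.

Definition cut (A : nzRingType) (f : bool) (e : A) : A := if f then e else 1 - e.

Section Cuts.
Variables (F : fieldType) (A : algType F).
Implicit Type e : A.

Lemma cutM e f f' : e * e = e -> cut f e * cut f' e = if f == f' then cut f e else 0.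
Proof.
move=> ee; case: f; case: f'; rewrite /cut /=.
- by [].
- by rewrite mulrBr mulr1 ee subrr.
- by rewrite mulrBl mul1r ee subrr.
- by rewrite mulrBr mulr1 mulrBl mul1r ee subrr subr0.
Qed.

Lemma cut_comm f e e' : GRing.comm e e' -> GRing.comm e (cut f e').
Proof. by case: f => // ce; apply: commrB => //; exact: commr1. Qed.

Lemma sum_cut e : \sum_f cut f e = 1.
Proof. by rewrite big_bool /= addrC subrK. Qed.

Lemma cut_partial e (f b : bool) : e * e = e ->
  (if b then 1 else e) * cut f e = (b || f)%:R *: cut f e.
Proof.
move=> ee; case: b; first by rewrite mul1r scale1r.
by rewrite -[X in X * _]/(cut true e) cutM //; case: f; rewrite /= ?scale1r ?scale0r.
Qed.

Variables e1 e2 e3 : A.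
Hypotheses (e11 : e1 * e1 = e1) (e22 : e2 * e2 = e2) (e33 : e3 * e3 = e3).
Hypotheses (e12 : GRing.comm e1 e2) (e13 : GRing.comm e1 e3) (e23 : GRing.comm e2 e3).

Definition cut3 (f : bool * bool * bool) : A :=
  cut f.1.1 e1 * cut f.1.2 e2 * cut f.2 e3.

Lemma mul_cut3 x1 x2 x3 (f : bool * bool * bool) : GRing.comm x2 e1 -> GRing.comm x3 e1 -> GRing.comm x3 e2 ->
  x1 * x2 * x3 * cut3 f = x1 * cut f.1.1 e1 * (x2 * cut f.1.2 e2) * (x3 * cut f.2 e3).
Proof.
move=> /(cut_comm f.1.1) c21 /(cut_comm f.1.1) c31 /(cut_comm f.1.2) c32.
rewrite /cut3 !mulrA; congr (_ * _).
by rewrite -(mulrA _ x3) c31 mulrA -(mulrA x1) c21 -!mulrA c32.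
Qed.

Lemma cut3M (f f' : bool * bool * bool) : cut3 f * cut3 f' = if f == f' then cut3 f else 0.
Proof.
rewrite mul_cut3; first last.
- by apply/commr_sym/cut_comm.
- by apply/commr_sym/cut_comm.
- by apply/commr_sym/cut_comm.
rewrite !cutM //; case: f f' => [[f1 f2] f3] [[f1' f2'] f3'] /=; rewrite !xpair_eqE.
by do 3?case: ifP => _; rewrite /= ?mulr0 ?mul0r.
Qed.

Lemma sum_cut3 : \sum_f cut3 f = 1.
Proof.
transitivity ((\sum_f cut f e1) * (\sum_f cut f e2) * (\sum_f cut f e3)); last first.
  by rewrite !sum_cut !mulr1.
by rewrite [in RHS]big_distrlr [in RHS]pair_bigA [RHS]big_distrlr [RHS]pair_bigA.
Qed.
End Cuts.

Section Involution.
Variables (F : numFieldType) (A : algType F) (v : A).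
Hypothesis vv : v * v = 1.

Definition involution_idem : A := 2%:R^-1 *: (1 + v).
Local Notation q := involution_idem.

Lemma involution_idemM : q * q = q.
Proof.
rewrite /q -scalerAl -scalerAr scalerA mulrDl mul1r mulrDr mulr1 vv.
by rewrite (addrC v 1) -[X in _ *: X]mulr2n -scaler_nat scalerA divfK ?pnatr_eq0.
Qed.

Lemma involution_comm z : GRing.comm z v -> GRing.comm z q.
Proof.
move=> zw; rewrite /GRing.comm /q -scalerAr -scalerAl; congr (_ *: _).
exact: commrD (commr1 _) zw.
Qed.

Lemma cut_involution f : cut f q = 2%:R^-1 *: (1 + (-1) ^+ (~~ f) *: v).
Proof.
case: f; rewrite /= ?expr0 ?expr1 ?scale1r // scaleN1r /q /cut scalerBr scalerDr.
have {1}-> : 1 = 2%:R^-1 *: 1 + 2%:R^-1 *: 1 :> A.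
  rewrite -scalerDl; have := splitr (1 : F); rewrite mul1r => <-.
  by rewrite scale1r.
by rewrite opprD addrA addrK.
Qed.

Lemma involution_cut f : v * cut f q = (-1) ^+ (~~ f) *: cut f q.
Proof.
rewrite !cut_involution -scalerAr scalerA mulrC -scalerA; congr (_ *: _).
rewrite mulrDr mulr1 -scalerAr vv scalerDr scalerA -expr2 sqrr_sign scale1r.
exact: addrC.
Qed.
End Involution.

(** Doubling is negation modulo 3, so unless both flips are trivial the argument is uniformly
    distributed. *)
Lemma flip_average (V : zmodType) (b c : bool) (phi : 'I_3 -> V) :
  \sum_x \sum_y phi (x - flip b x + flip c y - y) =
  (if ~~ b && ~~ c then phi 0 *+ 3 else \sum_x phi x) *+ 3.
Proof.
have dblE (x : 'I_3) : x + x = - x.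
  have test : all (fun x : 'I_3 => x + x == - x) [:: 0; 1; 1 + 1] by [].
  by apply/eqP/(allP test); case: x => [[|[|[|x]]] xP].
have shift (u : 'I_3) : \sum_x phi (u + x) = \sum_x phi x.
  by rewrite [RHS](reindex_inj (addrI u)).
case: b; case: c; rewrite /flip /=.
- under eq_bigr => x _.
    under eq_bigr => y _ do rewrite opprK dblE -addrA -opprD dblE opprK.
    rewrite shift; over.
  by rewrite sumr_const card_ord.
- under eq_bigr => x _.
    under eq_bigr => y _ do rewrite opprK addrK dblE.
    rewrite sumr_const card_ord; over.
  rewrite sumrMnl; congr (_ *+ 3).
  by rewrite [RHS](reindex_inj oppr_inj).
- under eq_bigr => x _.
    under eq_bigr => y _ do rewrite subrr add0r -opprD dblE opprK.
    over.
  by rewrite sumr_const card_ord.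
- under eq_bigr => x _.
    under eq_bigr => y _ do rewrite subrr add0r subrr.
    rewrite sumr_const card_ord; over.
  by rewrite sumr_const card_ord.
Qed.

Lemma sum_mul_delta (A : nzRingType) (I : finType) (k : I -> A) i :
  \sum_x k x * (x == i)%:R = k i.
Proof.
rewrite (bigD1 i) //= eqxx mulr1 big1 ?addr0 // => x xi.
by rewrite (negPf xi) mulr0.
Qed.

(** Coefficients at 1 of the factors of a component idempotent: 1/3 or 2/3 for each group of order
    3, and 1/2 for the involution. *)
Lemma cut_weight (F : numFieldType) (f1 f2 : bool) :
  2%:R^-1 * ((if f1 then 3%:R^-1 else 1 - 3%:R^-1) *
             (if f2 then 3%:R^-1 else 1 - 3%:R^-1)) =
  (if f1 then 1 else 2%:R) * (if f2 then 1 else 2%:R) / 18%:R :> F.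
Proof. by case: f1; case: f2; field; rewrite ?pnatr_eq0. Qed.

Section Averages.
Variables (F : numFieldType) (A : algType F) (n : 'I_3 -> A).
Implicit Type f : bool.

Lemma mulr_1DZ (x y : A) (s : F) : x * (1 + s *: y) = x + s *: (x * y).
Proof. by rewrite mulrDr mulr1 -scalerAr. Qed.

Lemma cut_average f : n 0 = 1 ->
  cut f (3%:R^-1 *: \sum_x n x) =
  \sum_x (if f then 3%:R^-1 else (x == 0)%:R - 3%:R^-1) *: n x.
Proof.
move=> n0; rewrite scaler_sumr; case: f => //=.
under [RHS]eq_bigr => x _ do rewrite scalerBl.
rewrite sumrB; congr (_ - _); rewrite (bigD1 0) //= big1 ?addr0 ?scale1r ?n0 // => x x0.
by rewrite (negPf x0) scale0r.
Qed.
End Averages.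

(** In this case commutators of elements over [p] and [r] have zero component in the factor of order
    3 on which [c] acts; otherwise that component is uniformly distributed. *)
Definition fixed (P : finGroupType) (c : sign_char P) p r := ~~ c r && ~~ c p.

Section SdpSpectrum.
Variables (F : numFieldType) (P : finGroupType) (c1 c2 : sign_char P).
Variable a : cocycle (units F) P.
Hypothesis a11 : a (1%g, 1%g) = 0.
Local Notation G := (sdp c1 c2).
Let b : cocycle (units F) G := cocycle_pull (@sdp_projM P c1 c2) a.
Local Notation U := (tw_basis b).

Let n1 (x : 'I_3) : twisted_alg b := U (x, 0, 1%g).
Let n2 (y : 'I_3) : twisted_alg b := U (0, y, 1%g).
Let iota (p : P) : twisted_alg b := U (0, 0, p).
Let e1 : twisted_alg b := 3%:R^-1 *: \sum_x n1 x.
Let e2 : twisted_alg b := 3%:R^-1 *: \sum_y n2 y.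

Let UM (g h : G) : a (g.2, h.2) = 0 -> U g * U h = U (g * h)%g.
Proof. by move=> gh; rewrite tw_basisM ffunE /= gh scale1r. Qed.

Let a1l p : a (1%g, p) = 0. Proof. by rewrite cocycle1l. Qed.
Let a1r p : a (p, 1%g) = 0. Proof. by rewrite cocycle1r. Qed.

Let U1 : U 1%g = 1.
Proof. by rewrite tw_basis1 ffunE /= a11 scale1r. Qed.

Let n12E x y : n1 x * n2 y = U (x, y, 1%g).
Proof.
rewrite UM ?a1l //; congr (U _).
by rewrite !sdpM /sdp_mul /= !sign_of1 /= !addr0 !add0r !mul1g.
Qed.

Let UE x y p : U (x, y, p) = n1 x * n2 y * iota p.
Proof.
rewrite n12E UM ?a1l //; congr (U _).
by rewrite !sdpM /sdp_mul /= !sign_of1 /= !addr0 !mul1g.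
Qed.

Let n1M x x' : n1 x * n1 x' = n1 (x + x').
Proof.
rewrite UM ?a1l //; congr (U _).
by rewrite !sdpM /sdp_mul /= !sign_of1 /= !addr0 !mul1g.
Qed.

Let n2M x x' : n2 x * n2 x' = n2 (x + x').
Proof.
rewrite UM ?a1l //; congr (U _).
by rewrite !sdpM /sdp_mul /= !sign_of1 /= !addr0 !mul1g.
Qed.

Let n12C x y : n1 x * n2 y = n2 y * n1 x.
Proof.
rewrite n12E UM ?a1l //; congr (U _).
by rewrite !sdpM /sdp_mul /= !sign_of1 /= !addr0 !add0r !mul1g.
Qed.

Let comm_shift (c : sign_char P) (p r : P) (x x' : 'I_3) :=
  x - flip (c r) x + flip (c p) x' - x'.

Let sdp_commE (x y : 'I_3) p (x' y' : 'I_3) r (g := (x, y, p) : G) (h := (x', y', r) : G) :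
  (g * h * g^-1 * h^-1)%g =
    (comm_shift c1 p r x x', comm_shift c2 p r y y', p * r * p^-1 * r^-1)%g.
Proof.
apply: (mulIg (h * g)%g); rewrite !mulgA !mulgKV !sdpM /sdp_mul /=.
rewrite /comm_shift !sign_ofM !sign_ofV.
have cc (c : bool) d : c (+) d (+) c (+) d = false by case: c; case: d.
rewrite !cc /= !mulgKV.
by congr (_, _, _); rewrite subrK addrAC subrK.
Qed.

Let sum_prod (I J : finType) (f : I -> twisted_alg b) (g : J -> twisted_alg b) :
  \sum_(q : I * J) f q.1 * g q.2 = (\sum_i f i) * (\sum_j g j).
Proof. by rewrite [RHS]big_distrlr [RHS]pair_bigA. Qed.

Let comm_average (c : sign_char P) p r (n : 'I_3 -> twisted_alg b) : n 0 = 1 ->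
  \sum_x \sum_y n (comm_shift c p r x y) =
  9%:R *: (if fixed c p r then 1 else 3%:R^-1 *: \sum_x n x).
Proof.
move=> n0; rewrite flip_average n0 -/(fixed c p r).
have -> : 9%:R = 3%:R * 3%:R :> F by rewrite -natrM.
case: (fixed c p r); rewrite -scalerA -!scaler_nat !scalerA // mulfK ?pnatr_eq0 //.
Qed.

(** Summing over Z_3^2 turns each factor of order 3 into 9 times either 1 or its averaging
    idempotent, whence 81. *)
Let sdp_commutator_sum : commutator_sum b =
  \sum_p \sum_r (81%:R * uval (comm_phase a p r)) *:
    ((if fixed c1 p r then 1 else e1) * (if fixed c2 p r then 1 else e2) *
     iota (p * r * p^-1 * r^-1)%g).
Proof.
pose E p r (q q' : 'I_3 * 'I_3) : twisted_alg b := uval (comm_phase a p r) *: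
   (n1 (comm_shift c1 p r q.1 q'.1) * n2 (comm_shift c2 p r q.2 q'.2) *
    iota (p * r * p^-1 * r^-1)%g).
rewrite commutator_sumE.
transitivity (\sum_(q : 'I_3 * 'I_3) \sum_p \sum_(q' : 'I_3 * 'I_3) \sum_r E p r q q').
  rewrite [RHS]pair_bigA; apply: eq_bigr => -[[x y] p] _; rewrite [RHS]pair_bigA.
  apply: eq_bigr => -[[x' y'] r] _; rewrite sdp_commE UE /E /=; congr (_ *: _).
  by rewrite /comm_phase sdp_commE !ffunE.
rewrite exchange_big; apply: eq_bigr => p _.
under eq_bigr => q _ do rewrite exchange_big.
rewrite exchange_big; apply: eq_bigr => r _.
transitivity (uval (comm_phase a p r) *: ((\sum_x \sum_x' n1 (comm_shift c1 p r x x')) *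
   (\sum_x \sum_x' n2 (comm_shift c2 p r x x')) * iota (p * r * p^-1 * r^-1)%g)).
  rewrite -sum_prod mulr_suml scaler_sumr; apply: eq_bigr => q _.
  by rewrite -sum_prod mulr_suml scaler_sumr.
rewrite !comm_average; try exact: U1.
by rewrite -!scalerAl -scalerAr -!scalerAl !scalerA -natrM mulrC.
Qed.

Variable w : P.
Hypotheses (w1 : w != 1%g) (ww : (w * w = 1)%g) (aw : a (w, w) = 0).
Hypotheses (c1w : ~~ c1 w) (c2w : ~~ c2 w).
Hypothesis comm_w : forall p r, (p * r * p^-1 * r^-1)%g = if (p * r == r * p)%g then 1%g else w.

Let q : twisted_alg b := involution_idem (iota w).

Let iww : iota w * iota w = 1.
Proof. by rewrite UM // -U1 sdpM /sdp_mul /= ww !flip0 !addr0. Qed.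

Let n1w x : n1 x * iota w = iota w * n1 x.
Proof.
rewrite !UM ?a1l ?a1r //; congr (U _).
by rewrite !sdpM /sdp_mul /= (negPf c1w) !sign_of1 /= !flip0 !addr0 !add0r mulg1 mul1g.
Qed.

Let n2w x : n2 x * iota w = iota w * n2 x.
Proof.
rewrite !UM ?a1l ?a1r //; congr (U _).
by rewrite !sdpM /sdp_mul /= (negPf c2w) !sign_of1 /= !flip0 !addr0 !add0r mulg1 mul1g.
Qed.

Let qq : q * q = q. Proof. exact: involution_idemM. Qed.

Let average_idem (n : 'I_3 -> twisted_alg b) (e := 3%:R^-1 *: \sum_x n x) :
  (forall x y, n x * n y = n (x + y)) -> e * e = e.
Proof.
move=> nM; rewrite /e -scalerAl -scalerAr scalerA mulr_suml.
have shift x : n x * \sum_y n y = \sum_y n y.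
  by rewrite mulr_sumr [RHS](reindex_inj (addrI x)); apply: eq_bigr => y _.
under eq_bigr => x _ do rewrite shift.
by rewrite sumr_const card_ord -scaler_nat scalerA divfK ?pnatr_eq0.
Qed.

Let e1e1 : e1 * e1 = e1. Proof. exact: average_idem n1M. Qed.
Let e2e2 : e2 * e2 = e2. Proof. exact: average_idem n2M. Qed.

Let average_comm (n : 'I_3 -> twisted_alg b) z : (forall x, GRing.comm z (n x)) ->
  GRing.comm z (3%:R^-1 *: \sum_x n x).
Proof. by move=> zn; rewrite /GRing.comm -scalerAr -scalerAl commr_sum. Qed.

Let e12 : GRing.comm e1 e2.
Proof. by apply: average_comm => y; apply/commr_sym/average_comm => x; apply/esym/n12C. Qed.

Let e1w : GRing.comm e1 (iota w).
Proof. by apply/commr_sym/average_comm => x; exact/esym/n1w. Qed.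
Let e2w : GRing.comm e2 (iota w).
Proof. by apply/commr_sym/average_comm => x; exact/esym/n2w. Qed.

(* [commutator_sum b] acts as [81 * component_value f] on the component cut   *)
(* out by the idempotents e1, e2 and q (if f is true) or 1 - e1, 1 - e2 and   *)
(* 1 - q (if f is false).                                                     *)
Definition component_value (f : bool * bool * bool) : F := \sum_p \sum_r
  uval (comm_phase a p r) * ((fixed c1 p r || f.1.1) && (fixed c2 p r || f.1.2))%:R *
  (if (p * r == r * p)%g then 1 else (-1) ^+ ~~ f.2).

Let eps := cut3 e1 e2 q.

Let iota_cut p r (f : bool) : iota (p * r * p^-1 * r^-1)%g * cut f q =
  (if (p * r == r * p)%g then 1 else (-1) ^+ ~~ f) *: cut f q.
Proof.
rewrite comm_w; case: ifP => _; first by rewrite [iota _]U1 mul1r scale1r.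
exact: (@involution_cut _ _ (iota w) iww f).
Qed.

Let commutator_sum_cut : commutator_sum b = \sum_f (81%:R * component_value f) *: eps f.
Proof.
rewrite -[LHS]mulr1 -(@sum_cut3 _ _ e1 e2 q) mulr_sumr; apply: eq_bigr => f _.
rewrite sdp_commutator_sum mulr_suml mulr_sumr scaler_suml; apply: eq_bigr => p _.
rewrite mulr_suml mulr_sumr scaler_suml; apply: eq_bigr => r _.
move: (uval (comm_phase a p r)) => phi; rewrite -scalerAl mul_cut3; first last.
- by rewrite comm_w; case: ifP => _; [rewrite [iota _]U1; apply/commr_sym/commr1
    | exact/commr_sym/e2w].
- by rewrite comm_w; case: ifP => _; [rewrite [iota _]U1; apply/commr_sym/commr1
    | exact/commr_sym/e1w].
- by case: ifP => _; [apply/commr_sym/commr1 | apply/commr_sym/e12].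
rewrite (cut_partial _ _ e1e1) (cut_partial _ _ e2e2) iota_cut.
rewrite -!(scalerAl, scalerAr) !scalerA.
rewrite -mulnb natrM !mulrA; congr (_ *: _).
by rewrite [LHS](ACl (1*2*4*5*3)).
Qed.

Let coord_mul (k1 k2 : 'I_3 -> F) (s : F) :
  (\sum_x k1 x *: n1 x) * (\sum_y k2 y *: n2 y) * (2%:R^-1 *: (1 + s *: iota w)) =
  2%:R^-1 *: \sum_x \sum_y (k1 x * k2 y) *: (U (x, y, 1%g) + s *: U (x, y, w)).
Proof.
rewrite -scalerAr big_distrlr mulr_suml; congr (_ *: _); apply: eq_bigr => x _.
rewrite mulr_suml; apply: eq_bigr => y _.
rewrite /= -!(scalerAl, scalerAr) scalerA; congr (_ *: _).
transitivity (n1 x * n2 y + s *: (n1 x * n2 y * iota w)); first exact: mulr_1DZ.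
by congr (_ + s *: _); [exact: n12E | exact/esym/UE].
Qed.

Let coord1 (k1 k2 : 'I_3 -> F) (s : F) :
  ((\sum_x k1 x *: n1 x) * (\sum_y k2 y *: n2 y) * (2%:R^-1 *: (1 + s *: iota w))) 1%g =
  2%:R^-1 * (k1 0 * k2 0).
Proof.
have at1 x y z : U (x, y, z) 1%g = ((x == 0) && (y == 0) && (z == 1%g))%:R.
  by rewrite ffunE eq_sym.
have term x y : ((k1 x * k2 y) *: (U (x, y, 1%g) + s *: U (x, y, w))) 1%g =
    k1 x * (x == 0)%:R * (k2 y * (y == 0)%:R).
  rewrite ffunE [X in _ *: X]ffunE at1 ffunE at1 (negPf w1) andbF scaler0 addr0.
  by rewrite eqxx andbT -mulnb natrM; apply: mulrACA.
rewrite coord_mul ffunE sum_ffunE; congr (_ * _).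
transitivity (\sum_x \sum_y k1 x * (x == 0)%:R * (k2 y * (y == 0)%:R)).
  by apply: eq_bigr => x _; rewrite sum_ffunE; apply: eq_bigr => y _; exact: term.
under eq_bigr => x _ do rewrite -mulr_sumr sum_mul_delta mulrAC.
exact: sum_mul_delta.
Qed.

Let eps1 f : eps f 1%g = (if f.1.1 then 1 else 2%:R) * (if f.1.2 then 1 else 2%:R) / 18%:R.
Proof.
rewrite /eps /cut3 (@cut_average _ _ n1 _ U1) (@cut_average _ _ n2 _ U1) cut_involution.
by rewrite coord1 eqxx cut_weight.
Qed.

(** The commutator sum is a combination of eight orthogonal idempotents, so its powers are explicit
    and only the coefficients of the idempotents at 1 remain. *)
Lemma sdp_spectrum k : spectrum b k = #|{: G}|%:R * \sum_f
  (81%:R * component_value f) ^+ k *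
  ((if f.1.1 then 1 else 2%:R) * (if f.1.2 then 1 else 2%:R) / 18%:R).
Proof.
rewrite /spectrum cocycle_pullE a11 uval0 mulr1; congr (_ * _).
rewrite commutator_sum_cut (@idempotent_sum_exp _ _ _ eps); first last.
- exact: sum_cut3.
- exact: (cut3M e1e1 e2e2 qq e12 (involution_comm e1w) (involution_comm e2w)).
rewrite sum_ffunE; apply: eq_bigr => f _; rewrite ffunE; congr (_ * _).
exact: eps1.
Qed.

End SdpSpectrum.

(* The components of s tell which of x, c, y are sent to -1.                  *)
Fact pgrp_sign_subproof (s : bool * bool * bool) :
  {morph (fun p : pgrp => (s.1.1 && odd p.1.1) (+) (s.1.2 && odd p.1.2) (+) (s.2 && p.2)) :
    p q / (p * q)%g >-> p (+) q}.
Proof.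
move=> [[i k] j] [[i' k'] j']; have oddD (x y : 'I_4) : odd (x + y)%R = odd x (+) odd y.
  have test : all (fun x : 'I_4 => all (fun y : 'I_4 =>
    odd (x + y)%R == odd x (+) odd y) quarters) quarters by [].
  by move/allP/(_ x (quartersE x))/allP/(_ y (quartersE y))/eqP: test.
have odd_dbl b x : odd (dbl b x) = false.
  by case: b => //; rewrite /dbl oddD addbb.
rewrite -[LHS]/((s.1.1 && odd (i + i')%R) (+) (s.1.2 && odd (k + k' + dbl j i')%R)
  (+) (s.2 && (j (+) j'))) !oddD odd_dbl addbF.
by case: s => [[[] []] []]; case: (odd i); case: (odd i'); case: (odd k);
  case: (odd k'); case: j; case: j'.
Qed.
Definition pgrp_sign s : sign_char pgrp := SignChar (pgrp_sign_subproof s).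

(** * Evaluation of the spectra over the group of order 32 *)

Lemma pgrp_sign_gc2 s : ~~ pgrp_sign s (gc * gc)%g.
Proof. by case: s => [[[] []] []]. Qed.

(* [pgrp_cocycle] as a power of 'i, in a form that computes.                  *)
Definition exponent (s t : nat) (p q : pgrp) : nat :=
  (p.1.2 * q.1.1 + fall2 p.2 q.1.1)%R * s + dbl p.2 q.1.2 * t.

(** [3 *] is negation modulo 4. *)
Definition comm_exponent (s t : nat) (p r : pgrp) : nat :=
  exponent s t p r + 3 * exponent s t r p +
  3 * exponent s t (p * r * p^-1 * r^-1)%g (r * p)%g.

Definition comm_data (c1 c2 : sign_char pgrp) s t : seq (bool * bool * bool * nat) :=
  [seq (fixed c1 p r, fixed c2 p r, (p * r != r * p)%g, comm_exponent s t p r) |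
    p <- pgrp_seq, r <- pgrp_seq].

(** The added 2 is the sign of a nontrivial commutator on the components where the central
    involution acts as -1. *)
Definition component_exponents (d : seq (bool * bool * bool * nat))
    (f : bool * bool * bool) : seq nat :=
  [seq x.2 + 2 * (x.1.2 && ~~ f.2) | x <- d &
    (x.1.1.1 || f.1.1) && (x.1.1.2 || f.1.2)]%N.

Definition quarter_counts (s : seq nat) : seq nat :=
  [seq count (fun e => e %% 4 == m)%N s | m <- iota 0 4].

Definition components : seq (bool * bool * bool) :=
  [seq (f12, f3) |
     f12 <- [seq (f1, f2) | f1 <- [:: false; true], f2 <- [:: false; true]],
     f3 <- [:: false; true]].

Lemma big_enumeration (V : nmodType) (I : finType) (s : seq I) (E : I -> V) :
  uniq s -> (forall i, i \in s) -> \sum_i E i = \sum_(i <- s) E i.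
Proof.
move=> Us sI; apply: perm_big; apply: uniq_perm => //; first exact: index_enum_uniq.
by move=> i; rewrite sI mem_index_enum.
Qed.

Lemma pgrp_seqE (p : pgrp) : p \in pgrp_seq.
Proof.
case: p => [[i k] j]; apply/allpairs_f; last by case: j.
exact/allpairs_f/quartersE/quartersE.
Qed.

Lemma pgrp_seq_uniq : uniq pgrp_seq. Proof. by []. Qed.

Lemma pgrp_comm (p r : pgrp) :
  (p * r * p^-1 * r^-1)%g = if (p * r == r * p)%g then 1%g else (gc * gc)%g.
Proof.
have test : all (fun p => all (fun r =>
    (p * r * p^-1 * r^-1)%g == if (p * r == r * p)%g then 1%g else (gc * gc)%g)
    pgrp_seq) pgrp_seq.
  by vm_compute.
by move/allP/(_ p (pgrp_seqE p))/allP/(_ r (pgrp_seqE r))/eqP: test.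
Qed.

Section PgrpSpectrum.
Variable F : numClosedFieldType.
Local Notation i := ('i : F).

Lemma sum_imag (s : seq nat) (n := quarter_counts s) : \sum_(e <- s) i ^+ e =
  (nth 0%N n 0)%:R - (nth 0%N n 2)%:R + i * ((nth 0%N n 1)%:R - (nth 0%N n 3)%:R).
Proof.
rewrite {}/n; elim: s => [|e s IHs]; first by rewrite big_nil /= !subr0 mulr0 addr0.
rewrite big_cons {}IHs /=.
have [p2 p3] : i ^+ 2 = -1 /\ i ^+ 3 = - i.
  by split; rewrite ?sqrCi // exprS sqrCi mulrN1.
rewrite -(prim_expr_mod (imag_prim F)); have : (e %% 4 < 4)%N by rewrite ltn_mod.
case: (e %% 4)%N => [|[|[|[|m]]]] //= _;
  rewrite ?expr0 ?expr1 ?p2 ?p3 ?add0n ?natrD; ring.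
Qed.

Lemma component_valueE c1 c2 s t f :
  component_value c1 c2 (pgrp_cocycle F s t) f =
  \sum_(e <- component_exponents (comm_data c1 c2 s t) f) i ^+ e.
Proof.
have phase p r : uval (comm_phase (pgrp_cocycle F s t) p r) = i ^+ comm_exponent s t p r.
  have expE g h : pgrp_cocycle F s t (g, h) = imag F *+ exponent s t g h.
    by rewrite pgrp_cocycleE !ffunE.
  have N3 n : - (imag F *+ n) = imag F *+ (3 * n).
    apply: (addIr (imag F *+ n)); rewrite addNr -mulrnDr -mulSnr mulrnA imag4.
    by rewrite mul0rn.
  by rewrite /comm_phase !expE !N3 -!mulrnDr uvalMn.
rewrite /component_exponents big_map big_filter big_mkcond big_allpairs_dep /=.
rewrite /component_value (big_enumeration _ pgrp_seq_uniq pgrp_seqE).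
apply: eq_bigr => p _; rewrite (big_enumeration _ pgrp_seq_uniq pgrp_seqE).
apply: eq_bigr => r _; rewrite phase.
case: ((fixed c1 p r || f.1.1) && _); last by rewrite mulr0 mul0r.
rewrite mulr1 exprD exprM sqrCi; congr (_ * _).
by case: (_ == _); rewrite /= ?expr0.
Qed.
End PgrpSpectrum.

Definition component_counts (d : seq (bool * bool * bool * nat)) :=
  [seq quarter_counts (component_exponents d f) | f <- components].

(* A sum of powers of 'i with these counts is a natural number.               *)
Definition balanced (n : seq nat) :=
  (nth 0 n 1 == nth 0 n 3)%N && (nth 0 n 2 <= nth 0 n 0)%N.

(** One sixteenth of the dimension of the component: 288/18 = 16. *)
Definition weight (f : bool * bool * bool) : nat :=
  (if f.1.1 then 1 else 2) * (if f.1.2 then 1 else 2).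

Definition weighted_values (ns : seq (seq nat)) : seq nat :=
  flatten [seq nseq (weight fn.1) (nth 0 fn.2 0 - nth 0 fn.2 2)%N | fn <- zip components ns].

Section SdpPgrpSpectrum.
Variables (F : numClosedFieldType) (s1 s2 : bool * bool * bool).
Local Notation c1 := (pgrp_sign s1).
Local Notation c2 := (pgrp_sign s2).

Lemma sdp_pgrp_spectrum s t k (ns := component_counts (comm_data c1 c2 s t)) : all balanced ns ->
  spectrum (sdp_cocycle F c1 c2 s t) k =
  288%:R * (81%:R ^+ k / 18%:R * \sum_(v <- weighted_values ns) v%:R ^+ k).
Proof.
have a0 p q : (p.1.2 * q.1.1 + fall2 p.2 q.1.1)%R = 0 -> dbl p.2 q.1.2 = 0 ->
    pgrp_cocycle F s t (p, q) = 0.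
  by move=> e1 e2; rewrite pgrp_cocycleE !ffunE e1 e2 !mul0n mulr0n.
have a11 : pgrp_cocycle F s t (1%g, 1%g) = 0 by apply: a0; apply/eqP.
have aw : pgrp_cocycle F s t ((gc * gc)%g, (gc * gc)%g) = 0 by apply: a0; apply/eqP.
have w1 : (gc * gc)%g != 1%g by [].
have ww : (gc * gc * (gc * gc) = 1)%g by apply/eqP.
rewrite /sdp_cocycle.
rewrite (sdp_spectrum a11 w1 ww aw (pgrp_sign_gc2 _) (pgrp_sign_gc2 _) pgrp_comm).
rewrite card_sdp card_pgrp => bal_ns; congr (_ * _).
rewrite (big_enumeration (s := components)) //; last by case=> [[[] []] []].
move: bal_ns; rewrite /weighted_values {}/ns /component_counts.
elim: components => [|f fs IHs] /=; first by rewrite !big_nil mulr0.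
case/andP => /andP[/eqP n13 n20] /IHs; rewrite !big_cons big_cat mulrDr => -> /=.
congr (_ + _); rewrite component_valueE sum_imag n13 subrr mulr0 addr0 -natrB //.
rewrite big_nseq iter_addr_0 exprMn -[_ *+ weight f]mulr_natr /weight natrM.
by case: f {n13 n20} => [[[] []] f3] /=; ring.
Qed.
End SdpPgrpSpectrum.

(** Passing the counts through [check] lets [vm_compute] evaluate each table once. *)
Definition spectra_agree (st uv : 'I_4 * 'I_2) : bool :=
  let check nG nH :=
    [&& all balanced nG, all balanced nH & perm_eq (weighted_values nG) (weighted_values nH)] in
  check (component_counts (comm_data (pgrp_sign (true, true, false))
                                     (pgrp_sign (true, false, false)) st.1 st.2))
        (component_counts (comm_data (pgrp_sign (false, true, true))
                                     (pgrp_sign (false, false, true)) uv.1 uv.2)).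

Definition swap_class (st : 'I_4 * 'I_2) : 'I_4 * 'I_2 :=
  if st == (1 + 1, 0) then (0, 1) else if st == (0, 1) then (1 + 1, 0) else st.

Lemma swap_classK : involutive swap_class.
Proof.
by case=> [[[|[|[|[|x]]]] xP] [[|[|y]] yP]] //; apply/eqP.
Qed.

Lemma quarters_halvesE (st : 'I_4 * 'I_2) : st \in [seq (s, t) | s <- quarters, t <- [:: 0; 1]].
Proof.
by case: st => s t; apply: allpairs_f (quartersE s) _; case: t => [[|[|t]] tP].
Qed.

Lemma swap_spectra_agree st : spectra_agree st (swap_class st).
Proof.
have test : all (fun st => spectra_agree st (swap_class st))
  [seq (s, t) | s <- quarters, t <- [:: 0; 1]] by vm_compute.
exact: (allP test) (quarters_halvesE st).
Qed.

Lemma sum_values_perm (F : numFieldType) k (vs ws : seq nat) : perm_eq vs ws ->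
  288%:R * (81%:R ^+ k / 18%:R * \sum_(v <- vs) v%:R ^+ k) =
  288%:R * (81%:R ^+ k / 18%:R * \sum_(v <- ws) v%:R ^+ k) :> F.
Proof. by move=> eq_vw; rewrite (perm_big ws eq_vw). Qed.

Lemma sum_values_inj (F : numFieldType) (vs ws : seq nat) :
  288%:R * (81%:R ^+ 1 / 18%:R * \sum_(v <- vs) v%:R ^+ 1) =
  288%:R * (81%:R ^+ 1 / 18%:R * \sum_(v <- ws) v%:R ^+ 1) :> F -> sumn vs = sumn ws.
Proof.
have sum_sumn (us : seq nat) : \sum_(v <- us) v%:R ^+ 1 = (sumn us)%:R :> F.
  elim: us => [|u us IHus]; first by rewrite big_nil.
  by rewrite big_cons IHus expr1 -natrD.
rewrite !sum_sumn => /mulfI; rewrite pnatr_eq0 => /(_ isT)/mulfI.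
rewrite mulf_neq0 ?invr_eq0 ?expf_neq0 ?pnatr_eq0 // => /(_ isT)/eqP.
by rewrite eqr_nat => /eqP.
Qed.

(** * The counterexample *)

Section Pair.
Variable F : numClosedFieldType.
Local Notation c1G := (pgrp_sign (true, true, false)).
Local Notation c2G := (pgrp_sign (true, false, false)).
Local Notation c1H := (pgrp_sign (false, true, true)).
Local Notation c2H := (pgrp_sign (false, false, true)).
Local Notation G := (sdp c1G c2G).
Local Notation H := (sdp c1H c2H).
Local Notation classG := (@sdp_class F c1G c2G).
Local Notation classH := (@sdp_class F c1H c2H).

(** The element [gc] inverts the first factor of Z_3^2 and fixes the second, as [sdp_class_bij]
    requires; it does so in [H] too. *)
Lemma bij_classG : bijective classG.
Proof. by apply: (@sdp_class_bij F c1G c2G gc). Qed.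

Lemma bij_classH : bijective classH.
Proof. by apply: (@sdp_class_bij F c1H c2H gc). Qed.

Lemma spectra_agreeP st uv : spectra_agree st uv ->
  class_spectrum (classG st) = class_spectrum (classH uv).
Proof.
case/and3P => balG balH agree; rewrite !class_spectrumE; apply/funext => k.
rewrite (sdp_pgrp_spectrum F k balG) (sdp_pgrp_spectrum F k balH).
exact: (sum_values_perm F k agree).
Qed.

Lemma multipliers_iso : zmod_iso (H2 (units F) G) (H2 (units F) H).
Proof.
apply: (zmod_iso_trans (zmod_iso_sym _)); first by exists classG; exact: bij_classG.
by exists classH; exact: bij_classH.
Qed.

Lemma bijectivity_GH : bijectivity_condition F G H.
Proof.
have [g gK Kg] := bij_classG.
exists (classH \o swap_class \o g); split.
  apply: bij_comp; last by exists classG.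
  exact: bij_comp bij_classH (inv_bij swap_classK).
move=> a b /= ab; apply/alg_isoP => k; rewrite -!class_spectrumE -ab.
by rewrite -(spectra_agreeP (swap_spectra_agree _)) Kg.
Qed.

Lemma double_classes (uv : 'I_4 * 'I_2) : uv + uv = 0 \/ uv + uv = (1 + 1, 0).
Proof.
by case: uv => [[[|[|[|[|u]]]] uP] [[|[|v]] vP]] //; [left|left|right|right|left|left|right|right];
  apply/eqP.
Qed.

(** The image of (2,0) = 2(1,0) is a nonzero double, hence (2,0) itself; but the values of the
    spectra at 1 differ there. *)
Lemma not_equiv_GH : ~ twisted_equiv F G H.
Proof.
case=> psi [bij_psi psiP]; have [g gK Kg] := bij_classH.
have dbl20 : classG (1 + 1, 0) = classG (1, 0) + classG (1, 0).
  by rewrite -raddfD; congr classG; apply/eqP.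
pose y := g (psi (classG (1, 0))).
have psi_dbl : psi (classG (1 + 1, 0)) = classH (y + y).
  by rewrite dbl20 raddfD [RHS]raddfD /= /y Kg.
have psi20 : psi (classG (1 + 1, 0)) = classH (1 + 1, 0).
  have [y0|yE] := double_classes y; last by rewrite psi_dbl yE.
  have : psi (classG (1 + 1, 0)) = psi (classG 0) by rewrite psi_dbl y0 !raddf0.
  by move/(bij_inj bij_psi)/(bij_inj bij_classG)/eqP.
(* The swap results are used here only to know that the counts of (2,0) are balanced, in [G] and in
   [H]. *)
have /and3P[balG _ _] := swap_spectra_agree (1 + 1, 0).
have swap01 : swap_class (0, 1) = (1 + 1, 0) by apply/eqP.
have := swap_spectra_agree (0, 1); rewrite {}swap01 => /and3P[_ balH _].
have /alg_isoP/(_ 1%N) := psiP _ _ psi20.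
rewrite (sdp_pgrp_spectrum F 1 balG) (sdp_pgrp_spectrum F 1 balH).
by move/sum_values_inj/eqP; apply/negP; vm_compute.
Qed.
End Pair.

Theorem theorem4 (R : realType) :
  (exists G H : finGroupType,
     [/\ #|G| = 288%N, #|H| = 288%N,
         zmod_iso (schur_multiplier R G) (schur_multiplier R H),
         bijectivity_condition R[i] G H
       & ~ twisted_equiv R[i] G H])
  /\
  (forall G H : finGroupType,
     zmod_iso (schur_multiplier R G) (schur_multiplier R H) ->
     bijectivity_condition R[i] G H ->
     [\/ zmod_cyclic (schur_multiplier R G),
         zmod_iso (schur_multiplier R G) ('Z_2 * 'Z_2)%type
       | zmod_iso (schur_multiplier R G) ('Z_3 * 'Z_3)%type] ->
     twisted_equiv R[i] G H).
Proof.
split; last by move=> G H; exact: small_multiplier_equiv.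
exists (sdp (pgrp_sign (true, true, false)) (pgrp_sign (true, false, false))).
exists (sdp (pgrp_sign (false, true, true)) (pgrp_sign (false, false, true))).
split.
- by rewrite card_sdp card_pgrp.
- by rewrite card_sdp card_pgrp.
- exact: multipliers_iso.
- exact: bijectivity_GH.
- exact: not_equiv_GH.
Qed.
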